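(* Let $A$ be a $2$-Gorenstein acyclic monomial algebra with a natural labelling of its vertices (simple modules). Then the following are equivalent: (i) $A$ is Auslander regular; (ii) there exists a Bruhat decomposition $C_A=U_1PU_2$ of the Coxeter matrix with $U_1$ the identity matrix. In this case, the Coxeter permutation coincides with the Auslander-Reiten permutation.
   Context: $A=KQ/I$ is a finite dimensional quiver algebra over a field $K$, $Q$ finite, connected and acyclic, $I$ admissible and generated by paths (monomial). Modules are finitely generated right modules, $P(i)=e_iA$, $I(i)=D(Ae_i)$. A natural labelling numbers the vertices $1,\ldots,n$ with $i<j$ whenever there is a path from $i$ to $j\neq i$. Let $0\to A_A\to I^0\to I^1\to\cdots$ be a minimal injective coresolution; $A$ is $2$-Gorenstein if $\operatorname{pdim}I^0\le0$ and $\operatorname{pdim}I^1\le1$, and Auslander regular if it has finite global dimension and $\operatorname{pdim}I^i\le i$ for all $i$. For Auslander regular $A$, $\Omega^{\operatorname{pdim}I(i)}(I(i))\cong P(j)$ is indecomposable projective and the Auslander-Reiten permutation is $\hat\psi(i)=j$. Cartan matrix $\omega_A=(\dim_Ke_jAe_i)_{i,j}$, Coxeter matrix $C_A=-\omega_A^T\omega_A^{-1}$. A Bruhat decomposition $M=U_1PU_2$ of an invertible matrix has $U_1,U_2$ upper triangular and $P$ a permutation matrix (unique); the Coxeter permutation is $p_A(i)=j$ if the non-zero entry of column $i$ of $P$ in a Bruhat decomposition of $C_A$ lies in row $j$. *)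

(* Defs.v *)
From HB Require Import structures.
From mathcomp Require Import all_boot all_order all_algebra.
Set Implicit Arguments. Unset Strict Implicit. Unset Printing Implicit Defensive.
Import Order.TTheory GRing.Theory Num.Theory.
Local Open Scope ring_scope.

(* A finite quiver Q with vertices 'I_qn, arrows 'I_qm (arrow a : qsrc a -> *)
(* qtgt a), together with a finite list of monomial relations (paths, given *)
(* as sequences of arrows read from their start to their end).  The ideal I *)
(* is the two-sided ideal of KQ generated by these paths.                   *)
(* Path convention (Assem-Simson-Skowronski): a path from x to y is written *)
(* a_1 a_2 ... a_l with qsrc a_1 = x, qtgt a_k = qsrc a_(k+1), qtgt a_l = y;*)
(* e_x p e_y = p.  Right A-modules = representations of (Q, I).            *)
Record monquiver := MonQuiver {
  qn : nat; qm : nat;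
  qsrc : 'I_qm -> 'I_qn; qtgt : 'I_qm -> 'I_qn;
  qrels : seq (seq 'I_qm) }.

Section Quiver.
Variable Q : monquiver.
Local Notation n := (qn Q).
Local Notation m := (qm Q).
Local Notation src := (@qsrc Q).
Local Notation tgt := (@qtgt Q).

Fixpoint composable (s : nat) (l : seq 'I_m) : bool :=
  if l is a :: l' then (src a == s :> nat) && composable (tgt a) l' else true.

Definition ptgt (s : nat) (l : seq 'I_m) : nat := last s [seq (tgt a : nat) | a <- l].

(* a path (start vertex, arrows); trivial paths e_s are (s, [::]) *)
Definition qpath := (nat * seq 'I_m)%type.

(* a path is non-zero in A = KQ/I iff it contains no relation as a subpath *)
Definition nonzero_path (l : seq 'I_m) : bool := ~~ has (fun r => infix r l) (@qrels Q).

Definition acyclic : Prop :=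
  forall (s : 'I_n) l, composable s l -> l != [::] -> ptgt s l != s.

Definition natural_labelling : Prop :=
  forall (s : 'I_n) l, composable s l -> l != [::] -> (s < ptgt s l)%N.

Definition adj_rel : rel 'I_n :=
  fun i j => [exists a, ((src a == i) && (tgt a == j)) || ((src a == j) && (tgt a == i))].

Definition quiver_connected : Prop := (0 < n)%N /\ forall i j, connect adj_rel i j.

(* I is generated by paths of length >= 2 (monomial, inside R^2; for an    *)
(* acyclic quiver such an ideal is automatically admissible)               *)
Definition monomial_admissible : Prop :=
  forall r, r \in qrels Q -> (2 <= size r)%N /\ exists s : 'I_n, composable s r.

Fixpoint allseqs (k : nat) : seq (seq 'I_m) :=
  if k is k'.+1 then [seq a :: s | a <- enum 'I_m, s <- allseqs k'] else [:: [::]].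

(* all non-zero paths (a K-basis of A); Q acyclic => length < n *)
Definition nzpaths : seq qpath :=
  [seq (i, l) | i <- iota 0 n,
     l <- [seq l <- flatten [seq allseqs k | k <- iota 0 n] |
            composable i l && nonzero_path l]].

Definition act_right (p : qpath) (a : 'I_m) : option qpath :=
  if (ptgt p.1 p.2 == src a) && nonzero_path (rcons p.2 a)
  then Some (p.1, rcons p.2 a) else None.

(* action of an arrow a on the dual basis element p^* of D(A e_i):         *)
(* p^* . a = x^* if p = a x, and 0 otherwise                               *)
Definition act_dual (p : qpath) (a : 'I_m) : option qpath :=
  if p.2 is b :: l' then (if b == a then Some (tgt a : nat, l') else None)
  else None.

Definition pend (p : qpath) : nat := ptgt p.1 p.2.
Definition pstart (p : qpath) : nat := p.1.

Section Modules.
Variable K : fieldType.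

(* A finite-dimensional right module, in matrix form acting on row vectors: *)
(* mE i is the action of e_i, mX a the action of the arrow a.               *)
Record amod := AMod {
  mdim : nat;
  mE : 'I_n -> 'M[K]_mdim;
  mX : 'I_m -> 'M[K]_mdim }.

Definition pathmx (M : amod) (l : seq 'I_m) : 'M[K]_(mdim M) :=
  foldl (fun A a => A *m mX M a) 1%:M l.

Definition is_module (M : amod) : Prop :=
  [/\ \sum_i mE M i = 1%:M,
      forall i j, mE M i *m mE M j = if i == j then mE M i else 0,
      forall a, mE M (src a) *m mX M a = mX M a /\ mX M a *m mE M (tgt a) = mX M a
    & forall r, r \in qrels Q -> pathmx M r = 0].

Definition is_hom (M N : amod) (f : 'M[K]_(mdim M, mdim N)) : Prop :=
  (forall i, mE M i *m f = f *m mE N i) /\ (forall a, mX M a *m f = f *m mX N a).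

Definition mod_iso (M N : amod) : Prop :=
  exists f : 'M[K]_(mdim M, mdim N), is_hom f /\ row_free f /\ row_full f.

Definition projective (M : amod) : Prop :=
  forall (X Y : amod) (g : 'M[K]_(mdim X, mdim Y)) (f : 'M[K]_(mdim M, mdim Y)),
    is_module X -> is_module Y -> is_hom g -> row_full g -> is_hom f ->
    exists h : 'M[K]_(mdim M, mdim X), is_hom h /\ h *m g = f.

Definition injective (M : amod) : Prop :=
  forall (X Y : amod) (f : 'M[K]_(mdim X, mdim Y)) (g : 'M[K]_(mdim X, mdim M)),
    is_module X -> is_module Y -> is_hom f -> row_free f -> is_hom g ->
    exists h : 'M[K]_(mdim Y, mdim M), is_hom h /\ f *m h = g.

Definition is_submod (M : amod) k (U : 'M[K]_(k, mdim M)) : Prop :=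
  (forall i, (U *m mE M i <= U)%MS) /\ (forall a, (U *m mX M a <= U)%MS).

Definition superfluous (M : amod) k (U : 'M[K]_(k, mdim M)) : Prop :=
  forall k' (V : 'M[K]_(k', mdim M)), is_submod V ->
    (1%:M <= U + V)%MS -> (1%:M <= V)%MS.

Definition essential (M : amod) k (U : 'M[K]_(k, mdim M)) : Prop :=
  forall k' (V : 'M[K]_(k', mdim M)), is_submod V ->
    (0 < \rank V)%N -> (0 < \rank (U :&: V))%N.

Record presol (M : amod) := PResol {
  rP : nat -> amod;
  rd : forall k, 'M[K]_(mdim (rP k.+1), mdim (rP k));
  reps : 'M[K]_(mdim (rP 0), mdim M) }.

Definition is_presol (M : amod) (R : presol M) : Prop :=
  [/\ forall k, is_module (rP R k) /\ projective (rP R k),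
      is_hom (reps R) /\ forall k, is_hom (rd R k),
      row_full (reps R),
      (rd R 0 == kermx (reps R))%MS
    & forall k, (rd R k.+1 == kermx (rd R k))%MS].

(* minimal: each P_k -> Omega^k M is a projective cover *)
Definition minimal_presol (M : amod) (R : presol M) : Prop :=
  is_presol R /\ superfluous (kermx (reps R)) /\
  forall k, superfluous (kermx (rd R k)).

Definition pdim_le (M : amod) (d : nat) : Prop :=
  exists R : presol M, is_presol R /\ forall k, (d < k)%N -> mdim (rP R k) = 0%N.

Definition pdim_eq (M : amod) (d : nat) : Prop :=
  pdim_le M d /\ forall e, pdim_le M e -> (d <= e)%N.

Record icoresol (N : amod) := ICoresol {
  cI : nat -> amod;
  cd : forall k, 'M[K]_(mdim (cI k), mdim (cI k.+1));
  ceta : 'M[K]_(mdim N, mdim (cI 0)) }.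

Definition minimal_icoresol (N : amod) (C : icoresol N) : Prop :=
  [/\ forall k, is_module (cI C k) /\ injective (cI C k),
      is_hom (ceta C) /\ forall k, is_hom (cd C k),
      row_free (ceta C),
      (ceta C == kermx (cd C 0))%MS /\ forall k, (cd C k == kermx (cd C k.+1))%MS
    & essential (ceta C) /\ forall k, essential (cd C k)].

Definition pmod (B : seq qpath) (vert : qpath -> nat)
    (act : qpath -> 'I_m -> option qpath) : amod :=
  {| mdim := size B;
     mE := fun i => \matrix_(p, q)
             (((p : nat) == q) && (vert (nth (0%N, [::]) B p) == i))%:R;
     mX := fun a => \matrix_(p, q)
             (act (nth (0%N, [::]) B p) a == Some (nth (0%N, [::]) B q))%:R |}.

Definition regmod : amod := pmod nzpaths pend act_right.
Definition projmod (i : 'I_n) : amod :=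
  pmod [seq p <- nzpaths | pstart p == i] pend act_right.
(* I(i) = D(A e_i), with the dual basis of the paths ending at i *)
Definition injmod (i : 'I_n) : amod :=
  pmod [seq p <- nzpaths | pend p == i] pstart act_dual.

Definition gldim_finite : Prop :=
  exists g, forall M, is_module M -> pdim_le M g.

Definition two_gorenstein : Prop :=
  forall C : icoresol regmod, minimal_icoresol C ->
    pdim_le (cI C 0) 0 /\ pdim_le (cI C 1) 1.

Definition auslander_regular : Prop :=
  gldim_finite /\
  forall C : icoresol regmod, minimal_icoresol C -> forall k, pdim_le (cI C k) k.

(* psi(i) = j  iff  Omega^(pdim I(i)) I(i) ~= P(j); for a minimal          *)
(* projective resolution of I(i) with pdim I(i) = d, Omega^d I(i) = P_d.    *)
Definition ar_perm_rel (i j : 'I_n) : Prop :=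
  forall d, pdim_eq (injmod i) d ->
  forall R : presol (injmod i), minimal_presol R -> mod_iso (rP R d) (projmod j).

End Modules.

(* Cartan matrix omega_(i,j) = dim_K e_j A e_i = #non-zero paths from j to i *)
Definition cartan : 'M[rat]_n :=
  \matrix_(i, j) (count (fun p => (pstart p == j) && (pend p == i)) nzpaths)%:R.

Definition coxeter : 'M[rat]_n := - ((cartan^T) *m invmx cartan).

End Quiver.

Definition upper_trig (k : nat) (U : 'M[rat]_k) : Prop :=
  forall i j : 'I_k, (j < i)%N -> U i j = 0.

Definition bruhat_dec (k : nat) (M U1 P U2 : 'M[rat]_k) : Prop :=
  [/\ upper_trig U1, upper_trig U2, is_perm_mx P & M = U1 *m P *m U2].

(* Main.v *)
(* The 2-Gorenstein condition forces a rigid shape on the bound quiver: at a vertex either at most  *)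

(* The homological hypotheses are first turned into statements about nonzero paths. A path ending at
   t that no arrow prolongs on the right is a socle element of A, so I(t) is a summand of I^0 and
   projective ([gor_rmax_proj]). A map from rad P(k) to A that does not extend to P(k) makes I(k) a
   summand of I^1, so its projective dimension is at most 1 ([gor_ext]). Flatness, or vanishing of
   Tor_2 against cyclic left modules A/Ay, tested on dual basis elements ([insum_dual]), makes
   maximal paths and minimal annihilating paths unique, and this forces the thread shape
   ([gorenstein_threaded]).

   On such a quiver the right annihilator of a nontrivial nonzero path is zero or generated by one
   path, its exit. Exits of exits give the minimal projective resolution of I(i), and their
   left-hand analogues the minimal coresolution of P(j) with terms I(x_0), ..., I(x_d), when i and j
   are not crossings ([inj_chain], [proj_chain]); crossings have one short exact sequence
   ([cross_res]). Taking dimensions at each vertex yields row j of C, whose first nonzero entry is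
   at x_d, or at j for a crossing ([row_ncr], [row_cross], [first_ncr]), and relations for the
   inverse of C ([row_inv]).

   The core is [pdata_main], proved through [chain_triple] and [chain_main]: walking along the
   coresolution of P(j), the resolution of I(x_k) is compared with chains from the previous step,
   and if j does not occur too early, or the bound on pdim I(x_k) is known, the resolution of I(x_d)
   has length d and ends in P(j). For regular A the bound is [ar_bound]; then j determines x_d
   injectively, inversely to the Auslander-Reiten permutation ([regular_first]), and sorting the
   rows of C gives P and U_2 ([bruhat_exists], [bruhat_unique]). Conversely, C = P U_2 restricts
   where j can occur in the resolution of I(i) ([bruhat_regular]), so the core result yields pdim
   I(x_k) at most k, which is enough for regularity ([ar_of_bound]). *)
(* one arrow enters and at most one leaves, or two threads cross without relations along a thread. *)
(* Hence the minimal projective resolution of I(i) and the minimal injective coresolution of P(j)  *)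
(* have indecomposable terms P(y_0), P(y_1), ... and I(x_0), I(x_1), ..., x_0 > x_1 > ... > x_d,    *)
(* given by successive exits of paths; at a crossing k there is an exact sequence                  *)
(* 0 -> P(k) -> J -> I(k) -> 0 with J projective and injective.  Counting dimensions, row j of the *)
(* Coxeter matrix C is the alternating sum of the -e_(x_k), whose first nonzero entry is at x_d,   *)
(* and the rows of the inverse are given by the y_k in the same way.  A comparison of the two      *)
(* kinds of chains shows that if, for all k < d, j does not occur in the resolution of I(x_k) or   *)
(* pdim I(x_k) <= k, then pdim I(x_k) <= k for all k and the resolution of I(x_d) has length d and *)
(* ends in P(j).  If A is Auslander regular, j |-> x_d is therefore inverse to the                 *)
(* Auslander-Reiten permutation, and C is a permutation times an upper triangular matrix.          *)
(* Conversely such a decomposition bounds the support of the rows of C^-1, so that j does not      *)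
(* occur in the resolution of I(x_k) for k < d.                                                     *)
Require Import Defs.
From mathcomp Require Import all_boot all_order all_algebra.
From mathcomp Require Import fingroup perm zify.
From Stdlib Require Import IndefiniteDescription.
Set Implicit Arguments. Unset Strict Implicit. Unset Printing Implicit Defensive.
Import Order.TTheory GRing.Theory Num.Theory.
Local Open Scope ring_scope.

(** * Homomorphisms, submodules and quotients *)

Section Homs.
Variables (Q : monquiver) (K : fieldType).
Local Notation n := (qn Q).
Local Notation src := (@qsrc Q).
Local Notation tgt := (@qtgt Q).
Local Notation amod := (amod Q K).
Implicit Types M N X Y Z : amod.

Lemma hom_comp M N X (f : 'M[K]_(mdim M, mdim N)) (g : 'M_(mdim N, mdim X)) :
  is_hom f -> is_hom g -> is_hom (f *m g).
Proof.
move=> [f1 f2] [g1 g2]; split=> i.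
  by rewrite mulmxA f1 -mulmxA g1 mulmxA.
by rewrite mulmxA f2 -mulmxA g2 mulmxA.
Qed.

Lemma hom_id M : is_hom (1%:M : 'M[K]_(mdim M, mdim M)).
Proof. by split=> i; rewrite mul1mx mulmx1. Qed.

Lemma hom_zero M N : is_hom (0 : 'M[K]_(mdim M, mdim N)).
Proof. by split=> i; rewrite mul0mx mulmx0. Qed.

Lemma hom_add M N (f g : 'M[K]_(mdim M, mdim N)) :
  is_hom f -> is_hom g -> is_hom (f + g).
Proof. by move=> [f1 f2] [g1 g2]; split=> i; rewrite mulmxDr mulmxDl ?f1 ?f2 ?g1 ?g2. Qed.

Lemma hom_opp M N (f : 'M[K]_(mdim M, mdim N)) : is_hom f -> is_hom (- f).
Proof. by move=> [f1 f2]; split=> i; rewrite mulmxN mulNmx ?f1 ?f2. Qed.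

Lemma hom_sum M N (I : finType) (f : I -> 'M[K]_(mdim M, mdim N)) :
  (forall i, is_hom (f i)) -> is_hom (\sum_i f i).
Proof.
move=> fh; elim/big_ind: _ => [|g h gh hh|i _]; last exact: fh.
  exact: hom_zero.
exact: hom_add.
Qed.

Lemma pathmx_foldl M (A : 'M[K]_(mdim M)) l :
  foldl (fun A a => A *m mX M a) A l = A *m pathmx M l.
Proof.
rewrite /pathmx; elim: l A => [|a l IHl] A /=; first by rewrite mulmx1.
by rewrite IHl [in RHS]IHl mul1mx mulmxA.
Qed.

Lemma pathmx_nil M : pathmx M [::] = 1%:M. Proof. by []. Qed.

Lemma pathmx_cons M a l : pathmx M (a :: l) = mX M a *m pathmx M l.
Proof. by rewrite {1}/pathmx /= pathmx_foldl mul1mx. Qed.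

Lemma pathmx_cat M l1 l2 : pathmx M (l1 ++ l2) = pathmx M l1 *m pathmx M l2.
Proof. by rewrite {1}/pathmx foldl_cat pathmx_foldl. Qed.

Lemma pathmx_rcons M l a : pathmx M (rcons l a) = pathmx M l *m mX M a.
Proof. by rewrite -cats1 pathmx_cat pathmx_cons mulmx1. Qed.

Lemma hom_path M N (f : 'M[K]_(mdim M, mdim N)) l :
  is_hom f -> pathmx M l *m f = f *m pathmx N l.
Proof.
case=> _ fX; elim: l => [|a l IHl]; first by rewrite mul1mx mulmx1.
by rewrite !pathmx_cons -mulmxA IHl !mulmxA fX.
Qed.

Section ModuleFacts.
Variables (M : amod).
Hypothesis Mm : is_module M.

Lemma mE_sum : \sum_i mE M i = 1%:M. Proof. by case: Mm. Qed.
Lemma mEE i j : mE M i *m mE M j = if i == j then mE M i else 0.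
Proof. by case: Mm => _ H _ _; apply: H. Qed.
Lemma mEid i : mE M i *m mE M i = mE M i. Proof. by rewrite mEE eqxx. Qed.
Lemma mEX a : mE M (src a) *m mX M a = mX M a.
Proof. by case: Mm => _ _ H _; case: (H a). Qed.
Lemma mXE a : mX M a *m mE M (tgt a) = mX M a.
Proof. by case: Mm => _ _ H _; case: (H a). Qed.
Lemma mod_rel r : r \in qrels Q -> pathmx M r = 0.
Proof. by case: Mm => _ _ _; apply. Qed.

Lemma pathmx_bad l : ~~ nonzero_path l -> pathmx M l = 0.
Proof.
rewrite /nonzero_path negbK => /hasP[r rQ /infixP[s [s' ->]]].
by rewrite !pathmx_cat (mod_rel rQ) mul0mx mulmx0.
Qed.

Lemma mEX_src k (x : 'M[K]_(k, mdim M)) a i :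
  x *m mE M i = x -> src a != i -> x *m mX M a = 0.
Proof.
by move=> <- ai; rewrite -(mEX a) mulmxA -(mulmxA x) mEE eq_sym (negbTE ai) mulmx0 mul0mx.
Qed.
End ModuleFacts.

(** An injective intertwining map can be cancelled, so every axiom may be checked inside [M];
    submodules then need no verification of their own. *)
Lemma mod_mono X M (f : 'M[K]_(mdim X, mdim M)) :
  is_hom f -> row_free f -> is_module M -> is_module X.
Proof.
move=> [f1 f2] ff Mm; have inj := row_free_inj ff.
split=> [|i j|a|r rQ]; try split; apply: inj.
- rewrite mulmx_suml (eq_bigr _ (fun i _ => f1 i)) -mulmx_sumr (mE_sum Mm).
  by rewrite mulmx1 mul1mx.
- rewrite -mulmxA f1 mulmxA f1 -mulmxA (mEE Mm).
  by case: eqP => _; rewrite ?f1 ?mulmx0 ?mul0mx.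
- by rewrite -mulmxA f2 mulmxA f1 -mulmxA (mEX Mm).
- by rewrite -mulmxA f1 mulmxA f2 -mulmxA (mXE Mm).
- by rewrite hom_path // (mod_rel Mm) // mulmx0 mul0mx.
Qed.

Lemma row_full_injl m p q (A : 'M[K]_(m, p)) (B C : 'M_(p, q)) :
  row_full A -> A *m B = A *m C -> B = C.
Proof. by move=> Af E; rewrite -[B]mul1mx -(mulVpmx Af) -mulmxA E mulmxA mulVpmx ?mul1mx. Qed.

Lemma mod_epi X M (f : 'M[K]_(mdim X, mdim M)) :
  is_hom f -> row_full f -> is_module X -> is_module M.
Proof.
move=> fh ff Xm; have [f1 f2] := fh; have inj := @row_full_injl _ _ _ _ _ _ ff.
split=> [|i j|a|r rQ]; try split; apply: inj.
- rewrite mulmx_sumr (eq_bigr _ (fun i _ => esym (f1 i))) -mulmx_suml (mE_sum Xm).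
  by rewrite mulmx1 mul1mx.
- rewrite mulmxA -f1 -mulmxA -f1 mulmxA (mEE Xm).
  by case: eqP => _; rewrite ?f1 ?mulmx0 ?mul0mx.
- by rewrite mulmxA -f1 -mulmxA -f2 mulmxA (mEX Xm).
- by rewrite mulmxA -f2 -mulmxA -f1 mulmxA (mXE Xm).
- by rewrite -hom_path // (mod_rel Xm) // mulmx0 mul0mx.
Qed.

Lemma submod_im X M (f : 'M[K]_(mdim X, mdim M)) : is_hom f -> is_submod f.
Proof. by move=> [f1 f2]; split=> i; rewrite -?f1 -?f2 submxMl. Qed.

Lemma submod_ker X M (f : 'M[K]_(mdim X, mdim M)) : is_hom f -> is_submod (kermx f).
Proof.
move=> [f1 f2]; split=> i; apply/sub_kermxP; rewrite -mulmxA ?f1 ?f2 mulmxA mulmx_ker.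
  by rewrite mul0mx.
by rewrite mul0mx.
Qed.

Lemma submod_eqmx M k k' (U : 'M[K]_(k, mdim M)) (V : 'M_(k', mdim M)) :
  (U :=: V)%MS -> is_submod U -> is_submod V.
Proof.
by move=> UV [U1 U2]; split=> i; rewrite -UV -(eqmxMr _ UV).
Qed.

(** The submodule in coordinates with respect to the rows of [U]. It is shown to be a module only
    for independent rows, so [U] will be a row base or a nonzero row. *)
Definition subm M k (U : 'M[K]_(k, mdim M)) : amod :=
  @AMod Q K k (fun i => U *m mE M i *m pinvmx U) (fun a => U *m mX M a *m pinvmx U).

Lemma subm_hom M k (U : 'M[K]_(k, mdim M)) : is_submod U -> @is_hom _ _ (subm U) M U.
Proof. by case=> U1 U2; split=> i; rewrite /= mulmxKpV. Qed.

Lemma hom_factor X Z M (f : 'M[K]_(mdim X, mdim M)) (U : 'M[K]_(mdim Z, mdim M)) :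
  is_hom f -> is_hom U -> row_free U -> (f <= U)%MS ->
  @is_hom _ _ X Z (f *m pinvmx U).
Proof.
move=> [f1 f2] [U1 U2] Uf fU; have inj := row_free_inj Uf.
by split=> i; apply: inj; rewrite -mulmxA mulmxKpV // ?f1 ?f2 -mulmxA ?U1 ?U2 mulmxA mulmxKpV.
Qed.

(** The columns form a basis of the functionals vanishing on [U], so this is the projection to M/U,
    and [pinvmx] of it is a linear section. *)
Definition quopr M k (U : 'M[K]_(k, mdim M)) := col_base (cokermx U).
Definition quom M k (U : 'M[K]_(k, mdim M)) : amod :=
  @AMod Q K (\rank (cokermx U)) (fun i => pinvmx (quopr U) *m mE M i *m quopr U)
    (fun a => pinvmx (quopr U) *m mX M a *m quopr U).

Lemma quopr_full M k (U : 'M[K]_(k, mdim M)) : row_full (quopr U).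
Proof. exact: col_base_full. Qed.

Lemma quopr_ker M k p (U : 'M[K]_(k, mdim M)) (V : 'M_(p, mdim M)) :
  (V *m quopr U == 0) = (V <= U)%MS.
Proof.
have E : V *m quopr U *m row_base (cokermx U) = V *m cokermx U.
  by rewrite -mulmxA mulmx_base.
by rewrite submxE -E -!mxrank_eq0 (mxrankMfree _ (row_base_free (cokermx U))).
Qed.

Lemma quopr_hom M k (U : 'M[K]_(k, mdim M)) :
  is_submod U -> @is_hom _ _ M (quom U) (quopr U).
Proof.
move=> [U1 U2]; have E : ((1%:M - quopr U *m pinvmx (quopr U)) <= U)%MS.
  rewrite -quopr_ker mulmxBl mul1mx -mulmxA mulVpmx ?quopr_full // mulmx1.
  by rewrite subrr.
have key A : (U *m A <= U)%MS -> A *m quopr U = quopr U *m (pinvmx (quopr U) *m A *m quopr U).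
  move=> UA; have := submx_trans (submxMr A E) UA; rewrite -quopr_ker.
  move: (pinvmx (quopr U)) (quopr U) => p q.
  by rewrite mulmxBl mul1mx mulmxBl subr_eq0 => /eqP ->; rewrite !mulmxA.
by split=> i; apply: key.
Qed.

Lemma epi_image X Y (d : 'M[K]_(mdim X, mdim Y)) : is_hom d -> is_module Y ->
  exists Z (g : 'M[K]_(mdim X, mdim Z)) (U : 'M[K]_(mdim Z, mdim Y)),
    [/\ is_module Z, is_hom g, is_hom U & [/\ row_full g, row_free U & g *m U = d]].
Proof.
move=> dh Ym; pose U := row_base d.
have Us : is_submod U by apply: submod_eqmx (submod_im dh); apply/eqmx_sym/eq_row_base.
have Uf : row_free U := row_base_free d.
have dU : (d <= U)%MS by rewrite eq_row_base.
exists (subm U), (d *m pinvmx U), U; have Uh := subm_hom Us.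
split=> //; [exact: mod_mono Uh Uf Ym | exact: hom_factor | split=> //].
  by rewrite /row_full -(mxrankMfree _ Uf) mulmxKpV.
by rewrite mulmxKpV.
Qed.

(** Factoring [d] through its image replaces surjectivity by an inclusion of images, the form in
    which chain maps are built. *)
Lemma proj_lift P X Y (f : 'M[K]_(mdim P, mdim Y)) (d : 'M[K]_(mdim X, mdim Y)) :
  projective P -> is_module X -> is_module Y -> is_hom f -> is_hom d -> (f <= d)%MS ->
  exists h : 'M[K]_(mdim P, mdim X), is_hom h /\ h *m d = f.
Proof.
move=> Pp Xm Ym fh dh fd.
have [Z [g [U [Zm gh Uh [gf Uf gU]]]]] := epi_image dh Ym.
have fU : (f <= U)%MS by rewrite (submx_trans fd) // -gU submxMl.
have f'h := hom_factor fh Uh Uf fU.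
have [h [hh hg]] := Pp _ _ _ _ Xm Zm gh gf f'h.
by exists h; split=> //; rewrite -gU mulmxA hg mulmxKpV.
Qed.

Lemma inj_extend I X Y (f : 'M[K]_(mdim X, mdim I)) (d : 'M[K]_(mdim X, mdim Y)) :
  Defs.injective I -> is_module X -> is_module Y -> is_hom f -> is_hom d ->
  (kermx d <= kermx f)%MS ->
  exists h : 'M[K]_(mdim Y, mdim I), is_hom h /\ d *m h = f.
Proof.
move=> Ii Xm Ym fh dh fd.
have [Z [g [U [Zm gh Uh [gf Uf gU]]]]] := epi_image dh Ym.
(* [pinvmx g] is only a linear section of [g], but the error [1%:M - g *m pinvmx g] lies in the
   kernel of [d], which [f] kills. *)
have gE : g *m (pinvmx g *m f) = f.
  have: ((1%:M - g *m pinvmx g) <= kermx d)%MS.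
    by apply/sub_kermxP; rewrite mulmxBl mul1mx -gU -(mulmxA g (pinvmx g)) (mulmxA (pinvmx g)) mulVpmx // mul1mx subrr.
  move/submx_trans/(_ fd)/sub_kermxP; rewrite mulmxBl mul1mx -mulmxA => /eqP.
  by rewrite subr_eq0 => /eqP <-.
have f'h : @is_hom _ _ Z I (pinvmx g *m f).
  have [g1 g2] := gh; have [f1 f2] := fh.
  split=> i; apply: (row_full_injl gf).
    by rewrite mulmxA -g1 -mulmxA gE f1 mulmxA gE.
  by rewrite mulmxA -g2 -mulmxA gE f2 mulmxA gE.
have [h [hh hU]] := Ii _ _ _ _ Zm Ym Uh Uf f'h.
by exists h; split=> //; rewrite -gU -mulmxA hU gE.
Qed.

Definition dsum M N : amod :=
  @AMod Q K (mdim M + mdim N) (fun i => block_mx (mE M i) 0 0 (mE N i))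
    (fun a => block_mx (mX M a) 0 0 (mX N a)).

Lemma dsum_path M N l : pathmx (dsum M N) l = block_mx (pathmx M l) 0 0 (pathmx N l).
Proof.
elim: l => [|a l IHl]; first by rewrite !pathmx_nil -scalar_mx_block.
by rewrite !pathmx_cons IHl mulmx_block !mulmx0 !mul0mx !addr0 add0r.
Qed.

Lemma dsum_mod M N : is_module M -> is_module N -> is_module (dsum M N).
Proof.
move=> Mm Nm; split=> [|i j|a|r rQ] /=.
- have -> : \sum_i block_mx (mE M i) 0 0 (mE N i) =
      block_mx (\sum_i mE M i) 0 0 (\sum_i mE N i).
    elim/big_rec3: _ => [|i A B C _ ->]; last by rewrite add_block_mx !addr0.
    by rewrite block_mx0.
  by rewrite (mE_sum Mm) (mE_sum Nm) -scalar_mx_block.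
- rewrite mulmx_block !mulmx0 !mul0mx !addr0 add0r (mEE Mm) (mEE Nm).
  by case: eqP => // _; rewrite block_mx0.
- by rewrite !mulmx_block !mulmx0 !mul0mx !addr0 !add0r (mEX Mm) (mEX Nm) (mXE Mm) (mXE Nm).
- by rewrite dsum_path (mod_rel Mm) // (mod_rel Nm) // block_mx0.
Qed.

Lemma hom_col M N X (f : 'M[K]_(mdim M, mdim X)) (g : 'M_(mdim N, mdim X)) :
  is_hom f -> is_hom g -> @is_hom _ _ (dsum M N) X (col_mx f g).
Proof.
move=> [f1 f2] [g1 g2]; split=> i /=; rewrite mul_block_col !mul0mx addr0 add0r mul_col_mx.
  by rewrite f1 g1.
by rewrite f2 g2.
Qed.

Lemma hom_row M N X (f : 'M[K]_(mdim X, mdim M)) (g : 'M_(mdim X, mdim N)) :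
  is_hom f -> is_hom g -> @is_hom _ _ X (dsum M N) (row_mx f g).
Proof.
move=> [f1 f2] [g1 g2]; split=> i /=; rewrite mul_row_block !mulmx0 addr0 add0r mul_mx_row.
  by rewrite f1 g1.
by rewrite f2 g2.
Qed.

Lemma dsum_proj M N : projective M -> projective N -> projective (dsum M N).
Proof.
move=> Mp Np X Y g f Xm Ym gh gf [f1 f2].
have i1 : @is_hom _ _ M (dsum M N) (row_mx 1%:M 0).
  by apply: hom_row; [exact: hom_id | exact: hom_zero].
have i2 : @is_hom _ _ N (dsum M N) (row_mx 0 1%:M).
  by apply: hom_row; [exact: hom_zero | exact: hom_id].
have fh : @is_hom _ _ (dsum M N) Y f by [].
have [h1 [h1h e1]] := Mp _ _ _ _ Xm Ym gh gf (hom_comp i1 fh).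
have [h2 [h2h e2]] := Np _ _ _ _ Xm Ym gh gf (hom_comp i2 fh).
exists (col_mx h1 h2); split; first exact: hom_col.
by rewrite mul_col_mx e1 e2 -mul_col_mx -[col_mx _ _]/(block_mx 1%:M 0 0 1%:M)
  -scalar_mx_block mul1mx.
Qed.

Lemma dsum_inj M N : Defs.injective M -> Defs.injective N -> Defs.injective (dsum M N).
Proof.
move=> Mi Ni X Y f g Xm Ym fh ff gh.
have p1 : @is_hom _ _ (dsum M N) M (col_mx 1%:M 0).
  by apply: hom_col; [exact: hom_id | exact: hom_zero].
have p2 : @is_hom _ _ (dsum M N) N (col_mx 0 1%:M).
  by apply: hom_col; [exact: hom_zero | exact: hom_id].
have gh' : @is_hom _ _ X (dsum M N) g by [].
have [h1 [h1h e1]] := Mi _ _ _ _ Xm Ym fh ff (hom_comp gh' p1).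
have [h2 [h2h e2]] := Ni _ _ _ _ Xm Ym fh ff (hom_comp gh' p2).
exists (row_mx h1 h2); split; first exact: hom_row.
by rewrite mul_mx_row e1 e2 -mul_mx_row -block_mxEh -scalar_mx_block mulmx1.
Qed.

(* A module is a retract of a finite family when its identity factors through *)
(* the sum of the family; this avoids forming the direct sum.                 *)
Definition retract_of M (I : finType) (N : I -> amod) :=
  exists (f : forall j, 'M[K]_(mdim M, mdim (N j))) (g : forall j, 'M[K]_(mdim (N j), mdim M)),
    [/\ forall j, is_hom (f j), forall j, is_hom (g j) & \sum_j f j *m g j = 1%:M].

Lemma retract_proj M (I : finType) (N : I -> amod) :
  retract_of M N -> (forall j, projective (N j)) -> projective M.
Proof.
move=> [f [g [fh gh fg]]] Np X Y d u Xm Ym dh df uh.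
have H j := constructive_indefinite_description _
  (Np j _ _ _ _ Xm Ym dh df (hom_comp (gh j) uh)).
exists (\sum_j f j *m sval (H j)); split.
  by apply: hom_sum => j; apply: hom_comp (fh j) (proj1 (svalP (H j))).
rewrite mulmx_suml -[u in RHS]mul1mx -fg mulmx_suml; apply: eq_bigr => j _.
by rewrite -!mulmxA (proj2 (svalP (H j))).
Qed.

Lemma retract1 M N (f : 'M[K]_(mdim M, mdim N)) (g : 'M[K]_(mdim N, mdim M)) :
  is_hom f -> is_hom g -> f *m g = 1%:M -> retract_of M (fun _ : 'I_1 => N).
Proof.
by move=> fh gh fg; exists (fun _ => f), (fun _ => g); split=> //; rewrite big_ord1.
Qed.

End Homs.

(** * Radical and socle *)

Section Radical.
Variables (Q : monquiver) (K : fieldType).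
Local Notation n := (qn Q).
Local Notation src := (@qsrc Q).
Local Notation tgt := (@qtgt Q).
Local Notation amod := (amod Q K).
Hypothesis harr : forall a, (src a < tgt a)%N.
Implicit Types M N X Y : amod.

Definition rad M : 'M[K]_(mdim M) := (\sum_a mX M a)%MS.

Fixpoint radk M k : 'M[K]_(mdim M) :=
  if k is k'.+1 then (\sum_a radk M k' *m mX M a)%MS else 1%:M.

(** Arrows strictly raise the label, so k steps end at a label of at least k. In particular the
    radical is nilpotent. *)
Lemma radk_supp M k (i : 'I_n) : is_module M -> (i < k)%N -> radk M k *m mE M i = 0.
Proof.
move=> Mm; elim: k i => [|k IHk] i //= ik; apply/sub_kermxP/sumsmx_subP => a _.
apply/sub_kermxP; rewrite -(mXE Mm) -!mulmxA (mEE Mm); case: (tgt a =P i) => [ai|_]; last first.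
  by rewrite !mulmx0.
rewrite (mXE Mm) -(mEX Mm) mulmxA IHk ?mul0mx //.
by apply: leq_trans (harr a) _; rewrite ai -ltnS.
Qed.

Lemma radk_nil M : is_module M -> radk M n = 0.
Proof.
by move=> Mm; rewrite -[radk M n]mulmx1 -(mE_sum Mm) mulmx_sumr big1 // => i _; apply: radk_supp.
Qed.

(** Substituting the hypothesis into itself pushes the defect into ever higher radical powers, and
    the n-th power vanishes. *)
Lemma nakayama M k (V : 'M[K]_(k, mdim M)) :
  is_module M -> is_submod V -> (1%:M <= V + rad M)%MS -> (1%:M <= V)%MS.
Proof.
move=> Mm [_ VX] VR; suff H p : (1%:M <= V + radk M p)%MS.
  by have := H n; rewrite radk_nil // => /submx_trans; apply; rewrite addsmx_sub submx_refl sub0mx.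
elim: p => [|p IHp]; first by rewrite addsmxSr.
apply: submx_trans VR _; rewrite addsmx_sub addsmxSl; apply/sumsmx_subP=> a _.
rewrite -[mX M a]mul1mx (submx_trans (submxMr _ IHp)) // addsmxMr addsmxS //.
by rewrite (sumsmx_sup a).
Qed.

Lemma sup_of_rad M k (V : 'M[K]_(k, mdim M)) :
  is_module M -> (V <= rad M)%MS -> superfluous V.
Proof.
move=> Mm VR p W Ws VW; apply: nakayama => //; apply: submx_trans VW _.
by rewrite addsmx_sub addsmxSl (submx_trans VR) ?addsmxSr.
Qed.

Definition in_soc M i (x : 'rV[K]_(mdim M)) :=
  x *m mE M i = x /\ forall a, x *m mX M a = 0.

Lemma soc_path M i (x : 'rV[K]_(mdim M)) l : in_soc i x -> x *m pathmx M l = if l is [::] then x else 0.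
Proof.
by case=> _ xX; case: l => [|a l]; rewrite ?mulmx1 // pathmx_cons mulmxA xX mul0mx.
Qed.

(** At the largest vertex supporting [V] every arrow leads out of the support, so each vector of [V]
    there lies in the socle. *)
Lemma soc_ex M k (V : 'M[K]_(k, mdim M)) :
  is_module M -> is_submod V -> V != 0 ->
  exists i (x : 'rV[K]_(mdim M)), [/\ x != 0, (x <= V)%MS & in_soc i x].
Proof.
move=> Mm [VE VX] V0.
have: [exists i, V *m mE M i != 0].
  apply: contraR V0; rewrite negb_exists => /forallP H.
  rewrite -[V]mulmx1 -(mE_sum Mm) mulmx_sumr big1 // => i _; apply/eqP.
  by have := H i; rewrite negbK.
case/existsP=> i0 Hi0; case: (@arg_maxnP _ i0 (fun i => V *m mE M i != 0) (fun i : 'I_n => i : nat) Hi0) => i Hi imax.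
have [r Hr] : exists r, row r (V *m mE M i) != 0.
  apply/existsP; apply: contraR Hi; rewrite negb_exists => /forallP H.
  by apply/eqP/row_matrixP => r; apply/eqP; rewrite row0; have := H r; rewrite negbK.
exists i, (row r (V *m mE M i)); have xV : (row r (V *m mE M i) <= V)%MS.
  by rewrite (submx_trans (row_sub _ _)).
split=> //; have xE : row r (V *m mE M i) *m mE M i = row r (V *m mE M i).
  by rewrite -row_mul -mulmxA (mEid Mm).
split=> // a.
have [sai|ne] := eqVneq (src a) i; last exact: (mEX_src Mm xE ne).
apply/eqP; rewrite -submx0 -(mXE Mm) mulmxA.
have: (row r (V *m mE M i) *m mX M a <= V)%MS by apply: submx_trans (submxMr _ xV) (VX a).
move/(submxMr (mE M (tgt a)))/submx_trans; apply.
case: (eqVneq (V *m mE M (tgt a)) 0) => [->|/imax]; first exact: sub0mx.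
by move=> /= le; have := harr a; rewrite sai ltnNge le.
Qed.

Lemma soc_inj M X (f : 'M[K]_(mdim M, mdim X)) : is_module M -> is_hom f ->
  (forall i (x : 'rV[K]_(mdim M)), in_soc i x -> x *m f = 0 -> x = 0) -> row_free f.
Proof.
move=> Mm fh H; rewrite -kermx_eq0; apply/negPn/negP => /(soc_ex Mm (submod_ker fh)).
by move=> [i [x [x0 /sub_kermxP xf xs]]]; rewrite (H i x) ?eqxx in x0.
Qed.

Lemma ess_of_soc M k (U : 'M[K]_(k, mdim M)) : is_module M ->
  (forall i (x : 'rV[K]_(mdim M)), in_soc i x -> (x <= U)%MS) -> essential U.
Proof.
move=> Mm H p V Vs; rewrite lt0n mxrank_eq0 => /(soc_ex Mm Vs)[i [x [x0 xV xs]]].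
by rewrite (leq_trans _ (mxrankS (_ : (x <= U :&: V)%MS))) ?sub_capmx ?xV ?(H i) // rank_rV x0.
Qed.

End Radical.

(** * Comparison of resolutions *)

Section Compare.
Variables (Q : monquiver) (K : fieldType).
Local Notation amod := (amod Q K).
Implicit Types M N X Y : amod.

Lemma hom_inv M (g : 'M[K]_(mdim M)) : @is_hom _ _ M M g -> g \in unitmx -> @is_hom _ _ M M (invmx g).
Proof.
move=> [g1 g2] gu; split=> i; apply: (can_inj (mulmxK gu)).
  by rewrite -[RHS]mulmxA g1 mulmxA mulVmx // mul1mx -mulmxA mulVmx // mulmx1.
by rewrite -[RHS]mulmxA g2 mulmxA mulVmx // mul1mx -mulmxA mulVmx // mulmx1.
Qed.

(** An invertible composite suffices: its inverse is again a homomorphism and is absorbed into the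
    maps [f j]. *)
Lemma retract_unit M (I : finType) (N : I -> amod) (f : forall j, 'M[K]_(mdim M, mdim (N j)))
    (g : forall j, 'M[K]_(mdim (N j), mdim M)) :
  (forall j, is_hom (f j)) -> (forall j, is_hom (g j)) -> \sum_j f j *m g j \in unitmx ->
  retract_of M N.
Proof.
move=> fh gh; set u := \sum_j _ => uu.
have uh : @is_hom _ _ M M u by apply: hom_sum => j; apply: hom_comp (fh j) (gh j).
exists (fun j => invmx u *m f j), g; split=> // [j|].
  exact: hom_comp (hom_inv uh uu) (fh j).
by under eq_bigr do rewrite -mulmxA; rewrite -mulmx_sumr mulVmx.
Qed.

(** With [M] itself as term 0, exactness and the comparison maps have the same form in every
    degree. *)
Definition aug M (R : presol M) k : amod := if k is k'.+1 then rP R k' else M.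
Definition augd M (R : presol M) k : 'M[K]_(mdim (aug R k.+1), mdim (aug R k)) :=
  match k with 0 => reps R | k'.+1 => rd R k' end.

Section AugFacts.
Variables (M : amod) (R : presol M).
Hypotheses (Mm : is_module M) (HR : is_presol R).

Lemma aug_mod k : is_module (aug R k).
Proof. by case: k => [|k] //=; case: HR => H _ _ _ _; case: (H k). Qed.
Lemma aug_proj k : projective (aug R k.+1).
Proof. by case: HR => H _ _ _ _; case: (H k). Qed.
Lemma augd_hom k : is_hom (augd R k).
Proof. by case: k => [|k] /=; case: HR => _ [H1 H2] _ _ _. Qed.
Lemma augd_exact k : (augd R k.+1 == kermx (augd R k))%MS.
Proof. by case: k => [|k] /=; case: HR. Qed.
Lemma augdd k : augd R k.+1 *m augd R k = 0.
Proof. by apply/sub_kermxP; case/andP: (augd_exact k). Qed.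
End AugFacts.
Arguments aug_proj {M R} HR k.

Lemma lift_ex M M' (R : presol M) (R' : presol M') (u : 'M[K]_(mdim M, mdim M')) :
  is_module M -> is_module M' -> is_presol R -> is_presol R' -> is_hom u ->
  exists f : forall k, 'M[K]_(mdim (aug R k), mdim (aug R' k)),
    [/\ f 0 = u, forall k, is_hom (f k) & forall k, f k.+1 *m augd R' k = augd R k *m f k].
Proof.
move=> Mm Mm' HR HR' uh.
(* [ok] records exactly what is needed to lift once more, so the whole chain map arises by dependent
   choice. *)
pose ok k (f : 'M[K]_(mdim (aug R k), mdim (aug R' k))) :=
  is_hom f /\ (augd R k *m f <= augd R' k)%MS.
have ok0 : ok 0 u.
  by split=> //; apply: submx_full; case: HR'.
have step k (f : {f | ok k f}) : {f' : {f' | ok k.+1 f'} | sval f' *m augd R' k = augd R k *m sval f}.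
  apply: constructive_indefinite_description.
  case: f => f [fh fd] /=.
  have [f' [f'h f'd]] := proj_lift (aug_proj HR k) (aug_mod Mm' HR' k.+1) (aug_mod Mm' HR' k)
     (hom_comp (augd_hom HR k) fh) (augd_hom HR' k) fd.
  have okf' : ok k.+1 f'.
    split=> //; case/andP: (augd_exact HR' k) => _; apply: submx_trans.
    by apply/sub_kermxP; rewrite -mulmxA f'd mulmxA augdd // mul0mx.
  by exists (exist _ f' okf').
pose F := fix F k : {f | ok k f} := if k is k'.+1 then sval (step k' (F k')) else exist _ u ok0.
exists (fun k => sval (F k)); split=> // k; first by case: (svalP (F k)).
exact: (svalP (step k (F k))).
Qed.

Lemma compare_pres M (I : finType) (N : I -> amod) (R0 : presol M) (R : forall j, presol (N j)) k :
  is_module M -> (forall j, is_module (N j)) -> minimal_presol R0 -> (forall j, is_presol (R j)) ->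
  retract_of M N -> retract_of (rP R0 k) (fun j => rP (R j) k).
Proof.
move=> Mm Nm [HR0 [sup0 sup]] HR [f [g [fh gh fg]]].
have supk p : superfluous (kermx (augd R0 p)) by case: p.
have F j := constructive_indefinite_description _ (lift_ex Mm (Nm j) HR0 (HR j) (fh j)).
have G j := constructive_indefinite_description _ (lift_ex (Nm j) Mm (HR j) HR0 (gh j)).
pose u p := \sum_j sval (F j) p *m sval (G j) p.
have uh p : @is_hom _ _ (aug R0 p) (aug R0 p) (u p).
  apply: hom_sum => j; case: (svalP (F j)) => _ H1 _; case: (svalP (G j)) => _ H2 _.
  exact: hom_comp (H1 p) (H2 p).
have ud p : u p.+1 *m augd R0 p = augd R0 p *m u p.
  rewrite mulmx_suml mulmx_sumr; apply: eq_bigr => j _.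
  case: (svalP (F j)) => _ _ H1; case: (svalP (G j)) => _ _ H2.
  by rewrite -mulmxA H2 mulmxA H1 mulmxA.
have uu p : u p \in unitmx.
  elim: p => [|p IHp].
    rewrite /u (eq_bigr (fun j => f j *m g j)) ?fg ?unitmx1 // => j _.
    by case: (svalP (F j)) => -> _ _; case: (svalP (G j)) => -> _ _.
  rewrite -row_full_unit -sub1mx; apply: (supk p); first exact: submod_im (uh _).
  have /submxP[D ED] : (augd R0 p <= u p.+1 *m augd R0 p)%MS.
    have sub : (u p.+1 *m augd R0 p <= augd R0 p)%MS by apply: submxMl.
    by rewrite -(geq_leqif (mxrank_leqif_sup sub)) ud mxrankMfree // row_free_unit.
  rewrite -[1%:M](subrK (D *m u p.+1)) addmx_sub_adds ?submxMl //.
  by apply/sub_kermxP; rewrite mulmxBl mul1mx {1}ED !mulmxA subrr.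
apply: (@retract_unit _ _ _ (fun j => sval (F j) k.+1) (fun j => sval (G j) k.+1) _ _ (uu k.+1)) => j.
  by case: (svalP (F j)).
by case: (svalP (G j)).
Qed.

(** Comparison needs minimality on one side only, and the sequence at a crossing is used without
    checking that it is minimal as a coresolution. *)
Definition is_icoresol (N : amod) (C : icoresol N) : Prop :=
  [/\ forall k, is_module (cI C k) /\ Defs.injective (cI C k),
      is_hom (ceta C) /\ forall k, is_hom (cd C k),
      row_free (ceta C)
    & (ceta C == kermx (cd C 0))%MS /\ forall k, (cd C k == kermx (cd C k.+1))%MS].

Lemma min_icoresol N (C : icoresol N) : minimal_icoresol C -> is_icoresol C.
Proof. by case. Qed.

Definition cug N (C : icoresol N) k : amod := if k is k'.+1 then cI C k' else N.
Definition cugd N (C : icoresol N) k : 'M[K]_(mdim (cug C k), mdim (cug C k.+1)) :=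
  match k with 0 => ceta C | k'.+1 => cd C k' end.

Section CugFacts.
Variables (N : amod) (C : icoresol N).
Hypotheses (Nm : is_module N) (HC : is_icoresol C).

Lemma cug_mod k : is_module (cug C k).
Proof. by case: k => [|k] //=; case: HC => H _ _ _; case: (H k). Qed.
Lemma cug_inj k : Defs.injective (cug C k.+1).
Proof. by case: HC => H _ _ _; case: (H k). Qed.
Lemma cugd_hom k : is_hom (cugd C k).
Proof. by case: k => [|k] /=; case: HC => _ [H1 H2] _ _. Qed.
Lemma cugd_exact k : (cugd C k == kermx (cugd C k.+1))%MS.
Proof. by case: k => [|k] /=; case: HC => _ _ _ []. Qed.
Lemma cugdd k : cugd C k *m cugd C k.+1 = 0.
Proof. by apply/sub_kermxP; case/andP: (cugd_exact k). Qed.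
End CugFacts.
Arguments cug_inj {N C} HC k.

Lemma extend_ex N N' (C : icoresol N) (C' : icoresol N') (u : 'M[K]_(mdim N, mdim N')) :
  is_module N -> is_module N' -> is_icoresol C -> is_icoresol C' -> is_hom u ->
  exists f : forall k, 'M[K]_(mdim (cug C k), mdim (cug C' k)),
    [/\ f 0 = u, forall k, is_hom (f k) & forall k, cugd C k *m f k.+1 = f k *m cugd C' k].
Proof.
move=> Nm Nm' HC HC' uh.
pose ok k (f : 'M[K]_(mdim (cug C k), mdim (cug C' k))) :=
  is_hom f /\ (kermx (cugd C k) <= kermx (f *m cugd C' k))%MS.
have ok0 : ok 0 u.
  by split=> //=; case: HC => _ _; rewrite -kermx_eq0 => /eqP -> _; rewrite sub0mx.
have step k (f : {f | ok k f}) : {f' : {f' | ok k.+1 f'} | cugd C k *m sval f' = sval f *m cugd C' k}.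
  apply: constructive_indefinite_description.
  case: f => f [fh fd] /=.
  have [f' [f'h f'd]] := inj_extend (cug_inj HC' k) (cug_mod Nm HC k) (cug_mod Nm HC k.+1)
     (hom_comp fh (cugd_hom HC' k)) (cugd_hom HC k) fd.
  have okf' : ok k.+1 f'.
    split=> //; case/andP: (cugd_exact HC k) => _ /submx_trans; apply.
    by apply/sub_kermxP; rewrite mulmxA f'd -mulmxA cugdd // mulmx0.
  by exists (exist _ f' okf').
pose F := fix F k : {f | ok k f} := if k is k'.+1 then sval (step k' (F k')) else exist _ u ok0.
exists (fun k => sval (F k)); split=> // k; first by case: (svalP (F k)).
exact: (svalP (step k (F k))).
Qed.

(** Dual to [compare_pres]: a nonzero kernel of the composite would meet the essential image of the
    differential, on which the composite is injective by induction. *)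
Lemma compare_icores N (I : finType) (X : I -> amod) (C0 : icoresol N)
    (C : forall j, icoresol (X j)) k :
  is_module N -> (forall j, is_module (X j)) -> minimal_icoresol C0 ->
  (forall j, is_icoresol (C j)) ->
  retract_of N X -> retract_of (cI C0 k) (fun j => cI (C j) k).
Proof.
move=> Nm Xm mC0 HC [f [g [fh gh fg]]]; have HC0 := min_icoresol mC0.
have essk p : essential (cugd C0 p) by case: mC0 => _ _ _ _ [H1 H2]; case: p => [|p] /=.
have F j := constructive_indefinite_description _ (extend_ex Nm (Xm j) HC0 (HC j) (fh j)).
have G j := constructive_indefinite_description _ (extend_ex (Xm j) Nm (HC j) HC0 (gh j)).
pose u p := \sum_j sval (F j) p *m sval (G j) p.
have uh p : @is_hom _ _ (cug C0 p) (cug C0 p) (u p).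
  apply: hom_sum => j; case: (svalP (F j)) => _ H1 _; case: (svalP (G j)) => _ H2 _.
  exact: hom_comp (H1 p) (H2 p).
have ud p : cugd C0 p *m u p.+1 = u p *m cugd C0 p.
  rewrite mulmx_suml mulmx_sumr; apply: eq_bigr => j _.
  case: (svalP (F j)) => _ _ H1; case: (svalP (G j)) => _ _ H2.
  by rewrite mulmxA H1 -mulmxA H2 mulmxA.
have uu p : u p \in unitmx.
  elim: p => [|p IHp].
    rewrite /u (eq_bigr (fun j => f j *m g j)) ?fg ?unitmx1 // => j _.
    by case: (svalP (F j)) => -> _ _; case: (svalP (G j)) => -> _ _.
  rewrite -row_free_unit -kermx_eq0 -mxrank_eq0 -leqn0 leqNgt; apply/negP => /(essk p).
  move/(_ (submod_ker (uh _))); apply/negP; rewrite -leqNgt leqn0 mxrank_eq0 -submx0.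
  apply/rV_subP => x; rewrite sub_capmx => /andP[/submxP[y ->]] /sub_kermxP.
  rewrite -mulmxA ud mulmxA => /sub_kermxP yu.
  have sub : (kermx (cugd C0 p) *m u p <= kermx (cugd C0 p))%MS.
    by apply/sub_kermxP; rewrite -mulmxA -ud mulmxA mulmx_ker mul0mx.
  have: (kermx (cugd C0 p) <= kermx (cugd C0 p) *m u p)%MS.
    by rewrite -(geq_leqif (mxrank_leqif_sup sub)) mxrankMfree // row_free_unit.
  move/(submx_trans yu); rewrite submxMfree ?row_free_unit // => /sub_kermxP ->.
  exact: sub0mx.
apply: (@retract_unit _ _ _ (fun j => sval (F j) k.+1) (fun j => sval (G j) k.+1) _ _ (uu k.+1)) => j.
  by case: (svalP (F j)).
by case: (svalP (G j)).
Qed.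

Lemma retract_dim0 M (I : finType) (N : I -> amod) :
  retract_of M N -> (forall j, mdim (N j) = 0%N) -> mdim M = 0%N.
Proof.
move=> [f [g [_ _ fg]]] N0; rewrite -(mxrank1 K (mdim M)) -fg big1 ?mxrank0 // => j _.
by move: (f j) (g j); rewrite (N0 j) => a b; rewrite thinmx0 mul0mx.
Qed.

(** Minimal resolutions detect projective dimension, even when the bound is known only for modules
    having [M] as a summand of their sum. *)
Lemma pdim_minimal M (I : finType) (N : I -> amod) (R0 : presol M) d :
  is_module M -> (forall j, is_module (N j)) -> minimal_presol R0 -> retract_of M N ->
  (forall j, pdim_le (N j) d) -> forall k, (d < k)%N -> mdim (rP R0 k) = 0%N.
Proof.
move=> Mm Nm HR0 rMN Nd k dk.
have R j := constructive_indefinite_description _ (Nd j).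
apply: (@retract_dim0 _ I (fun j => rP (sval (R j)) k)).
  by apply: compare_pres => // j; case: (svalP (R j)).
by move=> j; case: (svalP (R j)) => _; apply.
Qed.

Lemma retract_id M : retract_of M (fun _ : 'I_1 => M).
Proof. by apply: (@retract1 _ _ _ _ 1%:M 1%:M); rewrite ?mulmx1 //; apply: hom_id. Qed.

Lemma retract_both M N : retract_of M (fun _ : 'I_1 => N) -> (mdim N <= mdim M)%N -> mod_iso M N.
Proof.
move=> [f [g [fh gh]]]; rewrite big_ord1 => fg le; exists (f ord0); split=> //.
have ff : row_free (f ord0) by apply/row_freeP; exists (g ord0).
by split=> //; rewrite /row_full eqn_leq rank_leq_col /= (eqP ff).
Qed.

Lemma min_iso M (R R' : presol M) k :
  is_module M -> minimal_presol R -> minimal_presol R' -> mod_iso (rP R k) (rP R' k).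
Proof.
move=> Mm HR HR'.
have r1 := compare_pres k Mm (fun=> Mm) HR (fun _ : 'I_1 => proj1 HR') (retract_id M).
have r2 := compare_pres k Mm (fun=> Mm) HR' (fun _ : 'I_1 => proj1 HR) (retract_id M).
apply: retract_both => //.
case: r2 => f [g [_ _]]; rewrite big_ord1 => fg.
have ff : row_free (f ord0) by apply/row_freeP; exists (g ord0).
by rewrite -(eqP ff) rank_leq_col.
Qed.

End Compare.

(** * Paths *)

Section Paths.
Variable Q : monquiver.
Local Notation n := (qn Q).
Local Notation m := (qm Q).
Local Notation src := (@qsrc Q).
Local Notation tgt := (@qtgt Q).
Implicit Types (s v : nat) (l y z : seq 'I_m) (p q : qpath Q).

(** The start [s] is a plain number. A nonempty path determines it, but for the trivial path it is
    arbitrary, hence the separate conditions [s < n] below. *)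
Definition good s l := composable s l && nonzero_path l.

Lemma composable_cat s l1 l2 :
  composable s (l1 ++ l2) = composable s l1 && composable (ptgt s l1) l2.
Proof. by elim: l1 s => [|a l1 IH] s //=; rewrite IH andbA. Qed.

Lemma ptgt_cat s l1 l2 : ptgt s (l1 ++ l2) = ptgt (ptgt s l1) l2.
Proof. by rewrite /ptgt map_cat last_cat. Qed.

Lemma ptgt_cons s a l : ptgt s (a :: l) = ptgt (tgt a) l.
Proof. by []. Qed.

Lemma ptgt_rcons s l a : ptgt s (rcons l a) = tgt a.
Proof. by rewrite /ptgt map_rcons last_rcons. Qed.

Lemma composable_rcons s l a : composable s (rcons l a) = composable s l && (src a == ptgt s l :> nat).
Proof. by rewrite -cats1 composable_cat /= andbT. Qed.

Lemma nz_sub l1 l2 l3 : nonzero_path (l1 ++ l2 ++ l3) -> nonzero_path l2.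
Proof.
apply: contra => /hasP[r rQ /infixP[s [s' ->]]]; apply/hasP; exists r => //.
by apply/infixP; exists (l1 ++ s), (s' ++ l3); rewrite !catA.
Qed.

Lemma nz_catl l1 l2 : nonzero_path (l1 ++ l2) -> nonzero_path l1.
Proof. exact: (@nz_sub [::]). Qed.

Lemma nz_catr l1 l2 : nonzero_path (l1 ++ l2) -> nonzero_path l2.
Proof. by rewrite -{1}[l2]cats0; apply: nz_sub. Qed.

Lemma goodl s l1 l2 : good s (l1 ++ l2) -> good s l1.
Proof. by rewrite /good composable_cat => /andP[/andP[-> _] /nz_catl]. Qed.

Lemma goodr s l1 l2 : good s (l1 ++ l2) -> good (ptgt s l1) l2.
Proof. by rewrite /good composable_cat => /andP[/andP[_ ->] /nz_catr]. Qed.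

Lemma good_cat s l1 l2 : good s l1 -> good (ptgt s l1) l2 ->
  good s (l1 ++ l2) = nonzero_path (l1 ++ l2).
Proof. by rewrite /good composable_cat => /andP[-> _] /andP[-> _]. Qed.

Hypothesis harr : forall a, (src a < tgt a)%N.

Lemma composable_le s l : composable s l -> (s + size l <= ptgt s l)%N.
Proof.
elim: l s => [|a l IH] s /=; first by rewrite addn0.
case/andP=> /eqP <- /IH; apply: leq_trans; rewrite addnS -addSn leq_add2r; exact: harr.
Qed.

Lemma composable_lt s l : composable s l -> l != [::] -> (s < ptgt s l)%N.
Proof. by move=> /composable_le le; case: l le => // a l le _; apply: leq_trans le; rewrite /= addnS ltnS leq_addr. Qed.

Lemma ptgt_bound s l : (s < n)%N -> (ptgt s l < n)%N.
Proof. by case/lastP: l => [|l a] // _; rewrite ptgt_rcons. Qed.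

Lemma mem_allseqs k l : (l \in allseqs Q k) = (size l == k).
Proof.
elim: k l => [|k IH] [|a l] //=; first by apply/allpairsP => -[[b l'] [_ _ /=]].
rewrite eqSS -IH; apply/allpairsP/idP => [[[b l'] [/= _ H [_ ->]]]|H] //.
by exists (a, l); rewrite mem_enum.
Qed.

(** The enumeration stops below length n, but labels increase along a path, so no nonzero path is
    missed. *)
Lemma mem_nz p : (p \in nzpaths Q) = (p.1 < n)%N && good p.1 p.2.
Proof.
case: p => s l /=; apply/allpairsPdep/andP => [[i [l' [/=]]]|[sn gl]].
  by rewrite mem_iota mem_filter => ilt /andP[H _] [-> ->].
exists s, l; split=> //; first by rewrite mem_iota.
rewrite mem_filter; apply/andP; split=> //; apply/flattenP; exists (allseqs Q (size l)); last by rewrite mem_allseqs.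
apply/mapP; exists (size l) => //; rewrite mem_iota /= add0n.
case/andP: gl => /composable_le H _; apply: leq_ltn_trans (ptgt_bound l sn).
by apply: leq_trans H; rewrite leq_addl.
Qed.

Lemma allseqs_uniq k : uniq (allseqs Q k).
Proof.
elim: k => //= k IH; apply: allpairs_uniq => //; first exact: enum_uniq.
by move=> [a l] [a' l'] _ _ [-> ->].
Qed.

Lemma nzpaths_uniq : uniq (nzpaths Q).
Proof.
apply: allpairs_uniq_dep; first exact: iota_uniq; last by move=> [a l] [a' l'] _ _ [-> ->].
move=> i _; apply: filter_uniq; move: (iota 0 n) (iota_uniq 0 n) => r.
elim: r => //= k r IH /andP[kr /IH ur]; rewrite cat_uniq allseqs_uniq ur andbT /=.
apply/hasPn => l /flattenP[_ /mapP[k' k'r ->]]; rewrite !mem_allseqs => /eqP ->.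
by apply: contra kr => /eqP <-.
Qed.

Hypothesis hrel : forall r, r \in qrels Q -> (2 <= size r)%N.

Lemma nz_short l : (size l < 2)%N -> nonzero_path l.
Proof.
move=> sl; apply/hasPn => r /hrel sr; apply/negP => /size_infix; rewrite leqNgt.
by rewrite (leq_trans sl sr).
Qed.

Lemma good_nil s : good s [::]. Proof. by rewrite /good nz_short. Qed.

Lemma good_arrow a : good (src a) [:: a]. Proof. by rewrite /good /= eqxx nz_short. Qed.

Lemma mem_triv s : (s < n)%N -> (s, [::]) \in nzpaths Q.
Proof. by move=> sn; rewrite mem_nz /= sn good_nil. Qed.

End Paths.

(** * Modules with a basis of paths *)

Section PathModules.
Variables (Q : monquiver) (K : fieldType).
Local Notation n := (qn Q).
Local Notation m := (qm Q).
Local Notation src := (@qsrc Q).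
Local Notation tgt := (@qtgt Q).
Local Notation amod := (amod Q K).
Local Notation qpath := (qpath Q).
Implicit Types (M X Y : amod) (B : seq qpath) (p q : qpath) (l : seq 'I_m).

Hypothesis harr : forall a, (src a < tgt a)%N.
Hypothesis hrel : forall r, r \in qrels Q -> (2 <= size r)%N.

Local Arguments mE : simpl never.
Local Arguments mX : simpl never.

Let x0 : qpath := (0%N, [::]).

(** It vanishes for [p] outside [B], and thus also stands for a product of paths that is zero in the
    module. *)
Definition dl B p : 'rV[K]_(size B) := \row_q (nth x0 B q == p)%:R.
Definition dlo B (o : option qpath) : 'rV[K]_(size B) := oapp (dl B) 0 o.
(** The maps in the resolutions send a basis path to a basis path or to zero, or are sums of such
    maps; encoding them by partial functions turns exactness into combinatorics. *)
Definition pmx B B' (t : qpath -> option qpath) : 'M[K]_(size B, size B') :=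
  \matrix_(p, q) (t (nth x0 B p) == Some (nth x0 B' q))%:R.
Definition cf B (v : 'rV[K]_(size B)) p : K := (v *m (dl B p)^T) 0 0.

Lemma dl_notin B p : p \notin B -> dl B p = 0.
Proof.
move=> pB; apply/rowP => i; rewrite !mxE; case: eqP => // e.
by case/negP: pB; rewrite -e mem_nth.
Qed.

Lemma dl_delta B (i : 'I_(size B)) : uniq B -> dl B (nth x0 B i) = delta_mx 0 i.
Proof. by move=> uB; apply/rowP => j; rewrite !mxE /= nth_uniq // eq_sym. Qed.

Lemma dl_row B k (A : 'M[K]_(size B, k)) (i : 'I_(size B)) :
  uniq B -> dl B (nth x0 B i) *m A = row i A.
Proof. by move=> uB; rewrite dl_delta // -rowE. Qed.

Lemma dl_eq B k (A A' : 'M[K]_(size B, k)) :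
  uniq B -> (forall p, p \in B -> dl B p *m A = dl B p *m A') -> A = A'.
Proof. by move=> uB H; apply/row_matrixP => i; rewrite -!dl_row // H ?mem_nth. Qed.

Lemma dl_eq_col B k (A A' : 'M[K]_(k, size B)) :
  uniq B -> (forall p, p \in B -> A *m (dl B p)^T = A' *m (dl B p)^T) -> A = A'.
Proof.
move=> uB H; apply: trmx_inj; apply: dl_eq => // p pB; apply: trmx_inj.
by rewrite !trmx_mul !trmxK H.
Qed.

Lemma dl_sub B k k' (A : 'M[K]_(size B, k)) (U : 'M[K]_(k', k)) :
  uniq B -> (forall p, p \in B -> (dl B p *m A <= U)%MS) -> (A <= U)%MS.
Proof. by move=> uB H; apply/row_subP => i; rewrite -dl_row // H ?mem_nth. Qed.

Lemma dl_pmx B B' t p : uniq B -> p \in B -> dl B p *m pmx B B' t = dlo B' (t p).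
Proof.
move=> uB pB; rewrite -(nth_index x0 pB); have iB : (index p B < size B)%N by rewrite index_mem.
rewrite -[index p B]/(val (Ordinal iB)) dl_row //= nth_index //.
by apply/rowP => j; rewrite !mxE nth_index //; case: (t p) => [q|] /=; rewrite !mxE // eq_sym.
Qed.

Lemma cf_dl B p q : uniq B -> cf (dl B p) q = ((p == q) && (p \in B))%:R.
Proof.
move=> uB; case: (boolP (p \in B)) => pB; last by rewrite dl_notin // /cf mul0mx mxE andbF.
rewrite andbT -(nth_index x0 pB); have iB : (index p B < size B)%N by rewrite index_mem.
by rewrite -[index p B]/(val (Ordinal iB)) /cf dl_row // !mxE /= nth_index.
Qed.

Lemma cfD B v w p : @cf B (v + w) p = cf v p + cf w p.
Proof. by rewrite /cf mulmxDl mxE. Qed.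
Lemma cfZ B c v p : @cf B (c *: v) p = c * cf v p.
Proof. by rewrite /cf -scalemxAl mxE. Qed.
Lemma cf0 B p : @cf B 0 p = 0.
Proof. by rewrite /cf mul0mx mxE. Qed.
Lemma cf_sum B (I : Type) (r : seq I) P (F : I -> 'rV[K]_(size B)) p :
  cf (\sum_(i <- r | P i) F i) p = \sum_(i <- r | P i) cf (F i) p.
Proof. by elim/big_rec2: _ => [|i x y _ <-]; rewrite ?cf0 ?cfD. Qed.

Lemma cf_expand B v : uniq B -> v = \sum_(p <- B) cf v p *: dl B p.
Proof.
move=> uB; rewrite (big_nth x0) big_mkord [v in LHS]row_sum_delta.
apply: eq_bigr => i _; rewrite dl_delta // /cf dl_delta // trmx_delta -colE !mxE //.
Qed.

Lemma cf_inj B v w : uniq B -> (forall p, p \in B -> cf v p = @cf B w p) -> v = w.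
Proof.
move=> uB H; rewrite (cf_expand v uB) (cf_expand w uB).
by apply: eq_big_seq => p pB; rewrite H.
Qed.

Lemma cf_mul_sum B k (v : 'rV[K]_(size B)) (A : 'M_(size B, k)) :
  uniq B -> v *m A = \sum_(p <- B) cf v p *: (dl B p *m A).
Proof.
move=> uB; rewrite {1}(cf_expand v uB) mulmx_suml; apply: eq_bigr => p _.
by rewrite scalemxAl.
Qed.

Lemma cf_pmx B B' t v p q : uniq B -> uniq B' -> p \in B -> q \in B' -> t p = Some q ->
  (forall p', p' \in B -> t p' = Some q -> p' = p) -> cf (v *m pmx B B' t) q = cf v p.
Proof.
move=> uB uB' pB qB tp H; rewrite cf_mul_sum // cf_sum (big_rem p) //= big1_seq.
  by rewrite addr0 cfZ dl_pmx // tp cf_dl // eqxx qB mulr1.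
move=> p' /= ; rewrite mem_rem_uniq // inE => /andP[np p'B].
rewrite cfZ dl_pmx //; case e: (t p') => [q'|] /=; last by rewrite cf0 mulr0.
rewrite cf_dl //; case: eqP => [e'|]; last by rewrite mulr0.
by rewrite e' in e; rewrite (H p') ?eqxx in np.
Qed.

(** Where [t'] is defined it is injective, so coefficients survive there and the kernel is spanned
    by the basis paths at which [t'] is undefined; these are the values of [t]. *)
Lemma pmx_exact B B' B'' t t' :
  uniq B -> uniq B' -> uniq B'' ->
  (forall p q, p \in B -> t p = Some q -> t' q = None /\ q \in B') ->
  (forall q, q \in B' -> t' q = None -> exists2 p, p \in B & t p = Some q) ->
  (forall q r, q \in B' -> t' q = Some r -> r \in B'') ->
  (forall q q' r, q \in B' -> q' \in B' -> t' q = Some r -> t' q' = Some r -> q = q') ->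
  (pmx B B' t == kermx (pmx B' B'' t'))%MS.
Proof.
move=> uB uB' uB'' H1 H2 H3 H4; apply/andP; split.
  apply/sub_kermxP; apply: dl_eq => // p pB; rewrite mulmx0 mulmxA dl_pmx //.
  case e: (t p) => [q|] /=; last by rewrite mul0mx.
  by have [t'q qB'] := H1 p q pB e; rewrite dl_pmx // t'q.
apply/rV_subP => v /sub_kermxP v0; rewrite (cf_expand v uB') big_seq.
apply: summx_sub => q qB'; case e: (t' q) => [r|]; last first.
  by have [p pB tp] := H2 q qB' e; rewrite scalemx_sub // -[dl _ q]/(dlo B' (Some q)) -tp -(dl_pmx B' t uB pB) submxMl.
have := congr1 (fun w => cf w r) v0.
rewrite /= (@cf_pmx B' B'' t' v q r) ?(H3 q) // => [->|q' qB1 e']; first by rewrite cf0 scale0r sub0mx.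
exact: H4 qB1 qB' e' e.
Qed.

Lemma pmx_full B B' t : uniq B -> uniq B' ->
  (forall q, q \in B' -> exists2 p, p \in B & t p = Some q) -> row_full (pmx B B' t).
Proof.
move=> uB uB' H; rewrite -sub1mx; apply: dl_sub => // q /H[p pB tp].
by rewrite mulmx1 -[dl _ q]/(dlo B' (Some q)) -tp -(dl_pmx B' t uB pB) submxMl.
Qed.

Lemma pmx_free B B' t : uniq B -> uniq B' ->
  (forall q, q \in B -> exists2 r, r \in B' & t q = Some r) ->
  (forall q q' r, q \in B -> q' \in B -> t q = Some r -> t q' = Some r -> q = q') ->
  row_free (pmx B B' t).
Proof.
move=> uB uB' H3 H4; rewrite -kermx_eq0 -submx0.
apply/rV_subP => v /sub_kermxP v0; rewrite (cf_expand v uB) big_seq; apply: summx_sub => q qB.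
have [r rB' e] := H3 q qB; have := congr1 (fun w => cf w r) v0.
rewrite /= (@cf_pmx B B' t v q r) // => [->|q' qB1 e']; first by rewrite cf0 scale0r sub0mx.
exact: H4 qB1 qB e' e.
Qed.

(* The idempotent of a vertex given as a natural number, 0 out of range. *)
Definition mEn M (v : nat) : 'M[K]_(mdim M) := oapp (mE M) 0 (insub v).

Lemma mEn_ord M (i : 'I_n) : mEn M i = mE M i.
Proof. by rewrite /mEn valK. Qed.

Lemma mEn_lt M v (h : (v < n)%N) : mEn M v = mE M (Ordinal h).
Proof. by rewrite -mEn_ord. Qed.

Lemma path_end M s l k (x : 'M[K]_(k, mdim M)) : is_module M -> x *m mEn M s = x -> composable s l ->
  x *m pathmx M l *m mEn M (ptgt s l) = x *m pathmx M l.
Proof.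
move=> Mm xs; case/lastP: l => [|l a] _; first by rewrite mulmx1.
by rewrite ptgt_rcons mEn_ord pathmx_rcons -!mulmxA (mXE Mm).
Qed.

Lemma mEn_mX M v a k (x : 'M[K]_(k, mdim M)) : is_module M -> x *m mEn M v = x ->
  src a != v :> nat -> x *m mX M a = 0.
Proof.
move=> Mm; rewrite /mEn; case: insubP => [i _ <-|_] /=; first by move=> xE ne; apply: (mEX_src Mm xE).
by move=> <- _; rewrite mulmx0 mul0mx.
Qed.

Lemma path_bad M s l k (x : 'M[K]_(k, mdim M)) : is_module M -> x *m mEn M s = x -> ~~ good s l ->
  x *m pathmx M l = 0.
Proof.
move=> Mm xs; rewrite /good negb_and => /orP[|nz]; last by rewrite pathmx_bad ?mulmx0.
elim/last_ind: l => // l a IH; rewrite composable_rcons negb_and pathmx_rcons mulmxA => /orP[/IH->|ne].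
  by rewrite mul0mx.
case: (boolP (composable s l)) => [cl|/IH->]; last by rewrite mul0mx.
exact: (mEn_mX Mm (path_end Mm xs cl)).
Qed.

Section PMod.
Variables (B : seq qpath) (vert : qpath -> nat) (act : qpath -> 'I_m -> option qpath).
Hypothesis uB : uniq B.
Let P := pmod K B vert act.

Lemma dl_mX p a : p \in B -> dl B p *m mX P a = dlo B (act p a).
Proof. by move=> pB; rewrite -(@dl_pmx B B (act^~ a)). Qed.

Lemma dl_mE p i : p \in B -> dl B p *m mE P i = if vert p == i then dl B p else 0.
Proof.
move=> pB; rewrite -(nth_index x0 pB); have iB : (index p B < size B)%N by rewrite index_mem.
rewrite -[index p B]/(val (Ordinal iB)) dl_row //.
apply/rowP => j; rewrite !mxE /= nth_index //.
rewrite -[LHS]/(((index p B == j) && (vert p == i))%:R).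
case: (vert p == i); rewrite ?andbF ?andbT !mxE //.
by congr (nat_of_bool _)%:R; rewrite -{2}(nth_index x0 pB) nth_uniq // eq_sym.
Qed.

Lemma dl_mEn p v : p \in B -> (vert p < n)%N -> dl B p *m mEn P v = if vert p == v then dl B p else 0.
Proof.
move=> pB vn; rewrite /mEn; case: insubP => [i _ <-|H] /=; first exact: dl_mE.
by rewrite mulmx0; case: eqP => // e; rewrite -e vn in H.
Qed.

Hypothesis vB : forall p, p \in B -> (vert p < n)%N.
Hypothesis aB : forall p a q, p \in B -> act p a = Some q ->
  [/\ vert p = src a, vert q = tgt a & q \in B].
Hypothesis rB : forall p r, p \in B -> r \in qrels Q -> dl B p *m pathmx P r = 0.

Lemma pmod_mod : is_module P.
Proof.
split=> [|i j|a|r rQ].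
- apply: dl_eq => // p pB; rewrite mulmx1 mulmx_sumr (bigD1 (Ordinal (vB pB))) //=.
  rewrite dl_mE //= eqxx big1 ?addr0 // => i ne; rewrite dl_mE //; case: eqP => // e.
  by case/negP: ne; apply/eqP/val_inj.
- apply: dl_eq => // p pB; rewrite mulmxA dl_mE //.
  case: (i =P j) => [<-|ne]; first by case: ifP => e; rewrite ?mul0mx ?dl_mE // e.
  case: ifP => [/eqP e|]; rewrite ?mul0mx ?mulmx0 // dl_mE // e.
  by case: eqP => // /val_inj.
- split; apply: dl_eq => // p pB; rewrite mulmxA ?dl_mE ?dl_mX //.
    case: eqP => ep; rewrite ?dl_mX ?mul0mx //; case e: (act p a) => [q|] //.
    by have [H] := aB pB e; rewrite H in ep.
  case e: (act p a) => [q|] /=; rewrite ?mul0mx //.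
  by have [_ e' qB] := aB pB e; rewrite dl_mE // e' eqxx.
- by apply: dl_eq => // p pB; rewrite rB // mulmx0.
Qed.

End PMod.

(** Such a list of paths is a basis of a right ideal of A; the cases used are A, sums of P(i), and
    rad P(k). *)
Definition rclosed B := [/\ uniq B, {subset B <= nzpaths Q} &
  forall s l l', (s, l) \in B -> good s (l ++ l') -> (s, l ++ l') \in B].

(** A predicate on numbers that no vertex satisfies gives the zero module; finite resolutions will
    end in this way. *)
Definition PB (S : pred nat) : seq qpath := [seq p <- nzpaths Q | S (pstart p)].

Lemma mem_PB S s l : ((s, l) \in PB S) = [&& S s, (s < n)%N & good s l].
Proof. by rewrite mem_filter mem_nz. Qed.

Lemma PB_closed S : rclosed (PB S).
Proof.
split; first by apply: filter_uniq; apply: nzpaths_uniq.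
  by move=> p; rewrite mem_filter => /andP[].
by move=> s l l'; rewrite !mem_PB => /and3P[-> -> _] ->.
Qed.

Lemma nz_closed : rclosed (nzpaths Q).
Proof. by split=> //; [exact: nzpaths_uniq | move=> s l l'; rewrite !mem_nz //= => /andP[-> _]]. Qed.

Section RMod.
Variable B : seq qpath.
Hypothesis cB : rclosed B.
Let uB : uniq B. Proof. by case: cB. Qed.
Let P := pmod K B (@pend Q) (@act_right Q).

Lemma rB_good s l : (s, l) \in B -> (s < n)%N /\ good s l.
Proof. by case: cB => _ sB _ /sB; rewrite mem_nz // => /andP[]. Qed.

Lemma dl_path_right s l l' : (s, l) \in B ->
  dl B (s, l) *m pathmx P l' = if good s (l ++ l') then dl B (s, l ++ l') else 0.
Proof.
move=> pB; have [sn gl] := rB_good pB.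
elim/last_ind: l' => [|l' a IH]; first by rewrite mulmx1 cats0 gl.
rewrite pathmx_rcons mulmxA IH -rcons_cat -cats1; case: ifP => g1; last first.
  by rewrite mul0mx; case: ifP => // /goodl; rewrite g1.
have qB : (s, l ++ l') \in B by case: cB => _ _; apply.
rewrite dl_mX // /act_right /= cats1; case: (boolP (good s (rcons (l ++ l') a))) => [g2|].
  case/andP: (g2); rewrite composable_rcons => /andP[_]; rewrite eq_sym => -> ->.
  by [].
rewrite /good composable_rcons; case/andP: g1 => -> _; rewrite /= eq_sym.
by case: (_ == _) => //= /negbTE ->.
Qed.

Lemma rmod_mod : is_module P.
Proof.
apply: pmod_mod => // [[s l] /rB_good[sn _]|[s l] a q pB|[s l] r pB rQ]; first exact: ptgt_bound.
  have [sn gl] := rB_good pB.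
  rewrite /act_right; case: ifP => //= /andP[/eqP e nz] [<-].
  have g : good s (rcons l a) by rewrite /good composable_rcons e eqxx nz (proj1 (andP gl)).
  by split=> //; [rewrite /pend /= ptgt_rcons | rewrite -cats1; case: cB => _ _; apply=> //; rewrite cats1].
rewrite dl_path_right //; case: ifP => // /andP[_]; rewrite /nonzero_path => /hasP[].
by exists r => //; apply: suffixW; apply: suffix_suffix.
Qed.

(** [x v] is the intended image of the trivial path at v, a generator of P(v). *)
Definition homP M (x : nat -> 'rV[K]_(mdim M)) : 'M[K]_(size B, mdim M) :=
  \matrix_i (x (nth x0 B i).1 *m pathmx M (nth x0 B i).2).

Lemma dl_homP M x p : p \in B -> dl B p *m homP (M := M) x = x p.1 *m pathmx M p.2.
Proof.
move=> pB; rewrite -{1}(nth_index x0 pB); have iB : (index p B < size B)%N by rewrite index_mem.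
by rewrite -[index p B]/(val (Ordinal iB)) dl_row // rowK /= nth_index.
Qed.

Lemma homP_hom M (x : nat -> 'rV[K]_(mdim M)) : is_module M ->
  (forall p, p \in B -> x p.1 *m mEn M p.1 = x p.1) -> @is_hom _ _ P M (homP x).
Proof.
move=> Mm xB; split=> [i|a]; apply: dl_eq => // -[s l] pB; rewrite !mulmxA dl_homP //=.
  have [sn /andP[cl _]] := rB_good pB.
  have := path_end Mm (xB _ pB) cl; rewrite /= => E.
  rewrite dl_mE // /pend /=; case: eqP => [e|ne].
    by rewrite dl_homP //= -mEn_ord -e E.
  by rewrite mul0mx -E -mulmxA (mEn_lt _ (ptgt_bound l sn)) (mEE Mm); case: eqP => [e|_]; rewrite ?mulmx0 //; case: ne; rewrite -e.
rewrite dl_mX //; have [sn gl] := rB_good pB.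
rewrite -mulmxA -pathmx_rcons; case: (boolP (good s (rcons l a))) => [g|ng]; last first.
  rewrite (path_bad Mm (xB _ pB)) // /act_right; case: ifP => /= [/andP[/eqP e nz]|_]; last by rewrite mul0mx.
  by case/negP: ng; rewrite /good composable_rcons e eqxx nz (proj1 (andP gl)).
have /andP[] := g; rewrite composable_rcons /act_right => /andP[_ /eqP ->] ->; rewrite eqxx /=.
by rewrite dl_homP //= -cats1; case: cB => _ _; apply=> //; rewrite cats1.
Qed.

Lemma hom_right_gen M (f : 'M[K]_(size B, mdim M)) s l l' : @is_hom _ _ P M f -> (s, l) \in B ->
  good s (l ++ l') -> dl B (s, l ++ l') *m f = dl B (s, l) *m f *m pathmx M l'.
Proof. by move=> fh pB g; rewrite -mulmxA -(hom_path _ fh) mulmxA dl_path_right // g. Qed.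

End RMod.

Lemma PB_proj S : projective (pmod K (PB S) (@pend Q) (@act_right Q)).
Proof.
move=> X Y g f Xm Ym gh gf fh; have cB := PB_closed S; have [uB _ _] := cB.
(* Lift the image of the generator at v linearly, then project the lift to the vertex v. *)
pose x v := dl (PB S) (v, [::]) *m f *m pinvmx g *m mEn X v.
have trB s l : (s, l) \in PB S -> (s, [::]) \in PB S by rewrite !mem_PB => /and3P[-> -> _]; rewrite good_nil.
exists (homP (PB S) x); split.
  apply: homP_hom => // -[s l] /trB; rewrite mem_PB => /and3P[_ sn _] /=.
  by rewrite /x -mulmxA (mEn_lt _ sn) (mEid Xm).
apply: dl_eq => // -[s l] pB; rewrite mulmxA dl_homP //= -mulmxA (hom_path _ gh) mulmxA.
have pB' := trB _ _ pB; have [sn gl] := rB_good cB pB.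
rewrite (_ : x s *m g = dl (PB S) (s, [::]) *m f); last first.
  rewrite /x (mEn_lt _ sn) -(mulmxA _ (mE X _)); case: (gh) => -> _.
  rewrite mulmxA -(mulmxA _ (pinvmx g)) mulVpmx // mulmx1 -mulmxA.
  by case: (fh) => <- _; rewrite mulmxA dl_mE //= /pend /ptgt /= eqxx.
by rewrite -(hom_right_gen cB fh pB').
Qed.

Definition IB (S : pred nat) : seq qpath := [seq p <- nzpaths Q | S (pend p)].

Lemma mem_IB S s l : ((s, l) \in IB S) = [&& S (ptgt s l), (s < n)%N & good s l].
Proof. by rewrite mem_filter mem_nz. Qed.

Lemma IB_uniq S : uniq (IB S).
Proof. by apply: filter_uniq; apply: nzpaths_uniq. Qed.

Section LMod.
Variable S : pred nat.
Let B := IB S.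
Let uB : uniq B := IB_uniq S.
Let P := pmod K B (@pstart Q) (@act_dual Q).

Lemma IB_tail s a l : (s, a :: l) \in B -> src a = s :> nat /\ (tgt a : nat, l) \in B.
Proof.
rewrite !mem_IB => /and3P[St sn /andP[/= /andP[/eqP e cl] nz]]; split=> //.
by rewrite (St : S (ptgt (tgt a) l)) ltn_ord /good cl (@nz_catr _ [:: a]).
Qed.

Lemma dl_path_dual s l l' : (s, l) \in B ->
  dl B (s, l) *m pathmx P l' = if prefix l' l then dl B (ptgt s l', drop (size l') l) else 0.
Proof.
elim: l' s l => [|a l' IH] s l pB; first by rewrite mulmx1 prefix0s drop0.
rewrite pathmx_cons mulmxA dl_mX // /act_dual /=; case: l pB => [|b l] pB /=; first by rewrite mul0mx.
rewrite eq_sym; case: eqP => [e|_] /=; last by rewrite mul0mx.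
by subst b; have [_ /IH ->] := IB_tail pB.
Qed.

Lemma lmod_mod : is_module P.
Proof.
apply: pmod_mod => // [[s l]|[s [|b l]] a q pB|[s l] r pB rQ] //.
- by rewrite mem_IB => /and3P[].
- rewrite /act_dual /=; case: eqP => // e [<-]; subst b.
  by have [<- H] := IB_tail pB.
- rewrite dl_path_dual //; case: ifP => // /prefixW il; move: pB.
  by rewrite mem_IB => /and3P[_ _ /andP[_ /hasPn/(_ r rQ)]]; rewrite il.
Qed.

Lemma col_mX q a : q \in B -> mX P a *m (dl B q)^T =
  if tgt a == q.1 :> nat then (dl B (src a : nat, a :: q.2))^T else 0.
Proof.
move=> qB; apply: dl_eq => // -[s l] pB; rewrite mulmxA dl_mX //=.
have E p' q' : dl B p' *m (dl B q')^T = (cf (dl B p') q')%:M :> 'M_1.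
  by apply/matrixP => i j; rewrite !ord1 /cf [RHS]mxE mulr1n.
rewrite /act_dual /=; case: l pB => [|b l] pB /=.
  rewrite mul0mx; case: ifP => _; rewrite ?mulmx0 // E cf_dl //.
  by case: eqP => [[]|_] //; rewrite raddf0.
have [sb tB] := IB_tail pB; case: (b =P a) => [e|ne] /=; last first.
  rewrite mul0mx; case: ifP => _; rewrite ?mulmx0 // E cf_dl //.
  by case: eqP => [[]|_] //; rewrite raddf0.
subst b; case: q qB => s' l' qB /=; case: eqP => [e|ne].
  rewrite -sb in pB *; rewrite !E !cf_dl // -e !xpair_eqE eqseq_cons !eqxx /= tB.
  by rewrite pB.
by rewrite mulmx0 E cf_dl //; case: eqP => [[]|_] //; rewrite raddf0.
Qed.

Lemma col_mE q i : q \in B -> mE P i *m (dl B q)^T = if q.1 == i then (dl B q)^T else 0.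
Proof.
move=> qB; apply: dl_eq => // p pB; rewrite mulmxA dl_mE //.
have E p' q' : dl B p' *m (dl B q')^T = (cf (dl B p') q')%:M :> 'M_1.
  by apply/matrixP => i' j; rewrite !ord1 /cf [RHS]mxE mulr1n.
rewrite /pstart; case: (q.1 =P i) => e; case: (p.1 =P i) => e'; rewrite ?mulmx0 ?mul0mx ?E ?cf_dl //.
  by case: eqP => [e1|_]; rewrite ?raddf0 //; case: e'; rewrite e1.
by case: eqP => [e1|_]; rewrite ?raddf0 //; case: e; rewrite -e1.
Qed.

(** Homomorphisms into I(v) correspond to linear functionals on M e_v, written as columns. The
    coefficient of an image at the path q is the functional evaluated after acting by q. *)
Definition homI M (x : nat -> 'cV[K]_(mdim M)) : 'M[K]_(mdim M, size B) :=
  \matrix_(i, j) ((pathmx M (nth x0 B j).2 *m x (pend (nth x0 B j))) i 0).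

Lemma homI_col M x q : q \in B -> homI (M := M) x *m (dl B q)^T = pathmx M q.2 *m x (pend q).
Proof.
move=> qB; rewrite -{1}(nth_index x0 qB); have iB : (index q B < size B)%N by rewrite index_mem.
rewrite -[index q B]/(val (Ordinal iB)) dl_delta // trmx_delta -colE.
by apply/matrixP => i j; rewrite !mxE !ord1 /= nth_index.
Qed.

Lemma homI_hom M (x : nat -> 'cV[K]_(mdim M)) : is_module M ->
  (forall v, S v -> mEn M v *m x v = x v) -> @is_hom _ _ M P (homI x).
Proof.
move=> Mm xS; split=> [i|a]; apply: dl_eq_col => // -[s l] qB; rewrite -!mulmxA homI_col // ?col_mE ?col_mX //=.
  have := qB; rewrite mem_IB => /and3P[Sv sn /andP[cl _]].
  have E : mEn M s *m (pathmx M l *m x (ptgt s l)) = pathmx M l *m x (ptgt s l).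
    case: l cl Sv {qB} => [|b l] /=; first by rewrite !mul1mx => _; apply: xS.
    by case/andP=> /eqP <- _ _; rewrite mEn_ord pathmx_cons !mulmxA (mEX Mm).
  rewrite /pend /= -[in LHS]E (mEn_lt _ sn) mulmxA (mEE Mm) eq_sym.
  rewrite -[Ordinal sn == i]/(s == i); case: ifP => e; last by rewrite mul0mx mulmx0.
  by rewrite homI_col // -mEn_ord -(eqP e) E.
have [ae|ne] := eqVneq (tgt a : nat) s; last first.
  rewrite mulmx0; have := qB; rewrite mem_IB => /and3P[Sv sn /andP[cl _]].
  case: l cl Sv {qB} => [|b l] /=.
    move=> _ Sv; rewrite /pend /ptgt /= mul1mx -(xS s) // mulmxA -(mXE Mm) -!mulmxA (mulmxA (mE M _)).
    rewrite (mEn_lt _ sn) (mEE Mm); case: eqP => [e|_]; last by rewrite mul0mx mulmx0.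
    by case/eqP: ne; rewrite e.
  case/andP=> /eqP e _ _; rewrite pathmx_cons !mulmxA -(mXE Mm) -(mEX Mm b) -!mulmxA (mulmxA (mE M _)).
  rewrite (mEE Mm); case: eqP => [e'|_]; last by rewrite mul0mx mulmx0.
  by case/eqP: ne; rewrite e' e.
rewrite mulmxA -pathmx_cons; case: (boolP (nonzero_path (a :: l))) => nz; last first.
  rewrite (pathmx_bad Mm nz) mul0mx dl_notin ?trmx0 ?mulmx0 //.
  by rewrite mem_IB /good (negbTE nz) !andbF.
have qB' : (src a : nat, a :: l) \in B.
  move: qB; rewrite !mem_IB => /and3P[Sv _ /andP[cl _]].
  have -> : S (ptgt (src a) (a :: l)) by rewrite ptgt_cons ae.
  by rewrite ltn_ord /good /= eqxx ae cl.
by rewrite homI_col // /pend [ptgt _ (a :: l)]ptgt_cons ae.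
Qed.

(** By the correspondence with functionals, only a functional has to be extended along [f], and a
    linear retraction [r] of [f] does this. *)
Lemma IB_inj : Defs.injective P.
Proof.
move=> X Y f g Xm Ym fh ff gh.
have /row_freeP[r fr] := ff.
pose x v := mEn Y v *m r *m g *m (dl B (v, [::]))^T.
have xE v : mEn Y v *m x v = x v.
  rewrite /x !mulmxA /mEn; case: insubP => [i _ _|_] /=; first by rewrite (mEid Ym).
  by rewrite !mul0mx.
exists (homI x); split; first by apply: homI_hom.
apply: dl_eq_col => // -[s l] qB; rewrite -mulmxA homI_col //= mulmxA -(hom_path _ fh) -mulmxA.
have := qB; rewrite mem_IB => /and3P[Sv sn /andP[cl nz]].
have tn := ptgt_bound l sn; rewrite /pend /=.
have tB : (ptgt s l, [::]) \in B by rewrite mem_IB Sv tn good_nil.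
have -> : f *m x (ptgt s l) = g *m (dl B (ptgt s l, [::]))^T.
  rewrite /x (mEn_lt _ tn) !mulmxA; case: (fh) => <- _; rewrite -(mulmxA _ f) fr mulmx1.
  by case: (gh) => -> _; rewrite -mulmxA col_mE //= eqxx.
rewrite mulmxA (hom_path _ gh) -mulmxA; congr (_ *m _).
apply: dl_eq => // -[s' l'] pB; rewrite mulmxA dl_path_dual //.
have E p' q' : dl B p' *m (dl B q')^T = (cf (dl B p') q')%:M :> 'M_1.
  by apply/matrixP => i' j; rewrite !ord1 /cf [RHS]mxE mulr1n.
rewrite E cf_dl // pB andbT; case: (boolP (prefix l l')) => [/prefixP[t et]|np].
  rewrite E cf_dl // et drop_size_cat //.
  have := pB; rewrite mem_IB et ptgt_cat => /and3P[St s'n g'].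
  rewrite mem_IB St ptgt_bound // (goodr g') /= !andbT; congr (nat_of_bool _)%:R%:M.
  apply/idP/idP => [/eqP e|/eqP e]; last first.
    by case: e => -> /eqP; rewrite -{2}[l]cats0 eqseq_cat // eqxx => /eqP ->; rewrite eqxx.
  case: e => e1 ->; rewrite cats0 xpair_eqE eqxx andbT; apply/eqP.
  case: l e1 cl g' {nz qB tB Sv tn pB et St} => [|b l] //= _ /andP[/eqP <- _].
  by case/andP=> /andP[/eqP <-].
rewrite mul0mx; case: eqP => [[_ e]|_]; last by rewrite raddf0.
by rewrite e prefix_refl in np.
Qed.

End LMod.

End PathModules.

(** * Projective covers and injective envelopes *)

Section Covers.
Variables (Q : monquiver) (K : fieldType).
Local Notation n := (qn Q).
Local Notation m := (qm Q).
Local Notation src := (@qsrc Q).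
Local Notation tgt := (@qtgt Q).
Local Notation amod := (amod Q K).
Implicit Types (M X Y F J : amod) (v i : 'I_n).

Hypothesis harr : forall a, (src a < tgt a)%N.
Hypothesis hrel : forall r, r \in qrels Q -> (2 <= size r)%N.

Definition zero_mod : amod := @AMod Q K 0 (fun _ => 0) (fun _ => 0).

Lemma zero_is_module M : mdim M = 0%N -> is_module M.
Proof.
case: M => d E X /= d0; subst d.
by split=> [|i j|a|r _]; try split; rewrite [LHS]flatmx0 ?[RHS]flatmx0 //; case: eqP => // _; rewrite [RHS]flatmx0.
Qed.

Lemma zero_projective M : mdim M = 0%N -> projective M.
Proof.
case: M => d E X /= d0 A Y g f; subst d => *; exists 0; split; first exact: hom_zero.
by rewrite mul0mx [RHS]flatmx0.
Qed.

Lemma zero_injective M : mdim M = 0%N -> Defs.injective M.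
Proof.
case: M => d E X /= d0 A Y g f; subst d => *; exists 0; split; first exact: hom_zero.
by rewrite mulmx0 [RHS]thinmx0.
Qed.

Lemma projmod_mod v : is_module (projmod K v).
Proof. exact: (rmod_mod K harr (PB_closed harr (fun u => u == v))). Qed.

Lemma projmod_proj v : projective (projmod K v).
Proof. exact (@PB_proj Q K harr hrel (fun u => u == v)). Qed.

Lemma injmod_mod v : is_module (injmod K v).
Proof. exact: (lmod_mod K harr (fun u => u == v)). Qed.

Lemma injmod_inj v : Defs.injective (injmod K v).
Proof. exact (@IB_inj Q K harr hrel (fun u => u == v)). Qed.

Inductive free_mod : amod -> Prop :=
 | free_zero : free_mod zero_mod
 | free_add F v : free_mod F -> free_mod (dsum F (projmod K v)).

Lemma free_is_module F : free_mod F -> is_module F.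
Proof.
by elim=> [|F' v _ IH]; [exact: zero_is_module | exact: dsum_mod IH (projmod_mod v)].
Qed.

Lemma free_projective F : free_mod F -> projective F.
Proof.
by elim=> [|F' v _ IH]; [exact: zero_projective | exact: dsum_proj IH (@projmod_proj v)].
Qed.

Lemma rad_hom M X (f : 'M[K]_(mdim M, mdim X)) : is_hom f -> (rad M *m f <= rad X)%MS.
Proof.
case=> _ fX; rewrite /rad sumsmxMr_gen; apply/sumsmx_subP => a _; rewrite genmxE fX.
by rewrite (submx_trans (submxMl _ _)) // (sumsmx_sup a).
Qed.

Lemma rad_projmod v (x : 'rV[K]_(mdim (projmod K v))) :
  @cf Q K (PB Q (fun u => u == v)) x (v : nat, [::]) = 0 -> (x <= rad (projmod K v))%MS.
Proof.
have cB := PB_closed harr (fun u => u == v); have [uB _ _] := cB.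
move=> x0; rewrite [x](@cf_expand Q K (PB Q (fun u => u == v)) x uB) big_seq.
apply: summx_sub => -[s l] pB; have [sn g] := rB_good harr cB pB.
case/lastP: l pB g => [|l a] pB g.
  by move: pB; rewrite mem_PB // => /andP[/eqP -> _]; rewrite x0 scale0r sub0mx.
apply: scalemx_sub; have gl : good s l by move: g; rewrite -cats1 => /goodl.
have pB' : (s, l) \in PB Q (fun u => u == v) by move: pB; rewrite !mem_PB // gl => /and3P[-> -> _].
have := dl_path_right K harr cB [:: a] pB'; rewrite cats1 g => <-.
rewrite pathmx_cons mulmx1; apply: submx_trans (submxMl _ _) _.
by rewrite /rad (sumsmx_sup a).
Qed.

(** Supports are tracked because each syzygy in a minimal resolution moves at least one vertex up;
    this bounds the global dimension. *)
Definition supp k M := forall i : 'I_n, (i < k)%N -> mE M i = 0.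

Lemma projmod_supp k (v : 'I_n) : (k <= v)%N -> supp k (projmod K v).
Proof.
move=> kv i ik; have cB := PB_closed harr (fun u => u == v); have [uB _ _] := cB.
apply: (@dl_eq Q K (PB Q (fun u => u == v))) => // -[s l] pB; rewrite mulmx0.
have -> := @dl_mE Q K (PB Q (fun u => u == v)) (@pend Q) (@act_right Q) uB (s, l) i pB.
have [sn /andP[cl _]] := rB_good harr cB pB; move: pB; rewrite mem_PB // => /and3P[/eqP e _ _].
case: eqP => // e'; have := composable_le harr cl; rewrite -[ptgt s l]/(pend (s, l)) e' e leqNgt.
by rewrite (leq_trans ik) // (leq_trans kv) // leq_addr.
Qed.

(** A projective cover built generator by generator: while image and radical do not fill [M], some
    vertex i contributes a vector outside, and P(i) is added. The invariant that only radical
    elements map into rad M keeps the kernel inside rad F. *)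
Lemma cover_aux M r F (f : 'M[K]_(mdim F, mdim M)) : is_module M ->
  (mdim M - \rank (f + rad M)%MS <= r)%N ->
  free_mod F -> is_hom f -> (forall k : 'rV_(mdim F), (k *m f <= rad M)%MS -> (k <= rad F)%MS) ->
  (forall k, supp k M -> supp k F) ->
  exists c : {F : amod & 'M[K]_(mdim F, mdim M)}, let f := projT2 c in
    [/\ free_mod (projT1 c), is_hom f, (1%:M <= f + rad M)%MS,
      forall k : 'rV_(mdim (projT1 c)), (k *m f <= rad M)%MS -> (k <= rad (projT1 c))%MS &
      forall k, supp k M -> supp k (projT1 c)].
Proof.
move=> Mm; elim: r F f => [|r IH] F f le Ff fh inv sF.
  exists (existT _ F f); split=> //=; rewrite sub1mx /row_full eqn_leq rank_leq_col /=.
  by rewrite -subn_eq0 -leqn0.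
case: (boolP (1%:M <= f + rad M)%MS) => [full|nfull]; first by exists (existT _ F f).
have [i ni] : exists i, ~~ (mE M i <= f + rad M)%MS.
  apply/existsP; apply: contraR nfull; rewrite negb_exists => /forallP H.
  by rewrite -(mE_sum Mm); apply: summx_sub => i _; have := H i; rewrite negbK.
have /row_subPn[j nj] := ni; pose x := row j (mE M i).
have xi : x *m mE M i = x by rewrite /x -row_mul (mEid Mm).
pose B := PB Q (fun u => u == i) : seq (qpath Q).
have cB : rclosed B := PB_closed harr _; have [uB _ _] := cB.
have mB s l : ((s, l) \in B) = [&& s == i, (s < n)%N & good s l] := mem_PB harr _ s l.
pose h := homP B (fun _ => x) : 'M[K]_(mdim (projmod K i), mdim M).
have hh : is_hom h.
  apply: homP_hom => // -[s l]; rewrite mB => /and3P[/eqP -> _ _] /=.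
  by rewrite mEn_ord.
have f'h : @is_hom _ _ (dsum F (projmod K i)) M (col_mx f h) by apply: hom_col.
have eB : (i : nat, [::]) \in B by rewrite mB eqxx ltn_ord good_nil.
have eh : dl K B (i : nat, [::]) *m h = x by rewrite dl_homP //= mulmx1.
apply: (IH (dsum F (projmod K i)) (col_mx f h)) => //.
- have lt : (\rank (f + rad M)%MS < \rank (col_mx f h + rad M)%MS)%N.
    apply: rank_ltmx; rewrite ltmxE; apply/andP; split.
      by apply: addsmxS => //; rewrite -addsmxE addsmxSl.
    apply: contra nj; apply: submx_trans; rewrite -/x -eh.
    apply: submx_trans (submxMl _ _) _; apply: submx_trans (addsmxSl _ _).
    by rewrite -addsmxE addsmxSr.
  by rewrite -ltnS (leq_trans _ le) // ltn_sub2l // (leq_trans lt) // rank_leq_col.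
- exact: free_add.
- move=> k kr; set k1 := lsubmx k; set k2 := rsubmx k.
  have kE : k = row_mx k1 k2 by rewrite hsubmxK.
  pose c := @cf Q K B k2 (i : nat, [::]).
  pose k2' := k2 - c *: dl K B (i : nat, [::]).
  have k2r : (k2' <= rad (projmod K i))%MS.
    apply: rad_projmod; rewrite -/B /k2' -scaleN1r cfD cfZ cfZ cf_dl // eqxx eB /= mulr1 mulN1r.
    by rewrite subrr.
  have E : k *m col_mx f h = k1 *m f + c *: x + k2' *m h.
    rewrite kE mul_row_col -addrA; congr (_ + _).
    by rewrite /k2' mulmxBl -scalemxAl eh addrC subrK.
  have k2h : (k2' *m h <= rad M)%MS by apply: submx_trans (submxMr _ k2r) (rad_hom hh).
  have k1c : ((k1 *m f + c *: x)%R <= rad M)%MS.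
    have -> : k1 *m f + c *: x = k *m col_mx f h - k2' *m h by rewrite E addrK.
    by rewrite addmx_sub // eqmx_opp.
  (* Otherwise the new vector [x] would already lie in the image of [f] plus the radical. *)
  have c0 : c = 0.
    apply: contraNeq nj => c0; rewrite -/x -[x](scalerK c0) scalemx_sub //.
    have -> : c *: x = - k1 *m f + (k1 *m f + c *: x) by rewrite mulNmx addKr.
    by rewrite addmx_sub_adds // submxMl.
  rewrite c0 scale0r addr0 in k1c; rewrite /k2' c0 scale0r subr0 in k2r.
  have -> : k = k1 *m row_mx 1%:M 0 + k2 *m row_mx 0 1%:M.
    by rewrite !mul_mx_row !mulmx0 !mulmx1 add_row_mx addr0 add0r.
  apply: addmx_sub.
    apply: submx_trans (submxMr _ (inv _ k1c)) _.
    by apply: (@rad_hom F (dsum F (projmod K i))); apply: hom_row; [exact: hom_id | exact: hom_zero].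
  apply: submx_trans (submxMr _ k2r) _.
  by apply: (@rad_hom (projmod K i) (dsum F (projmod K i))); apply: hom_row; [exact: hom_zero | exact: hom_id].
- move=> k sM i' ik'; rewrite -[LHS]/(block_mx (mE F i') 0 0 (mE (projmod K i) i')) (sF k sM i' ik') (@projmod_supp k i _ i' ik') ?block_mx0 // leqNgt.
  apply/negP => /sM e; case/negP: nj; rewrite -/x -xi e mulmx0.
  exact: sub0mx.
Qed.

Lemma cover_ex M : is_module M -> exists c : {F : amod & 'M[K]_(mdim F, mdim M)}, let f := projT2 c in
    [/\ free_mod (projT1 c), is_hom f, row_full f, (kermx f <= rad (projT1 c))%MS &
      forall k, supp k M -> supp k (projT1 c)].
Proof.
move=> Mm.
have [||k _||[F f] [/= Ff fh full inv sF]] := @cover_aux M (mdim M) zero_mod 0 Mm (leq_subr _ _).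
- exact: free_zero.
- exact: hom_zero.
- by rewrite [k]thinmx0 sub0mx.
- by [].
exists (existT _ F f); split=> //=.
  by rewrite -sub1mx; apply: (nakayama harr) => //; apply: submod_im.
by apply/rV_subP => k /sub_kermxP kf; apply: inv; rewrite kf sub0mx.
Qed.

(** Covers of kernels are iterated. The kernel of each cover lies in the radical, hence one vertex
    further up. *)
Lemma pres_ex M : is_module M ->
  exists R : presol M, minimal_presol R /\ forall k, supp k (rP R k).
Proof.
move=> Mm; pose St := {M : amod | is_module M}.
pose cov (S : St) := constructive_indefinite_description _ (cover_ex (svalP S)).
pose F S := projT1 (sval (cov S)); pose f S : 'M[K]_(mdim (F S), mdim (sval S)) := projT2 (sval (cov S)).
have cP S : [/\ free_mod (F S), is_hom (f S), row_full (f S), (kermx (f S) <= rad (F S))%MS &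
      forall k, supp k (sval S) -> supp k (F S)] := svalP (cov S).
pose U S := row_base (kermx (f S)).
have Us S : is_submod (U S).
  by have [_ fh _ _ _] := cP S; apply: submod_eqmx (submod_ker fh); apply/eqmx_sym/eq_row_base.
have Uf S : row_free (U S) := row_base_free _.
have Uh S : @is_hom _ _ (subm (U S)) (F S) (U S) := subm_hom (Us S).
have Fm S : is_module (F S) by have [Ff _ _ _ _] := cP S; apply: free_is_module.
have nm S : is_module (subm (U S)) := mod_mono (Uh S) (Uf S) (Fm S).
pose nxt S : St := exist _ (subm (U S)) (nm S).
pose Sq k := iter k nxt (exist _ M Mm).
pose R := @PResol Q K M (fun k => F (Sq k)) (fun k => f (Sq k.+1) *m U (Sq k)) (f (Sq 0)).
have kerd k : (kermx (rd R k) :=: kermx (f (Sq k.+1)))%MS.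
  apply/eqmxP/andP; split; apply/sub_kermxP; last by rewrite /= mulmxA mulmx_ker mul0mx.
  by apply: (row_free_inj (Uf (Sq k))); rewrite mul0mx -mulmxA; apply: mulmx_ker.
have imd k : (rd R k :=: kermx (f (Sq k)))%MS.
  have [_ _ ff _ _] := cP (Sq k.+1).
  apply: eqmx_trans (eqmxMfull _ ff) _; exact: eq_row_base.
exists R; split; first split.
- split=> [k||||k].
  + by have [Ff _ _ _ _] := cP (Sq k); split; [exact: Fm | exact: free_projective].
  + split; first by case: (cP (Sq 0)).
    by move=> k; have [_ fh _ _ _] := cP (Sq k.+1); apply: hom_comp fh (Uh (Sq k)).
  + by case: (cP (Sq 0)).
  + by apply/eqmxP; exact: (imd 0%N).
  + by apply/eqmxP; apply: eqmx_trans (imd k.+1) (eqmx_sym (kerd k)).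
- split=> [|k]; apply: (sup_of_rad harr) => //; try exact: Fm; first by case: (cP (Sq 0)).
  by rewrite kerd; case: (cP (Sq k.+1)).
move=> k; have [_ _ _ _ H] := cP (Sq k); apply: H.
elim: k => [|k IH] // i ik /=.
have [_ _ _ kr H] := cP (Sq k).
suff -> : U (Sq k) *m mE (F (Sq k)) i = 0 by rewrite mul0mx.
apply/sub_kermxP; rewrite eq_row_base; apply: submx_trans kr _.
apply/sumsmx_subP => a _; apply/sub_kermxP; rewrite -(mXE (Fm _)) -mulmxA (mEE (Fm _)).
case: (tgt a =P i) => [e|_]; last by rewrite mulmx0.
rewrite (mXE (Fm _)) -(mEX (Fm _)) (H k IH) ?mul0mx //.
by apply: leq_trans (harr a) _; rewrite e -ltnS.
Qed.

Lemma gldim_fin : gldim_finite Q K.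
Proof.
exists n => M /pres_ex[R [[HR _] sR]]; exists R; split=> // k nk.
have [Rm _] : is_module (rP R k) /\ projective (rP R k) by case: HR => H _ _ _ _; apply: H.
apply/eqP; rewrite -(mxrank1 K (mdim (rP R k))) -(mE_sum Rm) big1 ?mxrank0 // => i _.
by apply: sR; apply: ltn_trans nk.
Qed.

Lemma pdim_retract M (I : finType) (N : I -> amod) d :
  is_module M -> (forall j, is_module (N j)) -> retract_of M N ->
  (forall j, pdim_le (N j) d) -> pdim_le M d.
Proof.
move=> Mm Nm r H; have [R [mR _]] := pres_ex Mm; exists R; split; first by case: mR.
by apply: pdim_minimal r H.
Qed.

Lemma soc_IB S (y : 'rV[K]_(size (IB Q S))) i s a l :
  @in_soc Q K (pmod K (IB Q S) (@pstart Q) (@act_dual Q)) i y -> (s, a :: l) \in IB Q S ->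
  cf y (s, a :: l) = 0.
Proof.
case=> _ yX pB; have uB := IB_uniq Q S; have [sa tB] := IB_tail harr pB.
have := congr1 (fun w => @cf Q K (IB Q S) w (tgt a : nat, l)) (yX a); rewrite /= cf0 => <-.
symmetry; apply: (@cf_pmx Q K (IB Q S) (IB Q S) (fun p => act_dual p a)) => //=.
  by rewrite /act_dual /= eqxx.
move=> [s' [|b l']] //= pB'; rewrite /act_dual /=; case: eqP => // e [el]; subst b l'.
by have [<- _] := IB_tail harr pB'; rewrite sa.
Qed.

Lemma soc_injmod v i (y : 'rV[K]_(mdim (injmod K v))) : in_soc i y ->
  exists c, y = c *: dl K (IB Q (fun u => u == v)) (v : nat, [::]).
Proof.
move=> ys; have uB := IB_uniq Q (fun u => u == v).
exists (@cf Q K (IB Q (fun u => u == v)) y (v : nat, [::])).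
apply: (@cf_inj Q K (IB Q (fun u => u == v))) => // -[s [|a l]] pB.
  have := pB; rewrite mem_IB // => /andP[/eqP e _]; have e' : s = v := e; subst s.
  by rewrite cfZ cf_dl // eqxx pB mulr1.
by rewrite (soc_IB ys pB) cfZ cf_dl // xpair_eqE andbF mulr0.
Qed.

Lemma triv_IB (v : 'I_n) : (v : nat, [::]) \in IB Q (fun u => u == v).
Proof. by rewrite mem_IB // eqxx ltn_ord good_nil. Qed.

Lemma dl_triv_soc v : @in_soc Q K (injmod K v) v (dl K (IB Q (fun u => u == v)) (v : nat, [::])).
Proof.
have uB := IB_uniq Q (fun u => u == v); split.
  have -> := @dl_mE Q K (IB Q (fun u => u == v)) (@pstart Q) (@act_dual Q) uB _ v (triv_IB v).
  by rewrite /= eqxx.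
move=> a; have -> := @dl_mX Q K (IB Q (fun u => u == v)) (@pstart Q) (@act_dual Q) uB _ a (triv_IB v).
by [].
Qed.

Lemma soc_homI M v i (w : 'cV[K]_(mdim M)) (x : 'rV_(mdim M)) : in_soc i x ->
  x *m homI (fun u => u == v) (M := M) (fun _ => w) =
  (x *m w) 0 0 *: dl K (IB Q (fun u => u == v)) (v : nat, [::]).
Proof.
move=> xs; have uB := IB_uniq Q (fun u => u == v).
apply: (@cf_inj Q K (IB Q (fun u => u == v))) => // -[s l] pB.
rewrite /cf -mulmxA homI_col //= mulmxA (soc_path _ xs) -scalemxAl [in RHS]mxE -/(cf _ _) cf_dl //.
rewrite triv_IB andbT; case: l pB => [|a l] pB; last by rewrite mul0mx mxE xpair_eqE andbF mulr0.
move: pB; rewrite mem_IB // => /andP[/eqP e _]; have e' : s = v := e; subst s.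
by rewrite eqxx mulr1.
Qed.

Lemma soc_functional M i (x : 'rV[K]_(mdim M)) : is_module M -> in_soc i x -> x != 0 ->
  exists2 w : 'cV[K]_(mdim M), mE M i *m w = w & (x *m w) 0 0 = 1.
Proof.
move=> Mm [xE _] x0; have /row_freeP[w xw] : row_free x by rewrite /row_free rank_rV x0.
exists (mE M i *m w); first by rewrite mulmxA (mEid Mm).
by rewrite mulmxA xE xw mxE.
Qed.

(** Dual to [cover_aux]: while [f] kills a socle vector x at i, add I(i) through a functional with
    value 1 on x. The invariant that socle vectors of [J] come from the socle of [M] makes the final
    map essential. *)
Lemma envelope_aux M r J (f : 'M[K]_(mdim M, mdim J)) : is_module M ->
  (\rank (kermx f) <= r)%N -> is_module J -> Defs.injective J -> is_hom f ->
  (forall i (y : 'rV_(mdim J)), in_soc i y -> exists2 x, in_soc i x & x *m f = y) ->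
  exists c : {J : amod & 'M[K]_(mdim M, mdim J)}, let f := projT2 c in
    [/\ is_module (projT1 c), Defs.injective (projT1 c), is_hom f, row_free f & essential f].
Proof.
move=> Mm; elim: r J f => [|r IH] J f le Jm Ji fh inv.
all: case: (boolP (row_free f)) => [ff|nf]; first by
  (exists (existT _ J f); split=> //=; apply: (ess_of_soc harr) => // i y /inv[x _ <-]; apply: submxMl).
  by rewrite -kermx_eq0 -mxrank_eq0 -leqn0 le in nf.
have [i [x [x0 /sub_kermxP xf xs]]] : exists i (x : 'rV[K]_(mdim M)),
    [/\ x != 0, (x <= kermx f)%MS & in_soc i x].
  by apply: (soc_ex harr Mm (submod_ker fh)); rewrite kermx_eq0.
have [w wE xw] := soc_functional Mm xs x0.
pose h := homI (fun u => u == i) (M := M) (fun _ => w) : 'M[K]_(mdim M, mdim (injmod K i)).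
have hh : is_hom h.
  by apply: homI_hom => // v /eqP ->; rewrite mEn_ord.
have f'h : @is_hom _ _ M (dsum J (injmod K i)) (row_mx f h) by apply: hom_row.
have xh : x *m h = dl K (IB Q (fun u => u == i)) (i : nat, [::]) by rewrite (soc_homI _ _ xs) xw scale1r.
apply: (IH (dsum J (injmod K i)) (row_mx f h)) => //.
- rewrite -ltnS (leq_trans _ le) // rank_ltmx // ltmxE; apply/andP; split.
    by apply/sub_kermxP; have := mulmx_ker (row_mx f h); rewrite mul_mx_row -row_mx0 => /eq_row_mx[].
  apply/negP => /(submx_trans (_ : (x <= _)%MS)).
  have xk : (x <= kermx f)%MS by apply/sub_kermxP.
  move/(_ xk)/sub_kermxP; rewrite mul_mx_row -row_mx0 => /eq_row_mx[_]; rewrite xh.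
  move/(congr1 (fun z => @cf Q K (IB Q (fun u => u == i)) z (i : nat, [::]))).
  rewrite cf0 cf_dl ?triv_IB ?eqxx //; last exact: IB_uniq.
  by move/eqP; rewrite oner_eq0.
- exact: dsum_mod Jm (injmod_mod i).
- exact: dsum_inj Ji (@injmod_inj i).
move=> i' y [yE yX]; have yM A B : y *m block_mx A 0 0 B = row_mx (lsubmx y *m A) (rsubmx y *m B).
  by rewrite -{1}[y]hsubmxK mul_row_block !mulmx0 addr0 add0r.
have ys1 : in_soc i' (lsubmx y).
  split=> [|a]; first by move: yE; rewrite /= yM => /(congr1 lsubmx); rewrite row_mxKl.
  by move: (yX a); rewrite /= yM => /(congr1 lsubmx); rewrite row_mxKl => ->; apply/rowP => j; rewrite !mxE.
have ys2 : @in_soc _ _ (injmod K i) i' (rsubmx y).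
  split=> [|a]; first by move: yE; rewrite /= yM => /(congr1 rsubmx); rewrite row_mxKr.
  by move: (yX a); rewrite /= yM => /(congr1 rsubmx); rewrite row_mxKr => ->; apply/rowP => j; rewrite !mxE.
have [c ec] := soc_injmod ys2; have [x1 x1s x1f] := inv _ _ ys1.
(* [f] does not see [x], while the new component is 1 on it, so a multiple of [x] corrects the
   second coordinate alone. *)
exists (x1 + (c - (x1 *m w) 0 0) *: x).
  case: (i =P i') => [e|ne].
    subst i'; case: x1s => e1 e2; case: xs => e3 e4.
    by split=> [|a]; rewrite mulmxDl -scalemxAl ?e3 ?e4 ?scaler0 ?addr0 // e1.
  have -> : (x1 *m w) 0 0 = 0.
    case: x1s => e1 _; rewrite -wE -e1 mulmxA -(mulmxA x1) (mEE Mm) eq_sym (introF eqP ne).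
    by rewrite mulmx0 mul0mx mxE.
  have -> : c = 0.
    have [e _] := ys2; have [e' _] := dl_triv_soc i.
    move: e; rewrite ec -scalemxAl -e' -mulmxA (mEE (injmod_mod i)) (introF eqP ne) mulmx0 scaler0.
    move/esym/(congr1 (fun z => @cf Q K (IB Q (fun u => u == i)) z (i : nat, [::]))).
    by rewrite e' cfZ cf0 cf_dl ?triv_IB ?eqxx ?mulr1 //; apply: IB_uniq.
  by rewrite subrr scale0r addr0.
rewrite mulmxDl -scalemxAl !mul_mx_row xf x1f xh (soc_homI _ _ x1s) scale_row_mx add_row_mx scaler0 addr0.
by rewrite -scalerDl addrC subrK -ec hsubmxK.
Qed.

Lemma envelope_ex M : is_module M -> exists c : {J : amod & 'M[K]_(mdim M, mdim J)}, let f := projT2 c in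
    [/\ is_module (projT1 c), Defs.injective (projT1 c), is_hom f, row_free f & essential f].
Proof.
move=> Mm; apply: (@envelope_aux M (mdim M) zero_mod 0 Mm).
- exact: rank_leq_col.
- exact: zero_is_module.
- exact: zero_injective.
- exact: hom_zero.
by move=> i y _; exists 0; [split=> [|a]; rewrite mul0mx | rewrite [y]thinmx0 mul0mx].
Qed.

Lemma icores_ex M : is_module M -> exists C : icoresol M, minimal_icoresol C.
Proof.
move=> Mm; pose St := {M : amod | is_module M}.
pose cov (S : St) := constructive_indefinite_description _ (envelope_ex (svalP S)).
pose J S := projT1 (sval (cov S)); pose f S : 'M[K]_(mdim (sval S), mdim (J S)) := projT2 (sval (cov S)).
have cP S : [/\ is_module (J S), Defs.injective (J S), is_hom (f S), row_free (f S) &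
   essential (f S)] := svalP (cov S).
pose U S := quopr (f S).
have Uh S : @is_hom _ _ (J S) (quom (f S)) (U S).
  by apply: quopr_hom; apply: submod_im; case: (cP S).
have nm S : is_module (quom (f S)).
  by apply: (mod_epi (Uh S)); [exact: quopr_full | case: (cP S)].
pose nxt S : St := exist _ (quom (f S)) (nm S).
pose Sq k := iter k nxt (exist _ M Mm).
pose C := @ICoresol Q K M (fun k => J (Sq k)) (fun k => U (Sq k) *m f (Sq k.+1)) (f (Sq 0)).
have kerd k : (kermx (cd C k) :=: f (Sq k))%MS.
  have [_ _ _ ff _] := cP (Sq k.+1).
  apply/eqmxP/andP; split; last first.
    by apply/sub_kermxP; rewrite /= mulmxA; have /eqP -> : f (Sq k) *m U (Sq k) == 0; rewrite ?mul0mx // quopr_ker.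
  rewrite -quopr_ker; apply/eqP; apply: (row_free_inj ff); rewrite mul0mx -mulmxA.
  exact: mulmx_ker.
have imd k : (cd C k :=: f (Sq k.+1))%MS by apply: eqmxMfull; apply: quopr_full.
exists C; split=> //.
- by move=> k; case: (cP (Sq k)).
- split; first by case: (cP (Sq 0)).
  by move=> k; have [_ _ fh _ _] := cP (Sq k.+1); apply: hom_comp (Uh (Sq k)) fh.
- by case: (cP (Sq 0)).
- split; first by apply/eqmxP; apply: eqmx_sym; exact: (kerd 0%N).
  by move=> k; apply/eqmxP; apply: eqmx_trans (imd k) (eqmx_sym (kerd k.+1)).
- split; first by case: (cP (Sq 0)).
  move=> k p V Vs V0; have [_ _ _ _ H] := cP (Sq k.+1).
  by rewrite (cap_eqmx (imd k) (eqmx_refl V)); apply: H.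
Qed.

(** The map from the simple socle of I(v) to [x] extends to I(v), and a functional with value 1 on
    [x] gives a map back. The composite fixes the socle of I(v), hence is injective and
    invertible. *)
Lemma injmod_retract J v (x : 'rV[K]_(mdim J)) : is_module J -> Defs.injective J ->
  in_soc v x -> x != 0 -> retract_of (injmod K v) (fun _ : 'I_1 => J).
Proof.
move=> Jm Ji xs x0; have uB := IB_uniq Q (fun u => u == v).
set e := dl K (IB Q (fun u => u == v)) (v : nat, [::]).
have es : @in_soc _ _ (injmod K v) v e := dl_triv_soc v.
have eN i : v <> i -> e *m mE (injmod K v) i = 0.
  by case: es => e1 _ ne; rewrite -e1 -mulmxA (mEE (injmod_mod v)) (introF eqP ne) mulmx0.
have sub_e : is_submod (M := injmod K v) e.
  case: es => e1 e2; split=> i; last by rewrite e2 sub0mx.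
  case: (v =P i) => [<-|ne]; first by rewrite e1 submx_refl.
  by rewrite eN // sub0mx.
have ef : row_free e.
  rewrite /row_free rank_rV; case: (e =P 0) => // e0.
  have := congr1 (fun z => @cf Q K (IB Q (fun u => u == v)) z (v : nat, [::])) e0.
  by rewrite cf0 cf_dl // eqxx triv_IB => /eqP; rewrite oner_eq0.
have eh := subm_hom sub_e.
have xh : @is_hom _ _ (subm (M := injmod K v) e) J x.
  case: (es) (xs) => e1 e2 [x1 x2]; split=> [i|a]; last first.
    by rewrite -[mX _ a]/(e *m mX (injmod K v) a *m pinvmx e) e2 x2 !mul0mx.
  rewrite -[mE _ i]/(e *m mE (injmod K v) i *m pinvmx e).
  case: (v =P i) => [<-|ne]; first by rewrite e1 x1 mulmxVp // mul1mx.
  by rewrite eN // !mul0mx -x1 -mulmxA (mEE Jm) (introF eqP ne) mulmx0.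
have [f [fh fe]] := Ji _ _ _ _ (mod_mono eh ef (injmod_mod v)) (injmod_mod v) eh ef xh.
have [w wE xw] := soc_functional Jm xs x0.
pose h := homI (fun u => u == v) (M := J) (fun _ => w) : 'M[K]_(mdim J, mdim (injmod K v)).
have hh : is_hom h by apply: homI_hom => // u /eqP ->; rewrite mEn_ord.
apply: (@retract_unit _ _ _ _ _ (fun=> f) (fun=> h)) => //; rewrite big_ord1 -row_free_unit.
apply: (soc_inj harr (injmod_mod v) (hom_comp fh hh)) => i y /soc_injmod[c ->].
by rewrite -/e -scalemxAl mulmxA fe (soc_homI _ _ xs) xw scale1r.
Qed.

End Covers.

(** * Flatness of projective modules and consequences of the 2-Gorenstein property *)

Section Flat.
Variables (Q : monquiver) (K : fieldType).
Local Notation n := (qn Q).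
Local Notation m := (qm Q).
Local Notation src := (@qsrc Q).
Local Notation tgt := (@qtgt Q).
Local Notation amod := (amod Q K).
Local Notation qpath := (qpath Q).
Local Notation PBv v := (PB Q (fun u => u == nat_of_ord v)).
Local Notation IBv v := (IB Q (fun u => u == nat_of_ord v)).
Implicit Types (M X Y F J : amod) (k t : 'I_n) (y z : seq 'I_m) (p w : qpath).

Hypothesis harr : forall a, (src a < tgt a)%N.
Hypothesis hrel : forall r, r \in qrels Q -> (2 <= size r)%N.

(* Ex v y generates the left annihilator of the path y, Wd s z that of z. *)
Definition Ex (v : nat) y : seq qpath :=
  [seq p <- nzpaths Q | [&& pend p == v, ~~ nonzero_path (p.2 ++ y) & nonzero_path (behead p.2 ++ y)]].
Definition Wd (s : nat) z : seq qpath :=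
  [seq w <- nzpaths Q | (pend w == s) && ~~ nonzero_path (w.2 ++ z)].

Definition insum M (r : seq qpath) (x : 'rV[K]_(mdim M)) :=
  exists c : qpath -> 'rV[K]_(mdim M), x = \sum_(p <- r) c p *m pathmx M p.2.

Lemma insum0 M r : @insum M r 0.
Proof. by exists (fun=> 0); rewrite big1 // => p _; rewrite mul0mx. Qed.

Lemma insumD M r x x' : insum r x -> insum r x' -> @insum M r (x + x').
Proof.
move=> [c ->] [c' ->]; exists (fun p => c p + c' p); rewrite -big_split.
by apply: eq_bigr => p _; rewrite mulmxDl.
Qed.

Lemma insumZ M r a x : insum r x -> @insum M r (a *: x).
Proof.
move=> [c ->]; exists (fun p => a *: c p); rewrite scaler_sumr.
by apply: eq_bigr => p _; rewrite scalemxAl.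
Qed.

Lemma insum_sum M r (I : Type) (s : seq I) (P : pred I) (F : I -> 'rV[K]_(mdim M)) :
  (forall i, P i -> insum r (F i)) -> insum r (\sum_(i <- s | P i) F i).
Proof.
by move=> H; elim/big_rec: _ => [|i x Pi]; [exact: insum0 | apply: insumD (H i Pi)].
Qed.

Lemma insum1 M (r : seq qpath) p (x : 'rV[K]_(mdim M)) : uniq r -> p \in r -> insum r (x *m pathmx M p.2).
Proof.
move=> ur pr; exists (fun q => if q == p then x else 0).
rewrite (big_rem p) //= eqxx big1_seq ?addr0 // => q; rewrite mem_rem_uniq // inE.
by case/and3P=> _ /negbTE -> _; rewrite mul0mx.
Qed.

Lemma insum_hom M X (f : 'M[K]_(mdim M, mdim X)) r x : is_hom f -> insum r x -> insum r (x *m f).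
Proof.
move=> fh [c ->]; exists (fun p => c p *m f); rewrite mulmx_suml.
by apply: eq_bigr => p _; rewrite -!mulmxA (hom_path _ fh).
Qed.

Lemma hom_mEn M X (f : 'M[K]_(mdim M, mdim X)) v : is_hom f -> mEn M v *m f = f *m mEn X v.
Proof. by case=> fE _; rewrite /mEn; case: insub => [i|] /=; rewrite ?fE // mul0mx mulmx0. Qed.

(** Vanishing of Tor_1 with A/Ay: what [y] kills in [M] comes from the left annihilator of [y] in
    A. *)
Definition flat1 M := forall v y (x : 'rV[K]_(mdim M)), good v y -> x *m mEn M v = x ->
  x *m pathmx M y = 0 -> insum (Ex v y) x.

(** Flatness for a left ideal generated by paths: Az meets the sum of the other Az' in zero when
    suffixes are incomparable, so a relation can only come from the annihilator of [z]. *)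
Definition flat2 M := forall s z (zs : seq qpath) (x : 'rV[K]_(mdim M)), good s z ->
  (forall p, p \in zs -> ~~ suffix p.2 z && ~~ suffix z p.2) ->
  x *m mEn M s = x -> insum zs (x *m pathmx M z) -> insum (Wd s z) x.

(* Vanishing of Tor_2 against the cyclic left modules A / A y. *)
Definition tor2 M := forall v y p (x : 'rV[K]_(mdim M)), good v y -> p \in Ex v y ->
  x *m mEn M p.1 = x -> insum (rem p (Ex v y)) (x *m pathmx M p.2) -> insum (Wd p.1 p.2) x.

Section RetractClosed.
Variables (M : amod) (I : finType) (N : I -> amod).
Hypothesis rMN : retract_of M N.

Lemma flat1_retract : (forall j, flat1 (N j)) -> flat1 M.
Proof.
case: rMN => f [g [fh gh fg]] H v y x gy xv xy; rewrite -[x]mulmx1 -fg mulmx_sumr.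
apply: insum_sum => j _; rewrite mulmxA; apply: insum_hom (gh j) _; apply: H => //.
  by rewrite -mulmxA -(hom_mEn _ (fh j)) mulmxA xv.
by rewrite -mulmxA -(hom_path _ (fh j)) mulmxA xy mul0mx.
Qed.

Lemma flat2_retract : (forall j, flat2 (N j)) -> flat2 M.
Proof.
case: rMN => f [g [fh gh fg]] H s z zs x gz zsz xs xz; rewrite -[x]mulmx1 -fg mulmx_sumr.
apply: insum_sum => j _; rewrite mulmxA; apply: insum_hom (gh j) _; apply: (H j s z zs) => //.
  by rewrite -mulmxA -(hom_mEn _ (fh j)) mulmxA xs.
by rewrite -mulmxA -(hom_path _ (fh j)) mulmxA; apply: insum_hom (fh j) xz.
Qed.

Lemma tor2_retract : (forall j, tor2 (N j)) -> tor2 M.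
Proof.
case: rMN => f [g [fh gh fg]] H v y p x gy pE xs xz; rewrite -[x]mulmx1 -fg mulmx_sumr.
apply: insum_sum => j _; rewrite mulmxA; apply: insum_hom (gh j) _; apply: (H j v y) => //.
  by rewrite -mulmxA -(hom_mEn _ (fh j)) mulmxA xs.
by rewrite -mulmxA -(hom_path _ (fh j)) mulmxA; apply: insum_hom (fh j) xz.
Qed.
End RetractClosed.

Lemma dsum_retract M X : retract_of (dsum M X) (fun b : bool => if b then M else X).
Proof.
exists (fun b => match b return 'M[K]_(mdim (dsum M X), mdim (if b then M else X)) with
  | true => col_mx 1%:M 0 | false => col_mx 0 1%:M end).
exists (fun b => match b return 'M[K]_(mdim (if b then M else X), mdim (dsum M X)) with
  | true => row_mx 1%:M 0 | false => row_mx 0 1%:M end).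
split=> [[]|[]|].
- by apply: hom_col; [exact: hom_id | exact: hom_zero].
- by apply: hom_col; [exact: hom_zero | exact: hom_id].
- by apply: hom_row; [exact: hom_id | exact: hom_zero].
- by apply: hom_row; [exact: hom_zero | exact: hom_id].
rewrite big_bool /= !mul_col_row !mulmx0 !mul0mx !mulmx1 add_block_mx !addr0 !add0r.
by rewrite -scalar_mx_block.
Qed.

Lemma cat_catP (T : eqType) (l1 l2 l3 l4 : seq T) : l1 ++ l2 = l3 ++ l4 -> suffix l2 l4 || suffix l4 l2.
Proof.
elim: l1 l3 => [|a l1 IH] [|b l3] /= E.
- by rewrite E suffix_refl.
- by rewrite E -cat_cons suffix_suffix orbT.
- by rewrite -E -cat_cons suffix_suffix.
- by case: E => _ /IH.
Qed.

Lemma cat_injr (T : eqType) (l l1 l2 : seq T) : l1 ++ l = l2 ++ l -> l1 = l2.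
Proof.
move=> e; have /addIn es : (size l1 + size l = size l2 + size l)%N by rewrite -!size_cat e.
by move/eqP: e; rewrite eqseq_cat // => /andP[/eqP].
Qed.

Lemma cat_injl (T : eqType) (l l1 l2 : seq T) : l ++ l1 = l ++ l2 -> l1 = l2.
Proof. by move/eqP; rewrite eqseq_cat // eqxx => /eqP. Qed.

Section ProjFlat.
Variable k : 'I_n.
Let P := projmod K k.
Let B := PBv k.
Let cB : rclosed B := PB_closed harr _.
Let uB : uniq B. Proof. by case: cB. Qed.

Lemma cf_path_right (x : 'rV[K]_(mdim P)) s l y : (s, l) \in B -> good s (l ++ y) ->
  @cf Q K B (x *m pathmx P y) (s, l ++ y) = @cf Q K B x (s, l).
Proof.
move=> pB g; rewrite cf_mul_sum // cf_sum (big_rem (s, l)) //= big1_seq.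
  rewrite addr0 cfZ dl_path_right // g cf_dl // eqxx /=.
  by have -> : (s, l ++ y) \in B; [case: cB => _ _; apply | rewrite mulr1].
move=> [s' l'] /=; rewrite mem_rem_uniq // inE => /andP[ne pB'].
rewrite cfZ dl_path_right //; case: ifP => _; last by rewrite cf0 mulr0.
rewrite cf_dl //; case: eqP => [[es /cat_injr el]|_]; last by rewrite mulr0.
by rewrite es el eqxx in ne.
Qed.

Lemma cf_path_right0 (x : 'rV[K]_(mdim P)) s l y : (forall l', l' ++ y <> l) ->
  @cf Q K B (x *m pathmx P y) (s, l) = 0.
Proof.
move=> ny; rewrite cf_mul_sum // cf_sum big1_seq // => -[s' l'] /= pB.
rewrite cfZ dl_path_right //; case: ifP => _; last by rewrite cf0 mulr0.
by rewrite cf_dl //; case: eqP => [[_ /ny]|_] //; rewrite mulr0.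
Qed.

Lemma cf_mEn (x : 'rV[K]_(mdim P)) v p : p \in B -> x *m mEn P v = x ->
  @cf Q K B x p != 0 -> pend p = v.
Proof.
case: p => s l pB xv; apply: contraNeq => ne; rewrite -xv cf_mul_sum // cf_sum big1_seq // => -[s' l'] /= pB'.
have [sn _] := rB_good harr cB pB'.
rewrite cfZ dl_mEn //; last exact: ptgt_bound.
case: ifP => [/eqP e|_]; last by rewrite cf0 mulr0.
rewrite cf_dl //; case: eqP => [e'|_]; last by rewrite mulr0.
by case/eqP: ne; rewrite -e'.
Qed.

(** Every path l occurring in x satisfies ly = 0, and its shortest suffix with this property belongs
    to [Ex v y]. *)
Lemma proj_flat1 : flat1 P.
Proof.
move=> v y x gy xv xy; rewrite [x](@cf_expand Q K B x uB) big_seq.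
apply: insum_sum => -[s l] pB; have [->|c0] := eqVneq (@cf Q K B x (s, l)) 0.
  by rewrite scale0r; apply: insum0.
have [sn gl] := rB_good harr cB pB; have ev := cf_mEn pB xv c0.
have ng : ~~ nonzero_path (l ++ y).
  apply: contra c0 => nz; rewrite -(@cf_path_right x s l y) //; first by rewrite xy cf0.
  by rewrite good_cat // -[ptgt s l]/(pend (s, l)) ev.
apply: insumZ.
have [l1 [l2 [el nz2 nz3]]] : exists l1 l2, [/\ l = l1 ++ l2, ~~ nonzero_path (l2 ++ y) &
    nonzero_path (behead l2 ++ y)].
  elim: l ng {pB c0 gl ev} => [|a l IH] ng; first by case/andP: gy => _ nz; rewrite nz in ng.
  case: (boolP (nonzero_path (l ++ y))) => [nz|/IH[l1 [l2 [-> h1 h2]]]].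
    by exists [::], (a :: l).
  by exists (a :: l1), l2.
subst l; have g1 := goodl gl; have g2 := goodr gl.
have pB1 : (s, l1) \in B by move: pB; rewrite !mem_PB // g1 => /and3P[-> -> _].
have := dl_path_right K harr cB l2 pB1; rewrite gl => <-.
apply: (@insum1 P (Ex v y) (ptgt s l1, l2)).
  by apply: filter_uniq; apply: nzpaths_uniq.
rewrite mem_filter mem_nz //= nz2 nz3 ptgt_bound // g2 /pend /= !andbT -ptgt_cat.
exact/eqP.
Qed.

(** For a path l occurring in x, the coefficient at lz cannot come from [zs], whose members are
    suffix-incomparable with z; hence lz = 0. *)
Lemma proj_flat2 : flat2 P.
Proof.
move=> s z zs x gz zsz xs [c xz]; rewrite [x](@cf_expand Q K B x uB) big_seq.
apply: insum_sum => -[s' l] pB; have [->|c0] := eqVneq (@cf Q K B x (s', l)) 0.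
  by rewrite scale0r; apply: insum0.
have [sn gl] := rB_good harr cB pB; have ev := cf_mEn pB xs c0.
have ng : ~~ nonzero_path (l ++ z).
  apply: contra c0 => nz; rewrite -(@cf_path_right x s' l z) //; last first.
    by rewrite good_cat // -[ptgt s' l]/(pend (s', l)) ev.
  rewrite xz cf_sum big1_seq // => p /= pz; apply: cf_path_right0 => l' /cat_catP.
  by case/andP: (zsz p pz) => /negbTE -> /negbTE ->.
apply: insumZ.
have pB0 : (s', [::]) \in B by move: pB; rewrite !mem_PB // good_nil // => /and3P[-> -> _].
have := dl_path_right K harr cB l pB0; rewrite /= gl => <-.
apply: (@insum1 P (Wd s z) (s', l)).
  by apply: filter_uniq; apply: nzpaths_uniq.
by rewrite mem_filter mem_nz //= ng sn gl ev eqxx.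
Qed.

End ProjFlat.

Lemma free_flat F : free_mod F -> flat1 F /\ flat2 F.
Proof.
elim=> [|F' v _ [f1 f2]].
  by split=> [v y x|s z zs x] *; rewrite [x]thinmx0; apply: insum0.
split.
  by apply: (flat1_retract (dsum_retract F' (projmod K v))) => -[] //; apply: proj_flat1.
by apply: (flat2_retract (dsum_retract F' (projmod K v))) => -[] //; apply: proj_flat2.
Qed.

Lemma proj_flat M : is_module M -> projective M -> flat1 M /\ flat2 M.
Proof.
move=> Mm Mp; have [[F f] [/= Ff fh ff _ _]] := cover_ex harr hrel Mm.
have [h [hh hf]] := Mp _ _ _ _ (free_is_module harr Ff) Mm fh ff (hom_id M).
have r : retract_of M (fun _ : 'I_1 => F) by apply: (retract1 hh fh).
have [f1 f2] := free_flat Ff.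
by split; [apply: (flat1_retract r) | apply: (flat2_retract r)].
Qed.

Lemma Ex_nz v y p : good v y -> p \in Ex v y ->
  [/\ p.2 != [::], (p.1 < n)%N, good p.1 p.2, pend p = v & ~~ nonzero_path (p.2 ++ y)].
Proof.
rewrite mem_filter mem_nz // => /andP[_ gy] /andP[/and3P[/eqP e nz _] /andP[sn g]].
by split=> //; apply: contra nz => /eqP ->.
Qed.

Lemma pathE_start M l (s : nat) : is_module M -> composable s l -> l != [::] ->
  mEn M s *m pathmx M l = pathmx M l.
Proof.
move=> Mm; case: l => // a l /= /andP[/eqP <- _] _.
by rewrite mEn_ord pathmx_cons mulmxA (mEX Mm).
Qed.

Lemma Ex_end M v y p : is_module M -> good v y -> p \in Ex v y -> pathmx M p.2 *m mEn M v = pathmx M p.2.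
Proof.
move=> Mm gy /(Ex_nz gy)[+ _ _ <- _]; case: p => s l /=; case/lastP: l => // l a _.
by rewrite /pend /= ptgt_rcons mEn_ord pathmx_rcons -mulmxA (mXE Mm).
Qed.

Lemma Ex_incomp v y p q : good v y -> p \in Ex v y -> q \in rem p (Ex v y) ->
  ~~ suffix q.2 p.2 && ~~ suffix p.2 q.2.
Proof.
move=> gy; have uE : uniq (Ex v y) by apply: filter_uniq; apply: nzpaths_uniq.
have key p' q' : p' \in Ex v y -> q' \in Ex v y -> q' != p' -> ~~ suffix q'.2 p'.2.
  move=> pE qE; apply: contra; have [p0 pn gp ep _] := Ex_nz gy pE; have [q0 qn gq eq nq] := Ex_nz gy qE.
  move: pE; rewrite mem_filter => /andP[/and3P[_ _ nz] _].
  case: p' q' nz p0 pn gp ep q0 qn gq eq nq {qE} => s l [s' l'] /= nz p0 pn gp ep q0 qn gq eq nq /suffixP[[|a w] e].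
    rewrite /= in e; subst l; rewrite xpair_eqE eqxx andbT.
    by case: l' p0 gp gq {nz ep eq nq q0} => //= a l' _ /andP[/andP[/eqP <- _] _] /andP[/andP[/eqP <- _] _].
  by case/negP: nq; move: nz; rewrite e /= -catA => /nz_catr.
rewrite mem_rem_uniq // inE => pE /andP[ne qE].
by rewrite !key // eq_sym.
Qed.

Lemma pdim0_proj M : is_module M -> pdim_le M 0 -> projective M.
Proof.
move=> Mm [R [HR R0]]; case: (HR) => Rp [eh _] ef /andP[_ ek] _.
have e0 : kermx (reps R) = 0.
  apply/eqP; rewrite -submx0; apply: submx_trans ek _.
  by move: (rd R 0); rewrite (R0 1%N) // => d; rewrite [d]flatmx0 sub0mx.
have er : row_free (reps R) by rewrite -kermx_eq0 e0.
have ih : @is_hom _ _ M (rP R 0) (pinvmx (reps R)).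
  rewrite -[pinvmx _]mul1mx; apply: hom_factor => //; first exact: hom_id.
  by rewrite sub1mx.
have r : retract_of M (fun _ : 'I_1 => rP R 0) by apply: (retract1 ih eh); rewrite mulVpmx.
by apply: (retract_proj r) => _; case: (Rp 0%N).
Qed.

(** A dimension shift along a resolution of length one. Lifted to the degree 0 term, the relation
    fails by an element [u] of the degree 1 term that [y] kills; [flat1] expands it in exits, and
    after correcting the lift of x, [flat2] applies in degree 0. *)
Lemma pdim1_tor2 M : is_module M -> pdim_le M 1 -> tor2 M.
Proof.
move=> Mm [R [HR R0]] v y p x gy pE xs [c xz].
case: (HR) => Rp [eh dh] ef /eqmxP ed /(_ 0%N)/andP[_ ek].
have [Fm Fp] := Rp 0%N; have [Nm Np] := Rp 1%N; have [N1 _] := proj_flat Nm Np; have [_ F2] := proj_flat Fm Fp.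
set d := rd R 0 in ed; set e := reps R in ed eh ef.
have df : row_free d.
  rewrite -kermx_eq0 -submx0; apply: submx_trans ek _.
  by move: (rd R 1); rewrite (R0 2%N) // => d'; rewrite [d']flatmx0 sub0mx.
have [r re] : exists r, r *m e = 1%:M by exists (pinvmx e); rewrite mulVpmx.
have uE : uniq (Ex v y) by apply: filter_uniq; apply: nzpaths_uniq.
have [p0 pn gp ep _] := Ex_nz gy pE.
pose xF := x *m r *m mEn (rP R 0) p.1.
have xFe : xF *m e = x by rewrite /xF -mulmxA (hom_mEn _ eh) mulmxA -(mulmxA x) re mulmx1.
pose u := xF *m pathmx _ p.2 - \sum_(q <- rem p (Ex v y)) c q *m r *m pathmx (rP R 0) q.2.
have ue : u *m e = 0.
  rewrite mulmxBl -mulmxA (hom_path _ eh) mulmxA xFe xz mulmx_suml; apply/eqP; rewrite subr_eq0; apply/eqP.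
  by apply: eq_bigr => q _; rewrite -!mulmxA (hom_path _ eh) (mulmxA r) re mul1mx.
have uv : u *m mEn _ v = u.
  rewrite mulmxBl -mulmxA (Ex_end Fm gy pE) mulmx_suml; congr (_ - _).
  by apply: eq_big_seq => q /mem_rem qE; rewrite -[LHS]mulmxA (Ex_end Fm gy qE).
have uy : u *m pathmx _ y = 0.
  rewrite mulmxBl -mulmxA -pathmx_cat (pathmx_bad Fm); last by case: (Ex_nz gy pE).
  rewrite mulmx0 sub0r mulmx_suml big1_seq ?oppr0 // => q /= /mem_rem qE.
  by rewrite -[LHS]mulmxA -pathmx_cat (pathmx_bad Fm) ?mulmx0 //; case: (Ex_nz gy qE).
have /submxP[w0 w0d] : (u <= d)%MS by rewrite ed; apply/sub_kermxP.
pose w := w0 *m mEn (rP R 1) v.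
have wd : w *m d = u by rewrite /w -mulmxA (hom_mEn _ (dh 0%N)) mulmxA -w0d uv.
have wv : w *m mEn _ v = w.
  by rewrite /w -mulmxA /mEn; case: insub => [i|] /=; rewrite ?(mEid Nm) // mulmx0.
have wy : w *m pathmx _ y = 0.
  by apply: (row_free_inj df); rewrite mul0mx -mulmxA (hom_path _ (dh 0%N)) mulmxA wd uy.
have [c' wE] := N1 _ _ _ gy wv wy.
(* Moving the p-part of the error into the lift of [x] leaves only the other exits on the right-hand
   side. *)
pose x' := xF - c' p *m d *m mEn (rP R 0) p.1.
have x's : x' *m mEn _ p.1 = x'.
  by rewrite /x' /xF mulmxBl -!mulmxA (mEn_lt _ pn) (mEid Fm).
have x'e : x' *m e = x.
  rewrite mulmxBl xFe -!mulmxA (hom_mEn _ eh) (mulmxA d) (_ : d *m e = 0) ?mul0mx ?mulmx0 ?subr0 //.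
  by apply/sub_kermxP; rewrite ed.
have /andP[cp _] := gp.
have x'z : insum (rem p (Ex v y)) (x' *m pathmx _ p.2).
  exists (fun q => c q *m r + c' q *m d).
  have E1 : xF *m pathmx (rP R 0) p.2 = u + \sum_(q <- rem p (Ex v y)) c q *m r *m pathmx (rP R 0) q.2.
    by rewrite /u subrK.
  rewrite mulmxBl E1 -(mulmxA _ (mEn _ _)) (pathE_start Fm cp p0) -wd wE (big_rem p) //= mulmxDl mulmx_suml.
  have -> : c' p *m pathmx _ p.2 *m d = c' p *m d *m pathmx (rP R 0) p.2.
    by rewrite -mulmxA (hom_path _ (dh 0%N)) mulmxA.
  rewrite addrAC [X in X + _]addrAC subrr add0r -big_split /=.
  apply: eq_bigr => q _; rewrite mulmxDl addrC -!mulmxA; congr (_ + _).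
  by rewrite (hom_path _ (dh 0%N)).
rewrite -x'e; apply: insum_hom eh _; apply: (F2 _ _ _ _ gp _ x's x'z) => q.
exact: Ex_incomp.
Qed.

End Flat.

(** * Paths and arrows under the 2-Gorenstein condition *)

Section Gorenstein.
Variables (Q : monquiver) (K : fieldType).
Local Notation n := (qn Q).
Local Notation m := (qm Q).
Local Notation src := (@qsrc Q).
Local Notation tgt := (@qtgt Q).
Local Notation amod := (amod Q K).
Local Notation qpath := (qpath Q).
Local Notation PBv v := (PB Q (fun i => i == nat_of_ord v)).
Local Notation IBv v := (IB Q (fun i => i == nat_of_ord v)).
Implicit Types (M X Y F J : amod) (k t : 'I_n) (y z u l : seq 'I_m) (p w : qpath) (s : nat).

Hypothesis harr : forall a, (src a < tgt a)%N.
Hypothesis hrel : forall r, r \in qrels Q -> (2 <= size r)%N.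

Lemma pmx_hom B B' vert vert' act act' (th : qpath -> option qpath) : uniq B -> uniq B' ->
  (forall p q, p \in B -> th p = Some q -> q \in B' /\ vert' q = vert p) ->
  (forall p q a, p \in B -> act p a = Some q -> q \in B) ->
  (forall p a, p \in B -> obind (act'^~ a) (th p) = obind th (act p a)) ->
  @is_hom Q K (pmod K B vert act) (pmod K B' vert' act') (pmx K B B' th).
Proof.
move=> uB uB' H1 H2 H3; split=> [i|a]; apply: dl_eq => // p pB; rewrite !mulmxA dl_pmx //.
  rewrite dl_mE //; case e: (th p) => [q|] /=; last by rewrite mul0mx; case: ifP => _; rewrite ?mul0mx // dl_pmx // e.
  have [qB vq] := H1 p q pB e; rewrite dl_mE // vq; case: ifP => _; last by rewrite mul0mx.
  by rewrite dl_pmx // e.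
rewrite dl_mX //; have := H3 p a pB; case e: (act p a) => [p'|] /= E.
  rewrite dl_pmx ?(H2 p p' a) // -E; case e': (th p) => [q|] /=; last by rewrite mul0mx.
  by have [qB _] := H1 p q pB e'; rewrite dl_mX.
rewrite mul0mx; case e': (th p) E => [q|] /= E; last by rewrite mul0mx.
by have [qB _] := H1 p q pB e'; rewrite dl_mX // E.
Qed.

Lemma cf_dual0 t (x : 'rV[K]_(mdim (injmod K t))) l s z : ~~ nonzero_path (l ++ z) ->
  @cf Q K (IBv t) (x *m pathmx (injmod K t) l) (s, z) = 0.
Proof.
move=> nz; have uB := IB_uniq Q (fun i => i == nat_of_ord t).
rewrite cf_mul_sum // cf_sum big1_seq // => -[s' l'] pB0; have pB : (s', l') \in IBv t := pB0.
rewrite cfZ; have -> := dl_path_dual K harr l pB; case: ifP => [/prefixP[z' e]|_]; last by rewrite cf0 mulr0.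
rewrite cf_dl // e drop_size_cat //; case: eqP => [[_ ez]|_]; last by rewrite mulr0.
by move: pB; rewrite mem_IB // e ez => /and3P[_ _ /andP[_ nz']]; rewrite nz' in nz.
Qed.

(** For dual basis elements q^* p = u^* only if q = pu, so u^* is reached only through a p with pu
    nonzero. *)
Lemma insum_dual t s u r : (s, u) \in IBv t -> @insum Q K (injmod K t) r (dl K (IBv t) (s, u)) ->
  exists2 p, p \in r & nonzero_path (p.2 ++ u).
Proof.
move=> uI [c e]; apply/hasP; apply: contraT => /hasPn H.
have := congr1 (fun x => @cf Q K (IBv t) x (s, u)) e.
rewrite /= cf_sum big1_seq => [|p /= /H]; last exact: cf_dual0.
by rewrite cf_dl ?IB_uniq // eqxx uI => /eqP; rewrite oner_eq0.
Qed.

Definition lmax (s : nat) u := forall b, tgt b = s :> nat -> ~~ nonzero_path (b :: u).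

Lemma dl_mEn_IB t s l : (s, l) \in IBv t ->
  dl K (IBv t) (s, l) *m mEn (injmod K t) s = dl K (IBv t) (s, l).
Proof.
move=> pB; have -> := @dl_mEn Q K (IBv t) (@pstart Q) (@act_dual Q) (IB_uniq _ _) _ s pB; rewrite ?eqxx //.
by move: pB; rewrite mem_IB // => /and3P[].
Qed.

(** Otherwise y kills u^*, and flatness produces a nontrivial p ending at s with pu nonzero, against
    left maximality. *)
Lemma lmax_chain t s u y : flat1 (injmod K t) -> (s, u) \in IBv t -> lmax s u -> good s y -> prefix y u.
Proof.
move=> f1 uI lm gy; apply: contraT => npr.
have xy : dl K (IBv t) (s, u) *m pathmx (injmod K t) y = 0.
  by have -> := dl_path_dual K harr y uI; rewrite (negbTE npr).
have [p pE nz] := insum_dual uI (f1 _ _ _ gy (dl_mEn_IB uI) xy).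
have [p0 _ _ ep _] := Ex_nz harr gy pE; case: p p0 ep nz {pE} => s' l /=; case/lastP: l => // l b _.
rewrite /pend /= ptgt_rcons cat_rcons => /lm nb /nz_catr.
by rewrite (negbTE nb).
Qed.

Lemma dl_full_path t s u : (s, u) \in IBv t ->
  dl K (IBv t) (s, u) *m pathmx (injmod K t) u = dl K (IBv t) (t : nat, [::]).
Proof.
move=> uI; have -> := dl_path_dual K harr u uI; rewrite prefix_refl drop_size.
by move: uI; rewrite mem_IB // => /andP[/eqP -> _].
Qed.

(** Both dual elements reach the socle, u^* u = u'^* u'. If neither path is a suffix of the other,
    [flat2] yields a w for which wu is both zero and nonzero. *)
Lemma lmax_uniq t s u s' u' : flat2 (injmod K t) -> (s, u) \in IBv t -> lmax s u ->
  (s', u') \in IBv t -> lmax s' u' -> (s, u) = (s', u').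
Proof.
have aux s1 u1 s2 u2 : (s1, u1) \in IBv t -> lmax s1 u1 -> (s2, u2) \in IBv t -> suffix u1 u2 -> (s1, u1) = (s2, u2).
  move=> uI lm uI' /suffixP[w e]; case/lastP: w e => [|w b] e.
    rewrite /= in e; subst u2; congr pair; move: uI uI'; rewrite !mem_IB //.
    case: u1 {lm} => [|a u1]; first by move=> /andP[/eqP e1 _] /andP[/eqP e2 _]; apply: etrans e1 (esym e2).
    by move=> /and3P[_ _ /andP[/andP[/eqP <- _] _]] /and3P[_ _ /andP[/andP[/eqP <- _] _]].
  have nb : tgt b = s1 :> nat.
    move: uI uI'; rewrite !mem_IB // e cat_rcons => /and3P[/eqP t1 s1n g1] /and3P[/eqP t2 _ g2].
    case: u1 {lm e} t1 t2 g1 g2 => [|a u1].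
      by rewrite -[ptgt s1 [::]]/s1 => -> + _ _; rewrite ptgt_cat ptgt_cons.
    by move=> _ _ /andP[/andP[/eqP <- _] _] /goodr/andP[/and3P[_ /eqP -> _] _].
  move: uI'; rewrite mem_IB // e cat_rcons => /and3P[_ _ /andP[_ /nz_catr]].
  by rewrite (negbTE (lm b nb)).
move=> f2 uI lm uI' lm'; case: (boolP (suffix u u')) => [/aux|n1]; first by apply.
case: (boolP (suffix u' u)) => [H|n2]; first by apply/esym/aux.
have g : good s u by move: uI; rewrite mem_IB // => /and3P[].
have H : @insum Q K (injmod K t) [:: (s', u')] (dl K (IBv t) (s, u) *m pathmx (injmod K t) u).
  exists (fun=> dl K (IBv t) (s', u')); rewrite big_seq1 /=.
  by rewrite dl_full_path // dl_full_path.
have [p] : exists2 p, p \in Wd s u & nonzero_path (p.2 ++ u).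
  apply: (insum_dual uI); apply: (f2 _ _ [:: (s', u')]) => //; last exact: dl_mEn_IB.
  by move=> p; rewrite inE => /eqP -> /=; rewrite n2 n1.
by rewrite mem_filter => /andP[/andP[_ /negbTE ->]].
Qed.

(** Distinct exits satisfy p^* p = q^* q, and [tor2] then asks for a w with wp both zero and
    nonzero. *)
Lemma tor2_exit k y p q : tor2 (injmod K k) -> good k y -> p \in Ex k y -> q \in Ex k y -> p = q.
Proof.
move=> t2 gy pE qE; apply/eqP; apply: contraT => ne.
have inI p' : p' \in Ex k y -> (p'.1, p'.2) \in IBv k.
  by move=> /(Ex_nz harr gy)[_ h1 h2 h3 _]; rewrite mem_IB // h1 h2 -h3 !andbT.
have uE : uniq (Ex k y) by apply: filter_uniq; apply: nzpaths_uniq.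
have [w] : exists2 w, w \in Wd p.1 p.2 & nonzero_path (w.2 ++ p.2).
  apply: (insum_dual (inI _ pE)); apply: (t2 _ _ _ _ gy pE) => //; first exact: dl_mEn_IB (inI _ pE).
  rewrite (dl_full_path (inI _ pE)) -(dl_full_path (inI _ qE)).
  by apply: insum1; [exact: rem_uniq | rewrite mem_rem_uniq // inE eq_sym ne].
by rewrite mem_filter => /andP[/andP[_ /negbTE ->]].
Qed.

(** Here z^* z is the socle element of I(k), which a kills; applying [tor2] to the exit za provides
    w. *)
Lemma tor2_arrow k y a s z : tor2 (injmod K k) -> src a = k -> good (tgt a) y ->
  (s, rcons z a) \in Ex (tgt a) y ->
  exists w, [/\ w \in nzpaths Q, pend w = s, nonzero_path (w.2 ++ z) & ~~ nonzero_path (w.2 ++ rcons z a)].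
Proof.
move=> t2 ak gy zE; have [_ /= sn gz _ _] := Ex_nz harr gy zE.
have zI : (s, z) \in IBv k.
  rewrite mem_IB // sn; move: gz; rewrite -cats1 => gz; rewrite (goodl gz) !andbT.
  by case/andP: (goodr gz) => /andP[/eqP <- _] _; rewrite ak.
have [w] : exists2 w, w \in Wd s (rcons z a) & nonzero_path (w.2 ++ z).
  apply: (insum_dual zI); apply: (t2 _ _ _ _ gy zE) => /=; first exact: dl_mEn_IB.
  rewrite pathmx_rcons mulmxA dl_full_path //.
  have [_ ->] := dl_triv_soc K harr hrel k; exact: insum0.
by rewrite mem_filter => /andP[/andP[/eqP pw nw] wn] nz; exists w.
Qed.

Hypothesis gor : two_gorenstein Q K.

Lemma reg_mod : is_module (regmod Q K).
Proof. exact: (rmod_mod K harr (nz_closed harr)). Qed.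

(** The path is a socle vector of A and hence of I^0, so I(t) is a summand of the projective module
    I^0. *)
Lemma gor_rmax_proj s l t : (s, l) \in nzpaths Q -> ptgt s l = t ->
  (forall a, src a = t -> ~~ nonzero_path (rcons l a)) -> projective (injmod K t).
Proof.
move=> lQ lt rm; have [C mC] := icores_ex harr hrel reg_mod.
have HC := min_icoresol mC; have [Cm [eh _] ef _] := HC; have [Jm Ji] := Cm 0%N.
have Jp := pdim0_proj Jm (proj1 (gor mC)).
have uB := nzpaths_uniq Q.
pose x := dl K (nzpaths Q) (s, l) : 'rV_(mdim (regmod Q K)).
have xs : in_soc t x.
  split.
    have -> := @dl_mE Q K (nzpaths Q) (@pend Q) (@act_right Q) uB _ t lQ.
    by rewrite /pend /= lt eqxx.
  move=> a; have -> := @dl_mX Q K (nzpaths Q) (@pend Q) (@act_right Q) uB _ a lQ.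
  rewrite /act_right /=; case: ifP => // /andP[/eqP e nz].
  have ea : src a = t by apply: val_inj; rewrite /= -e lt.
  by rewrite (negbTE (rm a ea)) in nz.
have es : in_soc t (x *m ceta C).
  case: eh xs => e1 e2 [x1 x2]; split=> [|a]; rewrite -mulmxA -?e1 -?e2 mulmxA ?x1 ?x2 ?mul0mx //.
have x0 : x *m ceta C != 0.
  apply/eqP => e0; have : x = 0 by apply: (row_free_inj ef); rewrite e0 mul0mx.
  move/(congr1 (fun v => @cf Q K (nzpaths Q) v (s, l))); rewrite cf0 cf_dl // eqxx lQ => /eqP.
  by rewrite oner_eq0.
by apply: (retract_proj (injmod_retract harr hrel Jm Ji es x0)) => _.
Qed.

Lemma gor_rmax s l t : (s, l) \in nzpaths Q -> ptgt s l = t ->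
  (forall a, src a = t -> ~~ nonzero_path (rcons l a)) ->
  flat1 (injmod K t) /\ flat2 (injmod K t).
Proof.
by move=> lQ lt rm; apply: (proj_flat harr hrel (injmod_mod K harr t)); apply: gor_rmax_proj lQ lt rm.
Qed.

Definition radB k : seq qpath := [seq p <- nzpaths Q | (pstart p == k) && (p.2 != [::])].

Lemma radB_closed k : rclosed (radB k).
Proof.
split; first by apply: filter_uniq; apply: nzpaths_uniq.
  by move=> p; rewrite mem_filter => /andP[].
move=> s l l'; rewrite !mem_filter !mem_nz //= => /andP[/andP[-> l0] /andP[-> _]] ->.
by case: l l0.
Qed.

Lemma act_right_some s l a q : good s l -> @act_right Q (s, l) a = Some q ->
  [/\ q = (s, rcons l a), ptgt s l = src a & good s (rcons l a)].
Proof.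
rewrite /act_right /= => /andP[cl _]; case: ifP => // /andP[/eqP e nz] [<-].
by split=> //; rewrite /good composable_rcons cl e eqxx nz.
Qed.

(* A homomorphism from the radical of P(k) to A that does not extend to P(k) gives a nonzero *)
(* class in Ext^1 of the simple module at k with A, so I(k) occurs in the second term I^1.   *)
Lemma gor_ext k (th : qpath -> option qpath) :
  @is_hom Q K (pmod K (radB k) (@pend Q) (@act_right Q)) (regmod Q K) (pmx K (radB k) (nzpaths Q) th) ->
  (forall x : 'rV[K]_(mdim (regmod Q K)),
     ~ (forall a, src a = k -> x *m mX (regmod Q K) a = dlo K (nzpaths Q) (th (k : nat, [:: a])))) ->
  tor2 (injmod K k).
Proof.
move=> hth next; have [C mC] := icores_ex harr hrel reg_mod.
have HC := min_icoresol mC; have [Cm [eh dh] ef [/eqmxP ek _]] := HC; have [Jm Ji] := Cm 0%N; have [J1m J1i] := Cm 1%N.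
have cR := radB_closed k; have [uR _ _] := cR; have cP := PB_closed harr (fun i => i == nat_of_ord k); have [uP _ _] := cP.
pose Rm := pmod K (radB k) (@pend Q) (@act_right Q).
pose inc := pmx K (radB k) (PBv k) Some : 'M[K]_(mdim Rm, mdim (projmod K k)).
have RP p : p \in radB k -> p \in PBv k by rewrite !mem_filter => /andP[/andP[-> _] ->].
have inch : is_hom inc.
  apply: pmx_hom => // [p q /RP pB [<-] //|[s l] q a pB ea|p a _]; last by rewrite /=; case: (act_right p a).
  have [_ g] := rB_good harr cR pB; have [-> _ g'] := act_right_some g ea.
  by rewrite -cats1; case: cR => _ _; apply=> //; rewrite cats1.
have incf : row_free inc.
  by apply: pmx_free => // [q /RP qB|q q' r _ _ [->] [->]] //; exists q.
have [h [hh hi]] := Ji _ _ _ _ (rmod_mod K harr cR) (projmod_mod K harr k) inch incf (hom_comp hth eh).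
(* The image of e_k under the extension to P(k). Its image in I^1 is a socle vector, nonzero because
   y does not come from A. *)
pose y := dl K (PBv k) (k : nat, [::]) *m h.
have kP : (k : nat, [::]) \in PBv k by rewrite mem_PB // eqxx ltn_ord good_nil.
have yk : y *m mE _ k = y.
  rewrite /y -mulmxA; case: (hh) => <- _; rewrite mulmxA.
  have -> := @dl_mE Q K (PBv k) (@pend Q) (@act_right Q) uP _ k kP.
  by rewrite /pend /ptgt /= eqxx.
have ya a : src a = k -> y *m mX _ a = dlo K (nzpaths Q) (th (k : nat, [:: a])) *m ceta C.
  move=> ak; have ga : good k [:: a] by rewrite -ak good_arrow.
  have aR : (k : nat, [:: a]) \in radB k by rewrite mem_filter mem_nz //= eqxx ltn_ord.
  rewrite /y -mulmxA; case: (hh) => _ <-; rewrite mulmxA.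
  have := dl_path_right K harr cP [:: a] kP; rewrite /= ga pathmx_cons mulmx1 => ->.
  have -> : dl K (PBv k) (k : nat, [:: a]) = dl K (radB k) (k : nat, [:: a]) *m inc by rewrite dl_pmx.
  by rewrite -mulmxA hi mulmxA dl_pmx.
have zs : in_soc k (y *m cd C 0).
  split; first by rewrite -mulmxA; case: (dh 0%N) => <- _; rewrite mulmxA yk.
  move=> a; rewrite -mulmxA; case: (dh 0%N) => _ <-; rewrite mulmxA.
  case: (src a =P k) => [ak|/eqP ne]; last by rewrite (mEX_src Jm yk ne) mul0mx.
  rewrite ya // -mulmxA (_ : ceta C *m cd C 0 = 0) ?mulmx0 //.
  by apply/sub_kermxP; rewrite ek.
have z0 : y *m cd C 0 != 0.
  apply/eqP => /sub_kermxP; rewrite -ek => /submxP[x ex]; apply: (next x) => a ak.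
  by apply: (row_free_inj ef); rewrite -ya // ex -!mulmxA; case: eh => _ ->.
have r := injmod_retract harr hrel J1m J1i zs z0.
by apply: (tor2_retract r) => _; apply: pdim1_tor2 => //; case: (gor mC).
Qed.

Lemma cf_reg_mX (x : 'rV[K]_(mdim (regmod Q K))) a s l : (s, rcons l a) \in nzpaths Q ->
  @cf Q K (nzpaths Q) (x *m mX (regmod Q K) a) (s, rcons l a) = @cf Q K (nzpaths Q) x (s, l).
Proof.
move=> aN; have uB := nzpaths_uniq Q; have := aN; rewrite mem_nz // => /= /andP[sn g].
apply: (@cf_pmx Q K (nzpaths Q) (nzpaths Q) (fun p => act_right p a)) => //.
- by rewrite mem_nz //= sn; move: g; rewrite -cats1 => /goodl.
- move: g; rewrite /good composable_rcons /act_right /= => /andP[/andP[_ /eqP ->] ->].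
  by rewrite eqxx.
move=> [s' l'] pB; have := pB; rewrite mem_nz // => /andP[_ g'] /(act_right_some g')[[-> e] _ _].
by case: (rcons_inj e) => ->.
Qed.

(** The projection of rad P(k) to the paths beginning with d1 does not extend: x d1 = d1 needs
    coefficient 1 of x at e_k, and x d2 = 0 needs coefficient 0. *)
Lemma gor_out2 k d1 d2 : src d1 = k -> src d2 = k -> d1 != d2 -> tor2 (injmod K k).
Proof.
move=> e1 e2 ne.
pose th (p : qpath) := if p.2 is b :: _ then if b == d1 then Some p else None else None.
have uB := nzpaths_uniq Q; have cR := radB_closed k; have [uR sR _] := cR.
apply: (@gor_ext k th).
  apply: pmx_hom => // [p q /sR pB|[s l] q a pB ea|[s [|b l]] a pB].
  - by rewrite /th; case: (p.2) => // b l; case: eqP => // _ [<-].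
  - have [_ g] := rB_good harr cR pB; have [-> _ g'] := act_right_some g ea.
    by rewrite -cats1; case: cR => _ _; apply=> //; rewrite cats1.
  - by move: pB; rewrite mem_filter andbF.
  rewrite /th /=; case: eqP => eb; rewrite /act_right /=; case: ifP => //= _.
    by rewrite (introT eqP eb).
  by rewrite (introF eqP eb).
have nzd a : src a = k -> (k : nat, rcons [::] a) \in nzpaths Q.
  by move=> ak; rewrite mem_nz //= ltn_ord -ak good_arrow.
move=> x H; have := H d2 e2; rewrite /th /= eq_sym (negbTE ne).
move/(congr1 (fun v => @cf Q K (nzpaths Q) v (k : nat, rcons [::] d2))); rewrite cf0 cf_reg_mX ?nzd // => x0.
have := H d1 e1; rewrite /th /= eqxx.
move/(congr1 (fun v => @cf Q K (nzpaths Q) v (k : nat, rcons [::] d1))); rewrite cf_reg_mX ?nzd // x0.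
by rewrite cf_dl // eqxx (nzd d1) // => /esym/eqP; rewrite oner_eq0.
Qed.

(** Cancelling a leading a is a homomorphism from rad P(k) to A under this hypothesis. It does not
    extend, since no product xa contains a trivial path. *)
Lemma gor_arrow a k : src a = k -> (forall y, good (tgt a) y -> nonzero_path (a :: y)) ->
  tor2 (injmod K k).
Proof.
move=> ak Ha; pose th (p : qpath) : option qpath :=
  if p.2 is b :: y then if b == a then Some (tgt a : nat, y) else None else None.
have uB := nzpaths_uniq Q; have cR := radB_closed k; have [uR sR _] := cR.
apply: (@gor_ext k th).
  apply: pmx_hom => // [[s l] q pB|[s l] q b pB ea|[s [|b l]] c pB].
  - have [_ g] := rB_good harr cR pB; case: l g {pB} => //= b l g; rewrite /th /=; case: eqP => // eb [<-]; subst b.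
    rewrite mem_nz //= ltn_ord; split=> //.
    exact: (@goodr _ s [:: a] l).
  - have [_ g] := rB_good harr cR pB; have [-> _ g'] := act_right_some g ea.
    by rewrite -cats1; case: cR => _ _; apply=> //; rewrite cats1.
  - by move: pB; rewrite mem_filter andbF.
  have [_ g] := rB_good harr cR pB.
  rewrite /th /=; case: eqP => eb /=; last by rewrite /act_right /=; case: ifP => //= _; rewrite (introF eqP eb).
  subst b; rewrite /act_right /= ptgt_cons; case: eqP => //= e.
  have -> : nonzero_path (rcons l c) = nonzero_path (a :: rcons l c).
    apply/idP/idP => [nz|]; last exact: (@nz_catr _ [:: a]).
    by apply: Ha; rewrite /good composable_rcons nz e eqxx !andbT; case/andP: g => /andP[].
  by case: ifP => //= _; rewrite eqxx.
move=> x H; have := H a ak; rewrite /th /= eqxx /=.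
move/(congr1 (fun v => @cf Q K (nzpaths Q) v (tgt a : nat, [::]))); rewrite cf_dl // eqxx mem_triv //.
rewrite cf_mul_sum // cf_sum big1_seq; first by move/esym/eqP; rewrite oner_eq0.
move=> [s l] pB; rewrite cfZ.
have -> := @dl_mX Q K (nzpaths Q) (@pend Q) (@act_right Q) uB _ a pB.
move: pB; rewrite /= mem_nz // => /andP[_ g].
case e: (act_right (s, l) a) => [q|] /=; last by rewrite cf0 mulr0.
have [-> _ _] := act_right_some g e.
by rewrite cf_dl // xpair_eqE; case: l {g e} => [|b l]; rewrite !andbF mulr0.
Qed.

End Gorenstein.

(** * Local structure of a 2-Gorenstein monomial quiver *)

Lemma subn_ltS p q r N : (p < q)%N -> (q < r)%N -> (r - p < N.+1)%N -> (r - q < N)%N.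
Proof. lia. Qed.

Lemma addn_neq p q : p = (q.+1 + p)%N -> False.
Proof. lia. Qed.

Lemma size_pair p q r t : (0 < p)%N -> (0 < q)%N -> r.+1 = (p + t)%N -> t.+1 = (q + r)%N -> p = 1%N.
Proof. lia. Qed.

Section Structure.
Variable Q : monquiver.
Local Notation n := (qn Q).
Local Notation m := (qm Q).
Local Notation src := (@qsrc Q).
Local Notation tgt := (@qtgt Q).
Implicit Types (k t i : 'I_n) (x y z u w f l : seq 'I_m) (s : nat) (a b c d : 'I_m).

(* At a crossing two threads c1 d1 and c2 d2 meet; no relation passes through a crossing *)
(* along a thread, and changing threads gives zero.                                       *)
Definition cross_spec k := exists c1 c2 d1 d2,
  [/\ [/\ c1 != c2, d1 != d2, tgt c1 = k & tgt c2 = k],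
      [/\ src d1 = k, src d2 = k, ~~ nonzero_path [:: c1; d2] & ~~ nonzero_path [:: c2; d1]],
      forall b, tgt b = k -> b = c1 \/ b = c2,
      forall b, src b = k -> b = d1 \/ b = d2 &
      (forall s f y, good s (rcons f c1) -> good k (d1 :: y) -> nonzero_path (rcons f c1 ++ d1 :: y)) /\
      (forall s f y, good s (rcons f c2) -> good k (d2 :: y) -> nonzero_path (rcons f c2 ++ d2 :: y))].

Definition threaded := forall k,
  ((forall a b, src a = k -> src b = k -> a = b) /\ (forall a b, tgt a = k -> tgt b = k -> a = b)) \/
  cross_spec k.

Hypothesis harr : forall a, (src a < tgt a)%N.
Hypothesis hrel : forall r, r \in qrels Q -> (2 <= size r)%N.

Definition rmaxv (t : nat) := exists s l, [/\ (s < n)%N, good s l, ptgt s l = t &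
  forall a, src a = t :> nat -> ~~ nonzero_path (rcons l a)].

(** The four hypotheses are the path form of the 2-Gorenstein condition, from [lmax_chain],
    [lmax_uniq], [tor2_exit] and [tor2_arrow]; [gorenstein_threaded] discharges them. *)
Hypothesis hA : forall (t : nat) s u y, rmaxv t -> (s < n)%N -> good s u -> ptgt s u = t -> lmax s u ->
  good s y -> prefix y u.
Hypothesis hB : forall (t : nat) s u s' u', rmaxv t -> (s < n)%N -> good s u -> ptgt s u = t -> lmax s u ->
  (s' < n)%N -> good s' u' -> ptgt s' u' = t -> lmax s' u' -> u = u'.
Hypothesis hT1 : forall k d1 d2 y p q, src d1 = k -> src d2 = k -> d1 != d2 -> good k y ->
  p \in Ex k y -> q \in Ex k y -> p = q.
Hypothesis hT2 : forall a y s z, (forall y, good (tgt a) y -> nonzero_path (a :: y)) ->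
  good (tgt a) y -> (s, rcons z a) \in Ex (tgt a) y ->
  exists w : qpath Q, [/\ w \in nzpaths Q, pend w = s, nonzero_path (w.2 ++ z) & ~~ nonzero_path (w.2 ++ rcons z a)].

Lemma mem_Ex s z v y : ((s, z) \in Ex v y) =
  [&& ptgt s z == v, ~~ nonzero_path (z ++ y), nonzero_path (behead z ++ y), (s < n)%N & good s z].
Proof. by rewrite mem_filter mem_nz // /pend /= -!andbA. Qed.

Lemma lext_ex s u : (s < n)%N -> good s u -> exists s' w,
  [/\ (s' < n)%N, good s' (w ++ u), ptgt s' w = s & lmax s' (w ++ u)].
Proof.
have [N] := ubnP s; elim: N s u => // N IH s u sN sn gu.
case: (boolP [exists b, (tgt b == s :> nat) && nonzero_path (b :: u)]) => [/existsP[b /andP[/eqP bs nz]]|].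
  have gb : good (src b) (b :: u) by rewrite /good /= eqxx bs nz andbT; case/andP: gu.
  have [|s' [w [s'n g e lm]]] := IH (src b) (b :: u) _ (ltn_ord _) gb.
    by apply: (leq_trans (harr b)); rewrite bs -ltnS.
  exists s', (rcons w b); rewrite cat_rcons; split=> //.
  by rewrite ptgt_rcons.
rewrite negb_exists => /forallP H; exists s, [::]; split=> // b bs.
by have := H b; rewrite bs eqxx.
Qed.

Lemma rext_ex s l : (s < n)%N -> good s l -> exists w, good s (l ++ w) /\
  forall a, src a = ptgt s (l ++ w) :> nat -> ~~ nonzero_path (rcons (l ++ w) a).
Proof.
move=> sn; have [N] := ubnP (n - ptgt s l); elim: N l => // N IH l lN gl.
case: (boolP [exists a, (src a == ptgt s l :> nat) && nonzero_path (rcons l a)]) => [/existsP[a /andP[as_ nz]]|].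
  have ga : good s (rcons l a) by rewrite /good composable_rcons as_ nz !andbT; case/andP: gl.
  have [|//|w [gw H]] := IH (rcons l a).
    rewrite ptgt_rcons; apply: subn_ltS lN; last exact: ltn_ord.
    by rewrite -(eqP as_).
  by exists (a :: w); rewrite -cat_rcons.
rewrite negb_exists => /forallP H; exists [::]; rewrite cats0; split=> // a as_.
by have := H a; rewrite as_ eqxx.
Qed.

Lemma lmax_chain_ex s u : (s < n)%N -> good s u -> lmax s u -> exists U, forall y, good s y -> prefix y U.
Proof.
move=> sn gu lm; have [w [gw rm]] := rext_ex sn gu; exists (u ++ w) => y.
apply: (hA (t := ptgt s (u ++ w))) => //; first by exists s, (u ++ w).
by move=> b /lm; apply: contra; rewrite -cat_cons => /nz_catl.
Qed.

(** Prolonging u on the right to a maximal path makes all paths from s prefixes of one path, so they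
    cannot branch. *)
Lemma lmax_arrow s u f d1 d2 x1 x2 : (s < n)%N -> good s u -> lmax s u ->
  good s (f ++ d1 :: x1) -> good s (f ++ d2 :: x2) -> d1 = d2.
Proof.
move=> sn gu lm g1 g2; have [U HU] := lmax_chain_ex sn gu lm.
have key d x : good s (f ++ d :: x) -> d = nth d1 U (size f).
  by move=> /HU/prefixP[U' ->]; rewrite -catA nth_cat ltnn subnn.
by rewrite (key _ _ g1) (key _ _ g2).
Qed.

Lemma exit_ex s z k y : (s < n)%N -> good s z -> ptgt s z = k -> good k y -> ~~ nonzero_path (z ++ y) ->
  exists s' z', (s', z') \in Ex k y /\ suffix z' z.
Proof.
move=> + + + gy; elim: z s => [|a z IH] s sn gz zt nz; first by case/andP: gy => _; rewrite (negbTE nz).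
case: (boolP (nonzero_path (z ++ y))) => [nz'|nz'].
  by exists s, (a :: z); rewrite mem_Ex zt eqxx nz nz' sn gz suffix_refl.
have [||s' [z' [zE /suffixP[w e]]]] := IH (tgt a) (ltn_ord _) _ _ nz'.
- exact: (@goodr _ s [:: a] z).
- by [].
by exists s', z'; split=> //; apply/suffixP; exists (a :: w); rewrite e.
Qed.

Lemma rmaxv_suffix t s z s' z' : rmaxv t -> (s < n)%N -> good s z -> ptgt s z = t ->
  (s' < n)%N -> good s' z' -> ptgt s' z' = t -> suffix z z' || suffix z' z.
Proof.
move=> rt sn gz zt s'n gz' z't.
have [s1 [w1 [s1n g1 e1 l1]]] := lext_ex sn gz; have [s2 [w2 [s2n g2 e2 l2]]] := lext_ex s'n gz'.
by apply: (@cat_catP _ w1 _ w2); apply: (hB rt s1n g1 _ l1 s2n g2 _ l2); rewrite ptgt_cat ?e1 ?e2.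
Qed.

Lemma suffix_eq (T : eqType) (l1 l2 : seq T) : suffix l1 l2 -> size l1 = size l2 -> l1 = l2.
Proof.
move=> /suffixP[w el] e; move: e; rewrite el size_cat => /eqP; rewrite -{1}[size l1]add0n eqn_add2r eq_sym.
by move/nilP => ->.
Qed.

Section Out2.
Variables (k : 'I_n).

(** Prolong zd on the left until it is maximal. Paths from its start do not branch, so the prolonged
    z kills d', and an exit of d' is a suffix of it. *)
Lemma other_exit d d' s z : src d = k -> src d' = k -> d != d' -> (s < n)%N -> good s z -> ptgt s z = k ->
  nonzero_path (rcons z d) -> exists s' z', [/\ (s', z') \in Ex k [:: d'], nonzero_path (rcons z' d) &
   suffix z' z \/ exists2 w, w != [::] & z' = w ++ z].
Proof.
move=> dk d'k ne sn gz zk nz.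
have gd : good s (rcons z d) by rewrite /good composable_rcons dk zk eqxx nz !andbT; case/andP: gz.
have [s1 [w [s1n g1 e1 l1]]] := lext_ex sn gd.
have gz1 : good s1 (w ++ z) by move: g1; rewrite -cats1 catA => /goodl.
have zk1 : ptgt s1 (w ++ z) = k by rewrite ptgt_cat e1.
have bad : ~~ nonzero_path ((w ++ z) ++ [:: d']).
  apply/negP => nz'; case/negP: ne; apply/eqP; apply: (@lmax_arrow s1 _ (w ++ z) d d' [::] [::] s1n g1 l1).
    by rewrite -catA cats1.
  by rewrite good_cat // zk1 -d'k good_arrow.
have gd' : good k [:: d'] by rewrite -d'k good_arrow.
have [s' [z' [zE sz]]] := exit_ex s1n gz1 zk1 gd' bad.
exists s', z'; split=> //.
  case/suffixP: sz => w' e; move: g1; rewrite -rcons_cat e => /andP[_].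
  by rewrite rcons_cat => /nz_catr.
case/suffixP: sz => w' /esym/cat_catP/orP[|] /suffixP[w2 e]; first by left; apply/suffixP; exists w2.
case: w2 e => [|b w2] e; first by left; rewrite e suffix_refl.
by right; exists (b :: w2).
Qed.

(** Each exit properly prolongs on the left the other one deprived of its first arrow; comparing
    lengths, the two agree after the first arrow. *)
Lemma exit_pair d1 d2 : src d1 = k -> src d2 = k -> d1 != d2 -> exists s1 s2 c1 c2 x,
  [/\ (s1, c1 :: x) \in Ex k [:: d1], (s2, c2 :: x) \in Ex k [:: d2],
      nonzero_path (rcons (c1 :: x) d2) & nonzero_path (rcons (c2 :: x) d1)].
Proof.
have half d d' z s s' z' : src d = k -> src d' = k -> d != d' -> (s, z) \in Ex k [:: d] ->
    nonzero_path (rcons z d') -> (s', z') \in Ex k [:: d'] ->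
    exists2 w, w != [::] & z' = w ++ behead z.
  move=> dk d'k ne zE nz z'E; have gd' : good k [:: d'] by rewrite -d'k good_arrow.
  have gd : good k [:: d] by rewrite -dk good_arrow.
  move: (zE); rewrite mem_Ex => /and5P[/eqP zk nb nz1 sn gz].
  have z0 : z != [::] by have [] := Ex_nz harr gd zE.
  case: z z0 zE zk nb nz1 gz nz => // c x _ zE zk nb nz1 gz nz; rewrite /= in nz1 *.
  have gx : good (tgt c) x by apply: (@goodr _ s [:: c] x).
  have [s2 [z2 [z2E nz2 sz]]] := other_exit dk d'k ne (ltn_ord _) gx zk (ltac:(by rewrite -cats1)).
  have e := hT1 dk d'k ne gd' z2E z'E; case: e => _ <-.
  case: sz => // /suffixP[w ex]; move: z2E; rewrite mem_Ex => /and5P[_ /negP[]].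
  by move: nz; rewrite ex -cats1 -cat_cons -catA => /nz_catr.
move=> dk1 dk2 ne; have ne' : d2 != d1 by rewrite eq_sym.
have g0 : @good Q k [::] := good_nil hrel k.
have [s2 [z2 [z2E nz2 _]]] := other_exit dk1 dk2 ne (ltn_ord k) g0 erefl (nz_short hrel (l := [:: d1]) isT).
have [s1 [z1 [z1E nz1 _]]] := other_exit dk2 dk1 ne' (ltn_ord k) g0 erefl (nz_short hrel (l := [:: d2]) isT).
have [w1 w10 e1] := half _ _ _ _ _ _ dk1 dk2 ne z1E nz1 z2E.
have [w2 w20 e2] := half _ _ _ _ _ _ dk2 dk1 ne' z2E nz2 z1E.
have gd1 : good k [:: d1] by rewrite -dk1 good_arrow.
have gd2 : good k [:: d2] by rewrite -dk2 good_arrow.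
have [z10 _ _ _ _] := Ex_nz harr gd1 z1E; have [z20 _ _ _ _] := Ex_nz harr gd2 z2E.
case: z1 z1E nz1 e1 e2 z10 => // c1 x1 z1E nz1 /= e1 e2 _.
case: z2 z2E nz2 e1 e2 z20 => // c2 x2 z2E nz2 /= e1 e2 _.
have ex : x1 = x2.
  have h1 := congr1 size e1; have h2 := congr1 size e2; rewrite /= !size_cat in h1 h2.
  have pos w : w != [::] -> (0 < @size 'I_m w)%N by case: w.
  have w0 : @size 'I_m w1 = 1%N by exact: (size_pair (pos _ w10) (pos _ w20) h1 h2).
  by case: w1 w0 e1 {w10 h1} => [|b1 []] //= _ [_ ->].
by subst x2; exists s1, s2, c1, c2, x1.
Qed.

End Out2.

Lemma cross_link k a b e : cross_spec k -> tgt e = k -> src a = k -> src b = k ->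
  nonzero_path [:: e; a] -> nonzero_path [:: e; b] -> a = b.
Proof.
move=> [c1 [c2 [d1 [d2 [_ [_ _ n12 n21] hin hout _]]]]] ek ak bk na nb.
case: (hin e ek) => ee; subst e; case: (hout a ak) => ea; case: (hout b bk) => eb; subst a b => //.
- by rewrite (negbTE n12) in nb.
- by rewrite (negbTE n12) in na.
- by rewrite (negbTE n21) in na.
- by rewrite (negbTE n21) in nb.
Qed.

Lemma good_bound s l : good s l -> l != [::] -> (s < n)%N.
Proof. by case: l => // a l /andP[/andP[/eqP <- _] _] _; apply: ltn_ord. Qed.

Lemma not_rmaxv_ex k s l : ~ rmaxv k -> (s < n)%N -> good s l -> ptgt s l = k ->
  exists2 a, src a = k & nonzero_path (rcons l a).
Proof.
move=> nr sn gl lk.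
case: (boolP [exists a, (src a == k) && nonzero_path (rcons l a)]) => [/existsP[a /andP[/eqP ak nz]]|].
  by exists a.
rewrite negb_exists => /forallP H; case: nr; exists s, l; split=> // a ak.
by have := H a; rewrite (val_inj ak) eqxx.
Qed.

Lemma last_suffix (T : eqType) (b c : T) (x w : seq T) : c :: x = w ++ [:: b] -> b = last c x.
Proof. by move/(congr1 (last b)); rewrite /= last_cat. Qed.

(** Induction on the label of k. The exits c1 x and c2 x leave room for just two arrows out of k,
    and arrows into k must be last arrows of the exits. A trivial x gives a crossing. If x ends in
    a, [hT2] yields a second arrow at the source of a continuing the same path as a, which is
    impossible at the crossing given by induction. *)
Lemma crossP k d1 d2 : src d1 = k -> src d2 = k -> d1 != d2 -> cross_spec k.
Proof.
have [N] := ubnP k; elim: N k d1 d2 => // N IH k d1 d2 kN dk1 dk2 ne.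
have ne' : d2 != d1 by rewrite eq_sym.
have [s1 [s2 [c1 [c2 [x [E1 E2 nz1 nz2]]]]]] := exit_pair dk1 dk2 ne.
have gd d : src d = k -> good k [:: d] by move=> <-; apply: good_arrow.
move: (E1) (E2); rewrite !mem_Ex => /and5P[/eqP zk1 nb1 _ s1n gz1] /and5P[/eqP zk2 nb2 _ s2n gz2].
have c12 : c1 != c2 by apply: contra nb2 => /eqP <-; rewrite cats1.
have nr : ~ rmaxv k.
  move=> rk; have := rmaxv_suffix rk s1n gz1 zk1 s2n gz2 zk2.
  by case/orP=> /suffix_eq/(_ erefl)[e]; rewrite e eqxx in c12.
have out d : src d = k -> d = d1 \/ d = d2.
  move=> dk; case: (eqVneq d d1) => [|n1]; [by left | case: (eqVneq d d2) => [|n2]; [by right | exfalso]].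
  have n1' : d1 != d by rewrite eq_sym.
  have n2' : d2 != d by rewrite eq_sym.
  have [s1' [s3 [c1' [c3 [x' [E1' E3 nz1' _]]]]]] := exit_pair dk1 dk n1'.
  case: (hT1 dk1 dk2 ne (gd _ dk1) E1' E1) => _ ec ex; subst c1' x'.
  have [s3' [z' [E3' _ H]]] := other_exit dk2 dk n2' s1n gz1 zk1 nz1.
  case: (hT1 dk1 dk2 ne (gd _ dk) E3' E3) => _ ez; subst z'.
  case: H => [/suffix_eq/(_ erefl)[e]|[w w0 /(congr1 size)]]; last first.
    by case: w w0 => // b w _; rewrite size_cat /= => /addn_neq.
  move: E3; rewrite mem_Ex e => /and5P[_]; rewrite cats1 => /negP[]; exact: nz1'.
have inc b : tgt b = k -> b = last c2 x \/ b = last c1 x.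
  move=> bk; have gb := good_arrow hrel b.
  have bk' : ptgt (src b) [:: b] = k by rewrite -bk.
  have last_of d d' c s : src d = k -> src d' = k -> d != d' -> nonzero_path [:: b; d] ->
      (s, c :: x) \in Ex k [:: d'] -> b = last c x.
    move=> dk dk' nd nz E; have [s' [z' [E' _ H]]] := other_exit dk dk' nd (ltn_ord _) gb bk' nz.
    case: (hT1 dk1 dk2 ne (gd _ dk') E' E) => _ ez; subst z'.
    case: H => [/suffixP[[|b' w] e]|[w _ /last_suffix]] //; first exact: (@last_suffix _ _ _ _ [::]).
    by case: w e.
  have [a ak nz] := not_rmaxv_ex nr (ltn_ord _) gb bk'.
  case: (out a ak) => ea; subst a; [left | right].
    exact: last_of dk1 dk2 ne nz E2.
  exact: last_of dk2 dk1 ne' nz E1.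
case/lastP: x E1 E2 nz1 nz2 zk1 nb1 gz1 zk2 nb2 gz2 inc => [|x a] E1 E2 nz1 nz2 zk1 nb1 gz1 zk2 nb2 gz2 inc.
  have ck1 : tgt c1 = k by apply: val_inj.
  have ck2 : tgt c2 = k by apply: val_inj.
  have glue c c' d s' : c != c' -> src d = k -> (s', [:: c']) \in Ex k [:: d] ->
      forall s f y, good s (rcons f c) -> good k (d :: y) -> tgt c = k -> nonzero_path (rcons f c ++ d :: y).
    move=> cc dk E s f y gf gy ck; apply: contraT => nz.
    have fk : ptgt s (rcons f c) = k by rewrite ptgt_rcons ck.
    have sn : (s < n)%N by apply: good_bound gf _; case: (f).
    have [s3 [z [zE sz]]] := exit_ex sn gf fk gy nz.
    have E' : (s', [:: c']) \in Ex k (d :: y).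
      move: E; rewrite !mem_Ex => /and5P[-> nb _ -> ->]; case/andP: gy => _ -> /=; rewrite !andbT.
      by apply: contra nb => nz'; apply: (@nz_catl _ _ y).
    case: (hT1 dk1 dk2 ne gy zE E') => _ ez; subst z; case/suffixP: sz => w; rewrite -cats1.
    by move/(congr1 (last c)); rewrite !last_cat /= => e; rewrite e eqxx in cc.
  exists c2, c1, d1, d2; split.
  - by split=> //; rewrite eq_sym.
  - by split.
  - by move=> b /inc.
  - exact: out.
  split=> s f y gf gy.
    by rewrite eq_sym in c12; exact: (glue c2 c1 d1 s1 c12 dk1 E1 s f y gf gy ck2).
  exact: (glue c1 c2 d2 s2 c12 dk2 E2 s f y gf gy ck1).
exfalso.
have inca b : tgt b = k -> b = a by move/inc; rewrite !last_rcons => -[].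
have ak : tgt a = k.
  by apply: val_inj; rewrite /= -zk1 -rcons_cons ptgt_rcons.
(* If ay = 0 then y is left maximal, a being the only arrow into k, so paths from k could not branch
   into d1 and d2. *)
have proja y : good (tgt a) y -> nonzero_path (a :: y).
  rewrite ak => gy; apply: contraT => nz; case/negP: ne; apply/eqP.
  apply: (@lmax_arrow k y [::] d1 d2 [::] [::] (ltn_ord k) gy) => //; try exact: gd.
  by move=> b bk; rewrite (inca b) //; apply: val_inj.
have E2' : (s2, rcons (c2 :: x) a) \in Ex (tgt a) [:: d2] by rewrite ak.
have gda : good (tgt a) [:: d2] by rewrite ak gd.
have [[sw w] [wN wp nzw bw]] := hT2 proja gda E2'.
move: wN; rewrite mem_nz //= => /andP[swn gw]; rewrite /pend /= in wp bw nzw.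
have gx c s : good s (c :: rcons x a) -> good s (c :: x) /\ ptgt s (c :: x) = src a.
  rewrite -rcons_cons => g; split; first by move: g; rewrite -cats1 => /goodl.
  by move: g => /andP[]; rewrite composable_rcons => /andP[_ /eqP ->].
have [gx1 ex1] := gx _ _ gz1; have [gx2 ex2] := gx _ _ gz2.
have gZ : good sw (w ++ c2 :: x) by rewrite good_cat // wp.
have eZ : ptgt sw (w ++ c2 :: x) = src a by rewrite ptgt_cat wp.
have nri : ~ rmaxv (src a).
  move=> ri; have := rmaxv_suffix ri s1n gx1 ex1 s2n gx2 ex2.
  by case/orP=> /suffix_eq/(_ erefl)[e]; rewrite e eqxx in c12.
have [b bi nzb] := not_rmaxv_ex nri swn gZ eZ.
have ab : a != b by apply: contra bw => /eqP ->; rewrite -rcons_cons -rcons_cat.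
have cs : cross_spec (src a).
  by apply: (IH (src a) a b) => //; apply: (leq_trans (harr a)); rewrite ak -ltnS.
have E : c2 :: x = rcons (belast c2 x) (last c2 x) by rewrite lastI.
case/negP: ab; apply/eqP; apply: (cross_link cs _ erefl bi (e := last c2 x)).
- by apply: val_inj; rewrite /= -ex2 E ptgt_rcons.
- by case/andP: gz2 => _; rewrite -rcons_cons E -!cats1 -catA => /nz_catr.
- by move: nzb; rewrite E -!cats1 -!catA => /nz_catr/nz_catr.
Qed.

Lemma gor_threaded : threaded.
Proof.
move=> k; case: (boolP [exists a, exists b, [&& src a == k, src b == k & a != b]]).
  by case/existsP=> a /existsP[b /and3P[/eqP ak /eqP bk ne]]; right; apply: crossP ak bk ne.
rewrite negb_exists => /forallP H.
have Hout a b : src a = k -> src b = k -> a = b.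
  move=> ak bk; have := H a; rewrite negb_exists => /forallP/(_ b).
  by rewrite ak bk !eqxx /= negbK => /eqP.
left; split=> // b1 b2 bk1 bk2; apply/eqP; apply: contraT => ne.
(* Two arrows into k would have common prolongations x without end: b1 x and b2 x are
   suffix-incomparable, so x does not end where a right-maximal path ends, and both continue by the
   same arrow. Labels are bounded. *)
suff: forall N x, (n - ptgt k x < N)%N -> good k x -> nonzero_path (b1 :: x) -> nonzero_path (b2 :: x) -> False.
  by move/(_ _ [::] (ltnSn _) (good_nil hrel k)); case; apply: nz_short.
elim=> // N IH x xN gx nz1 nz2.
have tn := ptgt_bound x (ltn_ord k); pose t := Ordinal tn.
have [g1 e1] : good (src b1) (b1 :: x) /\ ptgt (src b1) (b1 :: x) = t.
  by rewrite /good /= eqxx nz1 andbT ptgt_cons bk1; split=> //; case/andP: gx.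
have [g2 e2] : good (src b2) (b2 :: x) /\ ptgt (src b2) (b2 :: x) = t.
  by rewrite /good /= eqxx nz2 andbT ptgt_cons bk2; split=> //; case/andP: gx.
have nr : ~ rmaxv t.
  move=> rt; have := rmaxv_suffix rt (ltn_ord _) g1 e1 (ltn_ord _) g2 e2.
  by case/orP=> /suffix_eq/(_ erefl)[e]; rewrite e eqxx in ne.
have [d1 dk1 n1] := not_rmaxv_ex nr (ltn_ord _) g1 e1; have [d2 dk2 n2] := not_rmaxv_ex nr (ltn_ord _) g2 e2.
have [e|nd] := eqVneq d1 d2.
  subst d2; apply: (IH (rcons x d1)) => //.
    rewrite ptgt_rcons; apply: subn_ltS xN; last exact: ltn_ord.
    by have := harr d1; rewrite dk1.
  have ds : (src d1 : nat) == ptgt k x by rewrite dk1.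
  rewrite /good composable_rcons ds (@nz_catr _ [:: b1] (rcons x d1)) //.
  by case/andP: gx => ->.
case/negP: nd; apply/eqP; case/lastP: x {IH xN} gx nz1 nz2 tn t g1 e1 g2 e2 nr dk1 n1 dk2 n2 => [|x e] gx nz1 nz2 tn t g1 e1 g2 e2 nr dk1 n1 dk2 n2.
  by apply: Hout; apply: val_inj; rewrite /= ?dk1 ?dk2 -e1 ptgt_cons bk1.
have [->//|nd] := eqVneq d1 d2.
apply: (cross_link (crossP dk1 dk2 nd) _ dk1 dk2 (e := e)).
- by apply: val_inj; rewrite /= -e1 -rcons_cons ptgt_rcons.
- by move: n1; rewrite -rcons_cons -!cats1 -catA => /nz_catr.
- by move: n2; rewrite -rcons_cons -!cats1 -catA => /nz_catr.
Qed.

End Structure.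

Lemma gorenstein_threaded (Q : monquiver) (K : fieldType) :
  (forall a, (@qsrc Q a < @qtgt Q a)%N) -> (forall r, r \in qrels Q -> (2 <= size r)%N) ->
  two_gorenstein Q K -> threaded Q.
Proof.
move=> harr hrel gor.
have fl t : rmaxv Q t -> forall h : (t < qn Q)%N, flat1 (injmod K (Ordinal h)) /\ flat2 (injmod K (Ordinal h)).
  move=> [s [l [sn gl lt rm]]] h; apply: (gor_rmax harr hrel gor (s := s) (l := l)) => //.
    by rewrite mem_nz //= sn.
  by move=> a at_; apply: rm; rewrite at_.
apply: gor_threaded => //.
- move=> t s u y rt sn gu ut lm gy; have tn : (t < qn Q)%N by rewrite -ut; apply: ptgt_bound.
  have [f1 _] := fl t rt tn; apply: (lmax_chain harr f1 _ lm gy).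
  by rewrite mem_IB //= ut eqxx sn.
- move=> t s u s' u' rt sn gu ut lm sn' gu' ut' lm'; have tn : (t < qn Q)%N by rewrite -ut; apply: ptgt_bound.
  have [_ f2] := fl t rt tn; suff [] : (s, u) = (s', u') by [].
  apply: (lmax_uniq harr f2) => //.
    by rewrite mem_IB //= ut eqxx sn.
  by rewrite mem_IB //= ut' eqxx sn'.
- move=> k d1 d2 y p q dk1 dk2 ne; apply: (tor2_exit harr).
  exact: (gor_out2 harr hrel gor dk1 dk2 ne).
- move=> a y s z Ha; apply: (tor2_arrow harr hrel _ erefl).
  exact: (gor_arrow harr hrel gor erefl Ha).
Qed.

(** * Exits and chains of exits *)

Section Chains.
Variable Q : monquiver.
Local Notation n := (qn Q).
Local Notation m := (qm Q).
Local Notation src := (@qsrc Q).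
Local Notation tgt := (@qtgt Q).
Implicit Types (x y z u w f l q r : seq 'I_m) (s v j : nat) (k : 'I_n) (a b c d : 'I_m) (qs ss ps : seq (seq 'I_m)).

Hypothesis harr : forall a, (src a < tgt a)%N.
Hypothesis hrel : forall r, r \in qrels Q -> (2 <= size r)%N.
Hypothesis thr : threaded Q.

Definition ncr v := (forall a b, src a = v :> nat -> src b = v :> nat -> a = b) /\
                    (forall a b, tgt a = v :> nat -> tgt b = v :> nat -> a = b).

Lemma ncrP v (h : (v < n)%N) : ncr v \/ cross_spec (Ordinal h).
Proof.
case: (thr (Ordinal h)) => [[h1 h2]|]; [left | by right].
by split=> a b e e'; [apply: h1 | apply: h2]; apply: val_inj.
Qed.

Lemma nz_link q c d y : nonzero_path (rcons q c ++ d :: y) -> nonzero_path [:: c; d].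
Proof. by rewrite cat_rcons -[c :: _]/([:: c; d] ++ y); apply: nz_sub. Qed.

(** As qy is nonzero, the last arrow of q and the first of y lie on the same thread, and no relation
    passes through the crossing along it. *)
Lemma glueP k s y q q' : cross_spec k -> q != [::] -> good s (q' ++ q) -> ptgt s (q' ++ q) = k ->
  good (ptgt s q') (q ++ y) -> nonzero_path (q' ++ q ++ y).
Proof.
case: y => [|d y]; first by rewrite cats0 => _ _ /andP[].
case/lastP: q => // q c; rewrite -rcons_cat ptgt_rcons => cs _ gq qk gqy.
have [c1 [c2 [d1 [d2 [_ [_ _ n12 n21] hin hout [gl1 gl2]]]]]] := cs.
have gd : good k (d :: y) by have := goodr gqy; rewrite ptgt_rcons qk.
have dk : src d = k by apply: val_inj; case/andP: gd => /andP[/eqP].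
have nz : nonzero_path [:: c; d].
  by case/andP: gqy => _ /nz_link.
rewrite catA -rcons_cat.
case: (hin c (val_inj qk)) => ec; case: (hout d dk) => ed; subst c d.
- exact: gl1 gq gd.
- by rewrite (negbTE n12) in nz.
- by rewrite (negbTE n21) in nz.
- exact: gl2 gq gd.
Qed.

(** At a crossing the last arrow of q selects the thread; elsewhere at most one arrow leaves. *)
Lemma next_uniq s q b c y y' : (s < n)%N -> q != [::] -> good s (q ++ b :: y) -> good s (q ++ c :: y') -> b = c.
Proof.
move=> sn q0 g1 g2; have vn := ptgt_bound q sn.
have h1 : src b = ptgt s q :> nat by case/andP: (goodr g1) => /andP[/eqP].
have h2 : src c = ptgt s q :> nat by case/andP: (goodr g2) => /andP[/eqP].
case: (ncrP vn) => [[H _]|cs]; first by apply: H; rewrite ?h1 ?h2.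
case/lastP: q q0 g1 g2 h1 h2 vn cs => // q e _ g1 g2 h1 h2 vn cs.
apply: (cross_link cs (e := e)); try by apply: val_inj; rewrite /= ?ptgt_rcons ?h1 ?h2 ?ptgt_rcons.
  by case/andP: g1 => _ /nz_link.
by case/andP: g2 => _ /nz_link.
Qed.

Lemma prev_uniq s s' q b c w w' : (s < n)%N -> (s' < n)%N -> q != [::] ->
  good s (rcons w b ++ q) -> good s' (rcons w' c ++ q) -> b = c.
Proof.
case: q => // e q sn sn' _ g1 g2.
have hb : tgt b = src e :> nat by case/andP: (goodr g1) => /andP[/eqP->]; rewrite ptgt_rcons.
have hc : tgt c = src e :> nat by case/andP: (goodr g2) => /andP[/eqP->]; rewrite ptgt_rcons.
have nz1 : nonzero_path [:: b; e].
  by case/andP: g1 => _ /nz_link.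
have nz2 : nonzero_path [:: c; e].
  by case/andP: g2 => _ /nz_link.
case: (ncrP (ltn_ord (src e))) => [[_ H]|cs]; first exact: H.
have [c1 [c2 [d1 [d2 [_ [_ _ n12 n21] hin hout _]]]]] := cs.
have ee : src e = Ordinal (ltn_ord (src e)) by apply: val_inj.
have eb : tgt b = Ordinal (ltn_ord (src e)) by apply: val_inj.
have ec : tgt c = Ordinal (ltn_ord (src e)) by apply: val_inj.
case: (hin b eb) => e1; case: (hin c ec) => e2; case: (hout e ee) => e3; subst b c e => //.
- by rewrite (negbTE n21) in nz2.
- by rewrite (negbTE n12) in nz1.
- by rewrite (negbTE n21) in nz1.
- by rewrite (negbTE n12) in nz2.
Qed.

Lemma cmp_after s q y y' : (s < n)%N -> q != [::] -> good s (q ++ y) -> good s (q ++ y') ->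
  prefix y y' || prefix y' y.
Proof.
move=> sn; elim: y y' q => [|b y IH] [|c y'] q q0 g1 g2 //.
have e := next_uniq sn q0 g1 g2; subst c; rewrite /= eqxx /=.
by apply: (IH y' (rcons q b)); rewrite ?cat_rcons //; case: (q).
Qed.

Lemma cmp_from v y y' : (v < n)%N -> ncr v -> good v y -> good v y' -> prefix y y' || prefix y' y.
Proof.
case: y y' => [|b y] [|c y'] // vn [H _] g1 g2.
have e : b = c by apply: H; [case/andP: g1 => /andP[/eqP] | case/andP: g2 => /andP[/eqP]].
by subst c; rewrite /= eqxx /=; apply: (@cmp_after v [:: b]).
Qed.

Lemma cmp_before s s' q w w' : (s < n)%N -> (s' < n)%N -> q != [::] ->
  good s (w ++ q) -> good s' (w' ++ q) -> suffix w w' || suffix w' w.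
Proof.
move=> sn sn' q0; elim/last_ind: w w' q q0 => [|w b IH] w' q q0.
  by rewrite suffix0s.
case/lastP: w' => [|w' c]; first by rewrite suffix0s orbT.
move=> g1 g2; have e := prev_uniq sn sn' q0 g1 g2; subst c; rewrite !suffix_rcons eqxx /=.
by apply: (IH w' (b :: q)); rewrite -?cat_rcons.
Qed.

Lemma cmp_into s s' w w' v : (s < n)%N -> (s' < n)%N -> ncr v -> good s w -> good s' w' ->
  ptgt s w = v -> ptgt s' w' = v -> suffix w w' || suffix w' w.
Proof.
move=> sn sn' [_ H]; case/lastP: w => [|w b]; first by rewrite suffix0s.
case/lastP: w' => [|w' c]; first by rewrite suffix0s orbT.
rewrite !ptgt_rcons => g1 g2 e1 e2; have e : b = c by apply: H.
by subst c; rewrite !suffix_rcons eqxx /=; apply: (@cmp_before s s' [:: b]); rewrite ?cats1.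
Qed.

Lemma prefix_cat2l y x z : prefix (y ++ x) (y ++ z) = prefix x z.
Proof. by elim: y => //= a y ->; rewrite eqxx. Qed.

(* r generates the right annihilator of the path q inside P(t(q)). *)
Definition rex s q r := [/\ good (ptgt s q) r, r != [::] &
  forall y, good (ptgt s q) y -> ~~ nonzero_path (q ++ y) = prefix r y].
Definition nrex s q := forall y, good (ptgt s q) y -> nonzero_path (q ++ y).

Lemma cat_prefix x y z w : x ++ y = z ++ w -> prefix x z || prefix z x.
Proof.
elim: x z => [|a x IH] [|b z] //= [-> /IH].
by rewrite eqxx.
Qed.

Lemma prefix_anti r r' : prefix r r' -> prefix r' r -> r = r'.
Proof.
case/prefixP=> w -> /prefixP[w'] e.
have := congr1 size e; rewrite !size_cat -addnA -{1}[size r]addn0 => /eqP; rewrite eqn_add2l.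
by case: w {e} => [|a w] //; rewrite ?cats0.
Qed.

Lemma rex_uniq s q r r' : rex s q r -> rex s q r' -> r = r'.
Proof.
move=> [g1 _ H1] [g2 _ H2]; apply: prefix_anti.
  by rewrite -H1 // H2 // prefix_refl.
by rewrite -H2 // H1 // prefix_refl.
Qed.

Lemma cross_out k c : cross_spec k -> tgt c = k -> exists d d',
  [/\ src d = k, src d' = k, ~~ nonzero_path [:: c; d'], forall b, src b = k -> b != d' -> b = d &
   forall s f y, good s (rcons f c) -> good k (d :: y) -> nonzero_path (rcons f c ++ d :: y)].
Proof.
move=> [c1 [c2 [d1 [d2 [[_ d12 _ _] [dk1 dk2 n12 n21] hin hout [gl1 gl2]]]]]] /hin[->|->].
  by exists d1, d2; split=> // b /hout[->|->] //; rewrite eqxx.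
by exists d2, d1; split=> // b /hout[->|->] //; rewrite eqxx.
Qed.

(** Nothing on the thread of c kills the path, so the first arrow of the other thread is the whole
    annihilator's generator. *)
Lemma cross_rex k s q c a : cross_spec k -> good s (rcons q c) -> tgt c = k -> src a = k ->
  ~~ nonzero_path [:: c; a] -> rex s (rcons q c) [:: a].
Proof.
move=> cs gq ck ak nz; have [d [d' [dk dk' nz' hd gl]]] := cross_out cs ck.
have vE : ptgt s (rcons q c) = k by rewrite ptgt_rcons ck.
have ea : a = d'.
  apply/eqP; apply: contraT => /(hd a ak) e; case/negP: nz; rewrite e.
  by apply: (gl (src c) [::]); rewrite ?good_arrow // -dk good_arrow.
subst d'; split=> //; first by rewrite vE -ak good_arrow.
case=> [|b y] gy; first by rewrite cats0; case/andP: gq => _ ->.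
have bk : src b = k by apply: val_inj; rewrite /= -vE; case/andP: gy => /andP[/eqP].
rewrite /= prefix0s andbT eq_sym; case: (eqVneq b a) => eb.
  by rewrite eb; apply: contra nz => /nz_link.
apply/negbTE; rewrite negbK; have ed := hd b bk eb; subst b; apply: gl gq _.
by rewrite -vE.
Qed.

(** At a non-crossing vertex the paths going out are totally ordered by prefix, so a shortest y with
    qy = 0 generates the annihilator. *)
Lemma rex_ex s q : (s < n)%N -> good s q -> q != [::] -> nrex s q \/ exists r, rex s q r.
Proof.
move=> sn gq q0; have vn := ptgt_bound q sn.
case: (ncrP vn) => [nc|cs]; last first.
  right; case/lastP: q q0 gq vn cs => // q c _ gq vn cs.
  have ck : tgt c = Ordinal vn by apply: val_inj; rewrite /= ptgt_rcons.
  have [d [d' [_ dk' nz _ _]]] := cross_out cs ck.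
  by exists [:: d']; apply: cross_rex ck dk' nz.
pose P (N : nat) := has (fun p : qpath Q => [&& p.1 == ptgt s q, ~~ nonzero_path (q ++ p.2) & size p.2 == N]) (nzpaths Q).
case: (boolP (has (fun p : qpath Q => (p.1 == ptgt s q) && ~~ nonzero_path (q ++ p.2)) (nzpaths Q))) => [|H]; last first.
  left=> y gy; apply: contraT => nz; case/negP: H; apply/hasP; exists (ptgt s q, y); last by rewrite eqxx nz.
  by rewrite mem_nz //= vn.
case/hasP=> p0 p0N /andP[e0 b0].
have exP : exists N, P N by exists (size p0.2); apply/hasP; exists p0; rewrite // e0 b0 eqxx.
case: (ex_minnP exP) => N /hasP[[v r] rN /and3P[/eqP /= ev br /eqP sr]] kmin; subst v.
have gr : good (ptgt s q) r by move: rN; rewrite mem_nz // => /andP[].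
right; exists r; split=> //.
  by apply: contra br => /eqP ->; rewrite cats0; case/andP: gq.
move=> y gy; apply/idP/idP => [nz|/prefixP[w ->]]; last first.
  by apply: contra br; rewrite catA => /nz_catl.
case/orP: (cmp_from vn nc gr gy) => // /prefixP[w e].
have: (N <= size y)%N.
  by apply: kmin; apply/hasP; exists (ptgt s q, y); rewrite ?mem_nz //= ?vn // eqxx nz eqxx.
rewrite -sr e size_cat -{2}[size y]addn0 leq_add2l leqn0 => /nilP ->.
by rewrite cats0 prefix_refl.
Qed.

(** The chain of successive exits of q encodes the minimal projective resolution of P(s)/qA: after
    P(s) come the P(v) with v in [cvert], the last one at [cend]. The empty list means that qA is
    projective. *)
Fixpoint isch s q qs : Prop :=
  if qs is r :: qs' then rex s q r /\ isch (ptgt s q) r qs' else nrex s q.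
Fixpoint cend s q qs : nat := if qs is r :: qs' then cend (ptgt s q) r qs' else ptgt s q.
Fixpoint cvert s q qs : seq nat := ptgt s q :: if qs is r :: qs' then cvert (ptgt s q) r qs' else [::].

Lemma cend_in s q qs : cend s q qs \in cvert s q qs.
Proof. by elim: qs s q => [|r qs IH] s q /=; rewrite inE ?eqxx // IH orbT. Qed.

Lemma isch_uniq s q qs qs' : isch s q qs -> isch s q qs' -> qs = qs'.
Proof.
elim: qs s q qs' => [|r qs IH] s q [|r' qs'] //=.
- by move=> H [[g _ H'] _]; have := H _ g; rewrite -[nonzero_path _]negbK H' // prefix_refl.
- by move=> [[g _ H'] _] H; have := H _ g; rewrite -[nonzero_path _]negbK H' // prefix_refl.
move=> [h1 h2] [h1' h2']; have e := rex_uniq h1 h1'; subst r'.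
by rewrite (IH _ _ _ h2 h2').
Qed.

Lemma isch_same s q s' q' qs : ptgt s q = ptgt s' q' ->
  (forall y, good (ptgt s q) y -> nonzero_path (q ++ y) = nonzero_path (q' ++ y)) ->
  isch s q qs -> isch s' q' qs.
Proof.
move=> e H; case: qs => [|r qs] /=; first by move=> h y; rewrite -e => gy; rewrite -H // h.
rewrite e => -[[g r0 h] h2]; split=> //; split=> // [|y gy]; first by rewrite -e.
by rewrite -H ?e // h // e.
Qed.

Lemma isch_ex s q : (s < n)%N -> good s q -> q != [::] -> exists qs, isch s q qs.
Proof.
have [N] := ubnP (n - ptgt s q); elim: N s q => // N IH s q qN sn gq q0.
case: (rex_ex sn gq q0) => [h|[r hr]]; first by exists [::].
have [gr r0 _] := hr; have vn := ptgt_bound q sn.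
have [|qs hqs] := IH (ptgt s q) r _ vn gr r0; last by exists (r :: qs).
apply: subn_ltS qN; last exact: ptgt_bound.
by case/andP: gr => cr _; apply: composable_lt.
Qed.

Lemma rex_of_prefix s q r y : rex s q r -> good (ptgt s q) y -> ~~ prefix r y -> nonzero_path (q ++ y).
Proof. by case=> _ _ H gy; rewrite -H // negbK. Qed.

(* The left exits p_t, p_(t-1), ... read from left to right along the quiver. *)
Fixpoint pch s ps : Prop :=
  if ps is p :: ps' then [/\ good s p, p != [::],
     (if ps' is p' :: _ then ~~ nonzero_path (p ++ p') /\ nonzero_path (behead p ++ p') else True) &
     pch (ptgt s p) ps'] else True.

(** A certificate that the chains of h and gh do not merge: pi may follow h but is killed by gh, and
    the left exits [ps] interleave with the chains further on. In [chain_triple], with a bound on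
    lengths, it replaces the condition that j is off the chain of gh. *)
Definition wit s g h ps := exists pi, let v := ptgt s g in
  [/\ good v (h ++ pi), ~~ nonzero_path (g ++ h ++ pi), pch (ptgt v (h ++ pi)) ps &
    if ps is p :: _ then nonzero_path (pi ++ p) /\ ~~ nonzero_path (h ++ pi ++ p) else True].

Lemma proper_suffix_nz p p' w z : nonzero_path (behead p ++ p') -> p = w ++ z -> w != [::] -> nonzero_path (z ++ p').
Proof. by case: w => // a w + e _; rewrite e /= -catA => /nz_catr. Qed.

(* Three chains attached to a short exact sequence of uniserial modules: the exits of g, h *)
(* and gh are related by r(h) = r(gh) g', r(g) = h r(gh), r(gh) followed by g' h'.          *)
Lemma chain_triple s g h qs ss ps j :
  (s < n)%N -> g != [::] -> h != [::] -> good s (g ++ h) ->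
  isch (ptgt s g) h qs -> cend (ptgt s g) h qs = j -> isch s (g ++ h) ss ->
  (j \notin cvert s (g ++ h) ss) \/ [/\ (size ss <= size qs)%N, wit s g h ps & size ps = size qs] ->
  (size ss <= size qs)%N /\
  (ncr (ptgt s g) -> exists gs, [/\ isch s g gs, size gs = (size qs).+1 & cend s g gs = j]).
Proof.
have [N] := ubnP (size qs); elim: N s g h qs ss ps => // N IH s g h qs ss ps qN sn g0 h0 ggh.
set v := ptgt s g; have vn : (v < n)%N by apply: ptgt_bound.
have gh : good v h := goodr ggh; have gg : good s g := goodl ggh.
have tE : ptgt s (g ++ h) = ptgt v h by rewrite ptgt_cat.
have tn : (ptgt v h < n)%N by apply: ptgt_bound.
case: ss => [|r1 ss] hq hj hs H.
  exfalso; have hs' : nrex v h by move=> y gy; apply: (@nz_catr _ g); rewrite catA; apply: hs; rewrite tE.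
  case: H => [/negP[]|[_ [pi [gpi bpi _ _]] _]]; last first.
    by case/negP: bpi; rewrite catA; apply: hs; rewrite tE; apply: goodr gpi.
  by rewrite -hj (@isch_uniq v h qs [::]) //= inE tE.
case: qs qN hq hj H => [|r2 qs] qN hq hj H.
  exfalso; case: H => [/negP[]|[]] //.
  by rewrite -hj /= tE inE eqxx.
case: hq => h2 hq; case: (h2) => gr2 r20 H2; case: hs => h1 hs; case: (h1); rewrite tE => gr1 r10 H1.
rewrite tE in hs.
have b2 : ~~ nonzero_path (h ++ r2) by rewrite H2 // prefix_refl.
have /prefixP[g2 er2] : prefix r1 r2.
  by rewrite -H1 //; apply: contra b2; rewrite -catA => /nz_catr.
(* With equal exits the chains of h and gh would coincide from here on, so that of gh would contain
   j; the certificate excludes equal exits directly. *)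
have g20 : g2 != [::].
  apply/eqP => e; move: er2; rewrite e cats0 => e2; subst r2.
  case: H => [/negP[]|[_ [pi [gpi bpi _ _]] _]]; last first.
    have gpi' := goodr gpi; case/negP: (bpi).
    have : ~~ prefix r1 pi by rewrite -H2 // negbK; case/andP: gpi.
    by move=> npr; rewrite catA; apply: (rex_of_prefix h1); rewrite ?tE.
  by rewrite -hj (isch_uniq hq hs) /= tE inE cend_in orbT.
have nhr1 : nonzero_path (h ++ r1).
  apply: (rex_of_prefix h2) => //; apply/negP => /prefixP[w e]; case/negP: g20.
  have := congr1 size e; rewrite er2 !size_cat -addnA -{1}[size r1]addn0 => /eqP; rewrite eqn_add2l.
  by case: (g2).
have ghr1 : good v (h ++ r1) by rewrite good_cat.
pose v2 := ptgt (ptgt v h) r1; have v2n : (v2 < n)%N by apply: ptgt_bound.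
have gg2 : good v2 g2 by apply: goodr; rewrite -er2.
(* At a crossing, the nonzero paths h r1 and r1 g2 would glue to a nonzero h r2. *)
have nc2 : ncr v2.
  case: (ncrP v2n) => // cs; exfalso; case/negP: b2; rewrite er2.
  by apply: (glueP cs r10 ghr1); rewrite ?ptgt_cat // -er2.
have rex_g : ncr v -> rex s g (h ++ r1).
  move=> nc; split=> //; first by case: (h) h0.
  move=> y gy; apply/idP/idP => [nz|/prefixP[w ->]]; last first.
    apply/negP => nz; move: (H1 r1 gr1); rewrite prefix_refl => /negP[].
    by move: nz; rewrite !catA => /nz_catl.
  case/orP: (cmp_from vn nc ghr1 gy) => // /prefixP[e ee].
  case/lastP: e ee => [|e c] ee; first by rewrite cats0 in ee; rewrite ee prefix_refl.
  exfalso; case/lastP: r1 ee r10 gr1 h1 {hs H H1 er2 nhr1 ghr1 v2 v2n gg2 nc2} => // r1 c'.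
  rewrite -!rcons_cat => /rcons_inj[ee _] _ gr1 h1; case/negP: nz.
  have gr' : good (ptgt v h) r1 by move: gr1; rewrite -cats1 => /goodl.
  suff : nonzero_path (g ++ h ++ r1) by rewrite ee catA => /nz_catl.
  rewrite catA; apply: (rex_of_prefix h1); rewrite ?tE //.
  by apply/negP => /prefixP[w] /(congr1 size); rewrite size_cat size_rcons addSn -addnS => /eqP; rewrite -{1}[size r1]addn0 eqn_add2l.
have rex_hr1 : rex v (h ++ r1) g2.
  split=> //; first by rewrite ptgt_cat.
  rewrite ptgt_cat => y gy; apply/idP/idP => [nz|/prefixP[w ->]]; last first.
    by apply: contra b2; rewrite er2 !catA => /nz_catl.
  case/orP: (cmp_from v2n nc2 gg2 gy) => // /prefixP[w e].
  have gr1y : good (ptgt v h) (r1 ++ y) by apply: (@goodl _ _ _ w); rewrite -catA -e -er2.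
  have : prefix r2 (r1 ++ y) by rewrite -H2 // catA.
  by rewrite er2 prefix_cat2l.
(* Either the chain of gh stops at r1, and the rest of the chain of h finishes that of g, or r1 has
   an exit x = g2 h3; then h3 is the exit of r2 and the same configuration recurs with g2 and h3. *)
case: ss hs H => [|x ss] hs H.
  split=> // nc; exists [:: h ++ r1, g2 & qs]; split=> //=.
    split; first exact: rex_g; split=> //; rewrite ptgt_cat.
    apply: isch_same hq; first by rewrite er2 ptgt_cat.
    move=> y; rewrite er2 ptgt_cat => gy; rewrite -catA.
    apply/idP/idP => [/nz_catr //|nz]; apply: hs.
    by rewrite good_cat.
  by rewrite -hj /= er2 !ptgt_cat; case: (qs) => //=; rewrite ?ptgt_cat.
case: hs => hx hs; case: (hx) => gx x0 Hx.
have bx : ~~ nonzero_path (r1 ++ x) by rewrite Hx // prefix_refl.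
have npx : ~~ prefix x g2 by rewrite -Hx // negbK -er2; case/andP: gr2.
have /prefixP[h3 ex] : prefix g2 x by case/orP: (cmp_from v2n nc2 gg2 gx) => //; rewrite (negbTE npx).
have h30 : h3 != [::] by apply: contra npx => /eqP e; rewrite ex e cats0 prefix_refl.
pose v3 := ptgt v2 g2; have v3n : (v3 < n)%N by apply: ptgt_bound.
have v3E : ptgt (ptgt v h) r2 = v3 by rewrite er2 ptgt_cat.
have gh3 : good v3 h3 by apply: goodr; rewrite -ex.
have nc3 : ncr v3.
  case: (ncrP v3n) => // cs; exfalso; case/negP: bx; rewrite ex.
  apply: (@glueP _ (ptgt v h) h3 g2 r1 cs g20); rewrite -?er2 //.
  by rewrite -/v2 -ex.
have rex_r2 : rex (ptgt v h) r2 h3.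
  split; rewrite ?v3E // => y gy; apply/idP/idP => [nz|/prefixP[w ->]]; last first.
    by apply: contra bx; rewrite er2 ex !catA => /nz_catl.
  case/orP: (cmp_from v3n nc3 gh3 gy) => // /prefixP[w e].
  have gxy : good v2 (g2 ++ y) by apply: (@goodl _ _ _ w); rewrite -catA -e -ex.
  have : prefix x (g2 ++ y) by rewrite -Hx // catA -er2.
  by rewrite ex prefix_cat2l.
case: qs qN hq hj H => [|h3' qs] qN hq hj H.
  exfalso; have [_ _ /(_ h3)] := rex_r2; rewrite v3E gh3 prefix_refl => /(_ isT)/negP[].
  by apply: hq; rewrite v3E.
case: hq => hr2 hq; have e := rex_uniq hr2 rex_r2; subst h3'; rewrite v3E in hq.
rewrite -/v2 ex in hs.
have [||||le Hg] := IH v2 g2 h3 qs ss (drop 2 ps) _ v2n g20 h30 _ hq _ hs.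
- by move: qN; rewrite /= ltnS => /ltnW.
- by rewrite -ex.
- by rewrite -hj /= v3E.
(* The certificate passes to (g2, h3) by using up two left exits p and p': one finds pi p = r2 w1,
   h3 = w1 so and p' = so pi3, and pi3 is the new witness. *)
- case: H => [nj|[le [pi [gpi bpi pps hp]] sps]]; [left | right].
    by move: nj; rewrite /= tE !inE !negb_or ex => /and3P[_ _].
  split=> //.
  case: ps pps hp sps => [|p [|p' ps]] //= [gp p00 [bpp nzpp] [gp' p0' hp' pps]] [nzpip bhpip] sps.
  have gpi' : good (ptgt v h) pi by apply: goodr gpi.
  have tpi : ptgt v (h ++ pi) = ptgt (ptgt v h) pi by rewrite ptgt_cat.
  rewrite tpi in gp gp' pps.
  have gpip : good (ptgt v h) (pi ++ p) by rewrite good_cat.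
  have /prefixP[w1 e1] : prefix r2 (pi ++ p) by rewrite -H2.
  have npr : ~~ prefix r2 pi by rewrite -H2 // negbK; case/andP: gpi.
  have [sg [es sg0]] : exists sg, r2 = pi ++ sg /\ sg != [::].
    have : prefix pi r2 || prefix r2 pi by exact: cat_prefix e1.
    case/orP=> [/prefixP[sg e2]|pr]; last by rewrite pr in npr.
    by exists sg; split=> //; apply: contra npr => /eqP e3; rewrite e2 e3 cats0 prefix_refl.
  have ep : p = sg ++ w1 by apply: (@cat_injl _ pi); rewrite e1 es catA.
  have /prefixP[ta eta] : prefix r1 pi.
    rewrite -H1 //; by move: bpi; rewrite catA.
  have eg2 : g2 = ta ++ sg by apply: (@cat_injl _ r1); rewrite -er2 es eta catA.
  have gr2w : good (ptgt v h) (r2 ++ w1) by rewrite -e1.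
  have gw1 : good v3 w1 by rewrite -v3E; apply: goodr gr2w.
  have tw1 : ptgt v3 w1 = ptgt (ptgt (ptgt v h) pi) p by rewrite -v3E -!ptgt_cat -e1.
  have nzwp : nonzero_path (w1 ++ p') := proper_suffix_nz nzpp ep sg0.
  have [so [eso so0]] : exists so, h3 = w1 ++ so /\ so != [::].
    have nh3 : ~~ prefix h3 w1.
      have [_ _ /(_ w1)] := rex_r2; rewrite v3E => /(_ gw1) <-; rewrite negbK.
      by case/andP: gr2w.
    case/orP: (cmp_from v3n nc3 gw1 gh3) => [/prefixP[so e2]|pr]; last by rewrite pr in nh3.
    by exists so; split=> //; apply: contra nh3 => /eqP e3; rewrite e2 e3 cats0 prefix_refl.
  have gwp : good v3 (w1 ++ p') by rewrite good_cat // tw1.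
  have bx3 : ~~ nonzero_path (g2 ++ w1 ++ p').
    by apply: contra bpp; rewrite eg2 ep -!catA => /nz_catr.
  have /prefixP[pi3 e3] : prefix so p'.
    have /orP[//|/prefixP[w e4]] : prefix so p' || prefix p' so.
      have := cmp_from v3n nc3 gh3 gwp; rewrite eso !prefix_cat2l.
      by case/orP=> ->; rewrite ?orbT.
    exfalso; case/negP: bx3; case/andP: gx => _; rewrite ex eso e4 !catA => /nz_catl.
    by rewrite -!catA.
  exists pi3; rewrite -/v3 eso -!catA -e3; split=> //.
  - have -> : ptgt v3 (w1 ++ p') = ptgt (ptgt (ptgt (ptgt v h) pi) p) p' by rewrite ptgt_cat tw1.
    by case: (ps) pps => [|p3 ps'] //=; rewrite ?drop0.
  - case: (ps) hp' pps => [|p3 ps'] //= [b3 nz3] _.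
    split; first exact: proper_suffix_nz nz3 e3 so0.
    by apply: contra b3; rewrite e3 -!catA => /nz_catr.
  by rewrite size_drop sps /= subn2.
split; first exact: le.
move=> nc; have [gs [hgs sgs cgs]] := Hg nc3.
exists [:: h ++ r1, g2 & gs]; split=> /=.
- split; first exact: rex_g; split=> //.
  by rewrite ptgt_cat.
- by rewrite sgs.
- by rewrite !ptgt_cat; case: (gs) cgs => //= *; rewrite ?ptgt_cat.
Qed.

End Chains.

(** * Left exits and the comparison of the two kinds of chains *)

Section LeftChains.
Variable Q : monquiver.
Local Notation n := (qn Q).
Local Notation m := (qm Q).
Local Notation src := (@qsrc Q).
Local Notation tgt := (@qtgt Q).
Implicit Types (x y z u v w f l q r : seq 'I_m) (s j : nat) (k : 'I_n) (a b c d : 'I_m) (qs ss rps : seq (seq 'I_m)) (ps : seq (qpath Q)).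

Hypothesis harr : forall a, (src a < tgt a)%N.
Hypothesis hrel : forall r, r \in qrels Q -> (2 <= size r)%N.
Hypothesis thr : threaded Q.

Lemma ncr_cross k : ncr Q k -> ~ cross_spec k.
Proof.
move=> [_ H] [c1 [c2 [d1 [d2 [[c12 _ e1 e2] _ _ _ _]]]]]; case/negP: c12; apply/eqP.
by apply: H; rewrite ?e1 ?e2.
Qed.

Lemma cross_in k d : cross_spec k -> src d = k -> exists c c',
  [/\ tgt c = k, tgt c' = k, ~~ nonzero_path [:: c'; d], forall b, tgt b = k -> b != c' -> b = c &
   forall s f y, good s (rcons f c) -> good k (d :: y) -> nonzero_path (rcons f c ++ d :: y)].
Proof.
move=> [c1 [c2 [d1 [d2 [[_ _ ck1 ck2] [dk1 dk2 n12 n21] hin hout [gl1 gl2]]]]]] /hout[->|->].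
  by exists c1, c2; split=> // b /hin[->|->] //; rewrite eqxx.
by exists c2, c1; split=> // b /hin[->|->] //; rewrite eqxx.
Qed.

Definition lex s p s' l := [/\ (s' < n)%N, good s' l, ptgt s' l = s, l != [::] &
  forall t w, (t < n)%N -> good t w -> ptgt t w = s -> ~~ nonzero_path (w ++ p) = suffix l w].
Definition nlex s p := forall t w, (t < n)%N -> good t w -> ptgt t w = s -> nonzero_path (w ++ p).

Lemma lex_ex s p : (s < n)%N -> good s p -> p != [::] -> nlex s p \/ exists s' l, lex s p s' l.
Proof.
move=> sn gp p0; case: (ncrP thr sn) => [nc|cs]; last first.
  right; case: p p0 gp => // d p _ gp; have dk : src d = Ordinal sn by apply: val_inj; case/andP: gp => /andP[/eqP].
  have [c [c' [ck ck' nz hc gl]]] := cross_in cs dk.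
  exists (src c'), [:: c']; split=> //; first exact: good_arrow.
    by rewrite -[LHS]/(nat_of_ord (tgt c')) ck'.
  move=> t w; case/lastP: w => [|w b] tn gw wt; first by case/andP: gp => _ ->.
  have bk : tgt b = Ordinal sn by apply: val_inj; rewrite /= -wt ptgt_rcons.
  rewrite -[ [:: c'] ]/(rcons [::] c') suffix_rcons suffix0s andbT eq_sym; case: (eqVneq b c') => eb.
    by rewrite eb; apply: contra nz => /nz_link.
  by apply/negbTE; rewrite negbK; have ec := hc b bk eb; subst b; apply: gl gw gp.
pose bad (l : qpath Q) := (pend l == s) && ~~ nonzero_path (l.2 ++ p).
case: (boolP (has bad (nzpaths Q))) => [|H]; last first.
  left=> t w tn gw wt; apply: contraT => nz; case/negP: H; apply/hasP; exists (t, w); last by rewrite /bad /pend /= wt eqxx nz.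
  by rewrite mem_nz //= tn.
case/hasP=> p1 p1N b1.
have exP : exists N, has (fun e => bad e && (size e.2 == N)) (nzpaths Q).
  by exists (size p1.2); apply/hasP; exists p1; rewrite // b1 eqxx.
case: (ex_minnP exP) => N /hasP[[s' l] lN /andP[/andP[/eqP /= ev br] /eqP /= sl]] Nmin.
move: (lN); rewrite mem_nz //= => /andP[s'n gl].
right; exists s', l; split=> //.
  by apply: contra br => /eqP ->; case/andP: gp.
move=> t w tn gw wt; apply/idP/idP => [nz|/suffixP[w' ->]]; last first.
  by apply: contra br; rewrite -catA => /nz_catr.
case/orP: (cmp_into thr s'n tn nc gl gw ev wt) => // /suffixP[w' e].
have: (N <= size w)%N.
  by apply: Nmin; apply/hasP; exists (t, w); rewrite ?mem_nz //= ?tn // /bad /pend /= wt eqxx nz eqxx.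
rewrite -sl e size_cat -{2}[size w]add0n leq_add2r leqn0 => /nilP ->.
by rewrite suffix_refl.
Qed.

Fixpoint lch s p ps : Prop := if ps is l :: ps' then lex s p l.1 l.2 /\ lch l.1 l.2 ps' else nlex s p.

Lemma lch_ex s p : (s < n)%N -> good s p -> p != [::] -> exists ps, lch s p ps.
Proof.
have [N] := ubnP s; elim: N s p => // N IH s p sN sn gp p0.
case: (lex_ex sn gp p0) => [h|[s' [l hl]]]; first by exists [::].
have [s'n gl ls l0 _] := hl; have [|ps hps] := IH s' l _ s'n gl l0; last by exists ((s', l) :: ps).
by rewrite -ltnS; apply: leq_trans sN; rewrite ltnS -ls; case/andP: gl => cl _; apply: composable_lt.
Qed.

(* The minimal injective coresolution of P(j) has the terms I(t(v)), I(s(p)) for p in ps. *)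
Definition pdata j v ps := [/\ good j v, (forall y, good j y -> prefix y v) &
  if ps is p :: ps' then exists a,
    [/\ tgt a = j :> nat, p = (src a : nat, a :: v), nonzero_path (a :: v) & lch p.1 p.2 ps']
  else forall a, tgt a = j :> nat -> ~~ nonzero_path (a :: v)].

Lemma pdata_ex j : (j < n)%N -> ncr Q j -> exists v ps, pdata j v ps.
Proof.
move=> jn nc; have [v [gv rm]] := rext_ex harr jn (good_nil hrel j); rewrite /= in gv rm.
have pv y : good j y -> prefix y v.
  move=> gy; case/orP: (cmp_from thr jn nc gy gv) => // /prefixP[[|a w] e]; first by rewrite e cats0 prefix_refl.
  exfalso; rewrite e -cat_rcons in gy; have := goodl gy; rewrite /good composable_rcons => /andP[/andP[_ /eqP as_]].
  by rewrite (negbTE (rm a as_)).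
case: (boolP [exists a, (tgt a == j :> nat) && nonzero_path (a :: v)]) => [/existsP[a /andP[/eqP aj nz]]|].
  have ga : good (src a) (a :: v) by rewrite /good /= eqxx aj nz andbT; case/andP: gv.
  have [ps hps] := lch_ex (ltn_ord _) ga isT.
  by exists v, ((src a : nat, a :: v) :: ps); split=> //; exists a.
rewrite negb_exists => /forallP H; exists v, [::]; split=> // a aj.
by have := H a; rewrite aj eqxx.
Qed.

(* The minimal projective resolution of I(i) has the terms P(y) for y in ivert s qs. *)
Definition idata i s u qs := [/\ (s < n)%N, good s u, ptgt s u = i, lmax s u &
  if qs is q :: qs' then exists a, [/\ src a = i :> nat, q = rcons u a, nonzero_path q & isch s q qs']
  else forall a, src a = i :> nat -> ~~ nonzero_path (rcons u a)].
Definition ivert s qs := s :: (if qs is q :: qs' then cvert s q qs' else [::]).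
Definition iend s qs := if qs is q :: qs' then cend s q qs' else s.

Lemma good_rcons s u a : good s u -> src a = ptgt s u :> nat -> nonzero_path (rcons u a) -> good s (rcons u a).
Proof. by move=> /andP[cu _] e nz; rewrite /good composable_rcons cu e eqxx. Qed.

Lemma idata_ex i : (i < n)%N -> exists s u qs, idata i s u qs.
Proof.
move=> i_n; have [s [u [sn gu us lm]]] := lext_ex harr i_n (good_nil hrel i); rewrite cats0 in gu lm.
case: (boolP [exists a, (src a == i :> nat) && nonzero_path (rcons u a)]) => [/existsP[a /andP[/eqP ai nz]]|].
  have ga : good s (rcons u a) by apply: good_rcons; rewrite ?us.
  have [|qs hqs] := isch_ex harr hrel thr sn ga; first by case: (u).
  by exists s, u, (rcons u a :: qs); split=> //; exists a.
rewrite negb_exists => /forallP H; exists s, u, [::]; split=> // a ai.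
by have := H a; rewrite ai eqxx.
Qed.

Lemma lmax_suffix s u s' w : lmax s u -> good s u -> good s' (w ++ u) -> ptgt s' w = s -> w = [::].
Proof.
case/lastP: w => // w b lm gu gw; rewrite ptgt_rcons => bs.
by case/andP: gw => _; rewrite cat_rcons => /nz_catr; rewrite (negbTE (lm b bs)).
Qed.

Lemma start_eq s s' u : good s u -> good s' u -> ptgt s u = ptgt s' u -> s = s'.
Proof. by case: u => // a u /andP[/andP[/eqP <- _] _] /andP[/andP[/eqP <- _] _]. Qed.

Lemma start_suffix s s' u w : good s u -> good s' (w ++ u) -> ptgt s u = ptgt s' (w ++ u) -> ptgt s' w = s.
Proof. by move=> g g' e; apply: start_eq (goodr g') g _; rewrite e ptgt_cat. Qed.

Lemma lmax_uniqs s s' u u' i : (s < n)%N -> (s' < n)%N -> ncr Q i -> good s u -> good s' u' -> ptgt s u = i -> ptgt s' u' = i ->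
  lmax s u -> lmax s' u' -> s = s' /\ u = u'.
Proof.
move=> sn s'n nc g g' e e' lm lm'.
suff eu : u = u' by subst u'; split=> //; apply: start_eq g g' _; rewrite e e'.
case/orP: (cmp_into thr sn s'n nc g g' e e') => /suffixP[w ew]; subst.
  by rewrite (lmax_suffix lm g g') //; apply: start_suffix g g' _; rewrite e'.
by rewrite (lmax_suffix lm' g' g) //; apply: start_suffix g' g _; rewrite e'.
Qed.

Lemma idata_uniq i s u qs s' u' qs' : ncr Q i -> idata i s u qs -> idata i s' u' qs' -> [/\ s = s', u = u' & qs = qs'].
Proof.
move=> nc [sn g e lm H] [s'n g' e' lm' H'].
have [es eu] := lmax_uniqs sn s'n nc g g' e e' lm lm'; subst s' u'; split=> //.
case: qs qs' H H' => [|q qs] [|q' qs'] //.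
- by move=> H [a [ai -> nz _]]; rewrite (negbTE (H a ai)) in nz.
- by move=> [a [ai -> nz _]] H; rewrite (negbTE (H a ai)) in nz.
move=> [a [ai -> nz h]] [a' [ai' -> nz' h']]; have ea : a = a' by apply: (proj1 nc).
by subst a'; rewrite (isch_uniq h h').
Qed.

(** At a crossing, the incoming arrow of the thread on which u starts would prolong u. *)
Lemma lmax_ncr s u : (s < n)%N -> good s u -> u != [::] -> lmax s u -> ncr Q s.
Proof.
case: u => // d u sn g _ lm; case: (ncrP thr sn) => // cs.
have dk : src d = Ordinal sn by apply: val_inj; case/andP: g => /andP[/eqP].
have [c [c' [ck _ _ _ gl]]] := cross_in cs dk.
have := gl (src c) [::] u (good_arrow hrel c) g; rewrite /= => nz.
by have := lm c (congr1 val ck); rewrite nz.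
Qed.

Lemma pdata_ncr j v ps : (j < n)%N -> ncr Q j -> pdata j v ps -> ncr Q (ptgt j v).
Proof.
move=> jn nc [gv rm _]; case/lastP: v gv rm => // v c gv rm.
have vn := ptgt_bound (rcons v c) jn; case: (ncrP thr vn) => // cs; exfalso.
have ck : tgt c = Ordinal vn by apply: val_inj; rewrite /= ptgt_rcons.
have [d [d' [dk _ _ _ gl]]] := cross_out cs ck.
have gd : good (ptgt j (rcons v c)) [:: d] by have := good_arrow hrel d; rewrite dk.
have g2 : good j (rcons v c ++ [:: d]) by rewrite good_cat //; apply: gl gv gd.
have /prefixP[w] := rm _ g2; move/(congr1 size); rewrite !size_cat size_rcons /= => e.
by move: e; rewrite addnAC -{1}[(size v).+1]addn0 -!addnA => /eqP; rewrite eqn_add2l addn1.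
Qed.

(** Paths into s are comparable. The exit is longer than z, which does not kill a pi, and by
    maximality z with one more arrow in front already does. *)
Lemma exit_left s a pi t z s2 l : (t < n)%N -> ncr Q s -> good t (z ++ a :: pi) -> ptgt t z = s -> lmax t (z ++ a :: pi) ->
  lex s (a :: pi) s2 l -> exists c, [/\ l = c :: z, s2 = src c & t = tgt c].
Proof.
move=> tn nc g zs lm [s2n gl ls l0 H]; have gz := goodl g.
have nsz : ~~ suffix l z by rewrite -(H t z) // negbK; case/andP: g.
case/orP: (cmp_into thr s2n tn nc gl gz ls zs) => [sf|/suffixP[w e]]; first by rewrite sf in nsz.
case/lastP: w e => [|w c] e; first by rewrite e suffix_refl in nsz.
have tc : t = tgt c.
  by have := start_suffix gz (s' := s2) (w := rcons w c); rewrite -e ptgt_rcons => /(_ gl) <- //; rewrite ls.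
have gcz : good (src c) (c :: z).
  rewrite e cat_rcons in gl; have := goodr gl; case/andP: (goodr gl) => /andP[/eqP -> _] _ //.
have bad : ~~ nonzero_path ((c :: z) ++ a :: pi) by apply: lm.
rewrite (H (src c)) ?ltn_ord // in bad; last by rewrite ptgt_cons -tc.
case/suffixP: bad => w'; rewrite e cat_rcons => /(congr1 size); rewrite !size_cat /= => es.
have w0 : w = [::].
  by move/eqP: es; rewrite addnA -{1}[(size z).+1]add0n eqn_add2r eq_sym addn_eq0 => /andP[_ /nilP].
rewrite w0 /= in e *; exists c; split=> //.
by move: gl; rewrite e => /andP[/andP[/eqP <-]].
Qed.

(* Walking along the coresolution of P(j), the exits of [rcons z a], where z is the longest *)
(* path that extends the current left exit a :: pi, form a chain that ends at j and grows by   *)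
(* one at each step; at the last step it is the resolution of I(x).                            *)
Lemma chain_main ps s a pi rps j :
  (s < n)%N -> good s (a :: pi) -> lch s (a :: pi) ps -> pch s ((a :: pi) :: rps) ->
  (forall t z, (t < n)%N -> good t (z ++ a :: pi) -> ptgt t z = s -> lmax t (z ++ a :: pi) ->
     exists qs, [/\ isch t (rcons z a) qs, size qs = size rps & cend t (rcons z a) qs = j]) ->
  (forall i, (i < size ps)%N -> ncr Q (nth 0%N (s :: map fst ps) i) -> forall s' u qs,
     idata (nth 0%N (s :: map fst ps) i) s' u qs -> j \notin ivert s' qs \/ (size qs <= (size rps + i).+1)%N) ->
  (forall i, (i <= size ps)%N -> ncr Q (nth 0%N (s :: map fst ps) i) -> forall s' u qs,
     idata (nth 0%N (s :: map fst ps) i) s' u qs -> (size qs <= (size rps + i).+1)%N) /\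
  (ncr Q (last s (map fst ps)) /\ exists s' u qs,
     [/\ idata (last s (map fst ps)) s' u qs, size qs = (size rps + size ps).+1 & iend s' qs = j]).
Proof.
elim: ps s a pi rps => [|[s2 l] ps IH] s a pi rps sn gp hl hp Hz Hyp.
  have [t [z [tn gz zs lm]]] := lext_ex harr sn gp; have [qs [hqs sqs cqs]] := Hz t z tn gz zs lm.
  have nc : ncr Q s.
    case: (ncrP thr sn) => // cs; have as_ : src a = Ordinal sn by apply: val_inj; case/andP: gp => /andP[/eqP].
    have [c [c' [_ ck' /negP nzc _ _]]] := cross_in cs as_; case: nzc.
    by apply: (@nz_link _ [::] _ _ pi); apply: (hl (src c') [:: c']); rewrite ?good_arrow // /ptgt /= ck'.
  have gza : good t (rcons z a) by rewrite -cat_rcons in gz; apply: goodl gz.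
  have D : idata s t z (rcons z a :: qs).
    split=> //; first exact: goodl gz.
      move=> b bt; apply: contra (lm b bt) => nz; rewrite -cat_cons; apply: (hl (src b)) => //.
        by rewrite /good /= eqxx bt nz; case/andP: (goodl gz) => ->.
      by rewrite ptgt_cons bt.
    exists a; split=> //; first by case/andP: gp => /andP[/eqP].
    by case/andP: gza.
  rewrite /= addn0; split; last by split=> //; exists t, z, (rcons z a :: qs); rewrite /= sqs.
  move=> [|//] _ _ s' u qs' D'; have [_ _ <-] := idata_uniq nc D D'.
  by rewrite /= sqs addn0.
case: hl => hl hps; have [s2n gl ls l0 Hl] := hl; rewrite /= in s2n gl ls l0 Hl hps hl.
have [t [z [tn gz zs lm]]] := lext_ex harr sn gp; have [qs [hqs sqs cqs]] := Hz t z tn gz zs lm.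
have as_ : src a = s :> nat by case/andP: gp => /andP[/eqP].
have nz_p : ~~ nonzero_path (l ++ a :: pi) by rewrite (Hl s2) // suffix_refl.
have nz_bp : nonzero_path (behead l ++ a :: pi).
  case: l l0 gl ls Hl {hl hps nz_p Hyp} => // c l _ gl ls Hl; apply: contraT => /= nz.
  have gl' : good (tgt c) l by apply: (@goodr _ s2 [:: c]).
  have /suffixP[w] : suffix (c :: l) l by rewrite -(Hl (tgt c)) ?ltn_ord.
  by move/(congr1 size); rewrite size_cat /= addnS -addSn => /addn_neq.
(* The step must deliver the bound for I(s) and the chains belonging to the next left exit l, one
   longer than before. *)
suff [Hb Hn] : (ncr Q s -> forall s' u qs, idata s s' u qs -> (size qs <= (size rps).+1)%N) /\
   (forall t z, (t < n)%N -> good t (z ++ l) -> ptgt t z = s2 -> lmax t (z ++ l) ->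
     exists qs, [/\ isch t (rcons z (head a l)) qs, size qs = (size rps).+1 & cend t (rcons z (head a l)) qs = j]).
  case: l l0 gl ls Hl hl hps nz_p nz_bp Hn Hyp => // c l _ gl ls Hl hl hps nz_p nz_bp Hn Hyp.
  have [|||R1 R2] := IH s2 c l ((a :: pi) :: rps) s2n gl hps.
  - split=> //; rewrite ls; exact: hp.
  - exact: Hn.
  - move=> i ilt nci s' u qs' D; have := Hyp i.+1 ilt nci s' u qs' D.
    by rewrite /= addnS addSn.
  split; last by move: R2; rewrite /= addnS addSn.
  move=> [|i] ile nci s' u qs' D; first by rewrite addn0; apply: Hb D.
  by have := R1 i ile nci s' u qs' D; rewrite /= addnS addSn.
(* At a crossing the left exit is the single arrow c', and the new chain is the old one with a put
   in front: by gluing, a and za have the same annihilator. *)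
case: (ncrP thr sn) => [nc|cs]; last first.
  split; first by move=> nc; case: (ncr_cross (k := Ordinal sn) nc cs).
  have ask : src a = Ordinal sn by apply: val_inj.
  have [c [c' [ck ck' nz hc glue]]] := cross_in cs ask.
  have el : l = [:: c'].
    have : ~~ nonzero_path ([:: c'] ++ a :: pi) by apply: contra nz => /(@nz_link _ [::]).
    rewrite (Hl (src c')) ?ltn_ord ?good_arrow //; last by rewrite /ptgt /= ck'.
    case/suffixP=> -[|b w] /= e; first by rewrite e.
    by case: e => _ e; case: (l) l0 e; case: (w).
  subst l => t' z' t'n gz' zs' lm'; rewrite /= cats1 in gz' *.
  exists ([:: a] :: qs); split=> /=; last 1 first.
  - rewrite ptgt_rcons -cqs; case: (qs) => [|r qs'] /=; rewrite ?ptgt_rcons //.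
  - split; first exact: cross_rex cs gz' ck' ask nz.
    apply: isch_same hqs; first by rewrite !ptgt_rcons.
    move=> y; rewrite ptgt_rcons => gy; rewrite cat_rcons.
    apply/idP/idP => [/nz_catr //|nzy].
    case/lastP: z gz zs {lm cqs} => // z0 b gz zs.
    have bk : tgt b = Ordinal sn by apply: val_inj; rewrite /= -zs ptgt_rcons.
    have nb : b != c' by apply: contra nz => /eqP <-; case/andP: gz => _ /nz_link.
    have eb := hc b bk nb; subst b; apply: glue (goodl gz) _.
    by rewrite /good nzy andbT /= as_ eqxx /=; case/andP: gy.
  by rewrite sqs.
have [c [el es2 etc]] := exit_left tn nc gz zs lm hl.
have ncc : ncr Q t by apply: (lmax_ncr tn gz) => //; case: (z).
have step t' z' : (t' < n)%N -> good t' (z' ++ l) -> ptgt t' z' = s2 -> lmax t' (z' ++ l) ->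
    (exists2 qs', idata s t' (z' ++ l) qs' & (size qs' <= (size rps).+1)%N) /\
    exists qs, [/\ isch t' (rcons z' c) qs, size qs = (size rps).+1 & cend t' (rcons z' c) qs = j].
  move=> t'n gz' zs' lm'; pose g := rcons z' c; pose h := rcons z a.
  have uE : z' ++ l = g ++ z by rewrite el -cat_rcons.
  have qE : rcons (z' ++ l) a = g ++ h by rewrite uE rcons_cat.
  have us : ptgt t' (z' ++ l) = s by rewrite ptgt_cat zs' ls.
  have gg : good t' g by rewrite uE in gz'; apply: goodl gz'.
  have tg : ptgt t' g = t by rewrite ptgt_rcons.
  have gh : good t h by rewrite -cat_rcons in gz; apply: goodl gz.
  have h0 : h != [::] by rewrite /h; case: (z).
  have g0 : g != [::] by rewrite /g; case: (z').
  (* If gh is nonzero it begins the resolution of I(s), and [chain_triple] compares its chain with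
     those of h and g. If gh = 0, then I(s) is projective and h is the exit of g. *)
  case: (boolP (nonzero_path (g ++ h))) => nz.
    have ggh : good t' (g ++ h) by rewrite good_cat // tg.
    have [|ss hss] := isch_ex harr hrel thr t'n ggh; first by case: (g) g0.
    have D : idata s t' (z' ++ l) ((g ++ h) :: ss) by split=> //; exists a; rewrite qE.
    have [|||le Hg] := chain_triple thr (ps := rps) t'n g0 h0 ggh (qs := qs) _ _ hss (j := j).
    - by rewrite tg.
    - by rewrite tg.
    - have [nj|le] := Hyp 0%N isT nc _ _ _ D; [left | right].
        by move: nj; rewrite /ivert inE negb_or => /andP[].
      rewrite sqs; split=> //; first by move: le; rewrite /= addn0.
      exists pi; rewrite tg /= /h cat_rcons; split=> //.
      + by apply: contra nz_p; rewrite /g cat_rcons el => /nz_catr.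
      + by rewrite ptgt_cat zs; case: hp.
      by case: (rps) hp => // p' rps' [_ _ [b1 b2] _]; split=> //; apply: contra b1; rewrite cat_rcons => /nz_catr.
    split; first by exists ((g ++ h) :: ss) => //; rewrite -sqs.
    by rewrite -sqs; apply: Hg; rewrite tg.
  split.
    exists [::] => //; split=> // a' as'; have -> : a' = a by apply: (proj1 nc); rewrite ?as'.
    by rewrite qE.
  exists (h :: qs); rewrite /= tg; split; [split | by rewrite sqs | by []] => //.
  split; rewrite ?tg // => y gy; apply/idP/idP => [bad|/prefixP[w ->]]; last first.
    by apply: contra nz; rewrite catA => /nz_catl.
  case/orP: (cmp_from thr tn ncc gh gy) => // /prefixP[w e].
  case/lastP: w e => [|w b] e; first by rewrite e cats0 prefix_refl.
  exfalso; move: e; rewrite /h -rcons_cat => /rcons_inj[e _].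
  by case/negP: bad; move: gz'; rewrite uE e catA => /goodl/andP[].
split.
  move=> _ s' u qs' D'; have [t' [z' [t'n gz' zs' lm']]] := lext_ex harr s2n gl.
  have [[qs'' D le] _] := step t' z' t'n gz' zs' lm'.
  by have [_ _ <-] := idata_uniq nc D D'.
by move=> t' z' t'n gz' zs' lm'; rewrite el /=; have [] := step t' z' t'n gz' zs' lm'.
Qed.

(** Starts [chain_main] at the left exit av, where all chains are empty because v is the longest
    path from j. If there is no left exit, then P(j) is I(t(v)) and v itself is the required
    data. *)
Lemma pdata_main j v ps : (j < n)%N -> ncr Q j -> pdata j v ps ->
  (forall i, (0 < i < size ps)%N -> ncr Q (nth 0%N (ptgt j v :: map fst ps) i) -> forall s' u qs,
     idata (nth 0%N (ptgt j v :: map fst ps) i) s' u qs -> j \notin ivert s' qs \/ (size qs <= i)%N) ->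
  (forall i, (0 < i <= size ps)%N -> ncr Q (nth 0%N (ptgt j v :: map fst ps) i) -> forall s' u qs,
     idata (nth 0%N (ptgt j v :: map fst ps) i) s' u qs -> (size qs <= i)%N) /\
  (ncr Q (last (ptgt j v) (map fst ps)) /\ exists s' u qs,
     [/\ idata (last (ptgt j v) (map fst ps)) s' u qs, size qs = size ps & iend s' qs = j]).
Proof.
move=> jn nc pd Hyp; have ncv := pdata_ncr jn nc pd; case: pd => gv rm.
case: ps Hyp => [|p ps] Hyp.
  move=> lm; split; first by case=> // i /andP[].
  split=> //; exists j, v, [::]; split=> //; split=> // a ae; apply/negP => nz.
  have /rm/prefixP[w] := good_rcons gv ae nz.
  by move/(congr1 size); rewrite size_cat size_rcons addSn -addnS -{1}[size v]addn0 => /eqP; rewrite eqn_add2l.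
move=> [a [aj ep nz hl]]; subst p; rewrite /= in hl Hyp *.
have ga : good (src a) (a :: v) by rewrite /good /= eqxx aj nz andbT; case/andP: gv.
have [|||R1 R2] := @chain_main ps (src a) a v [::] j (ltn_ord _) ga hl.
- by [].
- move=> t z tn gz zs lm; exists [::]; split=> //=; last by rewrite ptgt_rcons.
  move=> y; rewrite ptgt_rcons aj => /rm/prefixP[w ev]; rewrite cat_rcons.
  by move: gz; rewrite ev -cat_cons catA => /goodl/andP[].
- by move=> i ilt nci s' u qs D; apply: (Hyp i.+1 _ nci s' u qs D).
split; last by case: R2.
by move=> [|i] // ile nci s' u qs D; apply: R1 D.
Qed.

End LeftChains.

(** * Explicit resolutions of I(i) and coresolutions of P(j) *)

Section Explicit.
Variables (Q : monquiver) (K : fieldType).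
Local Notation n := (qn Q).
Local Notation m := (qm Q).
Local Notation src := (@qsrc Q).
Local Notation tgt := (@qtgt Q).
Local Notation qpath := (qpath Q).
Implicit Types (x y z u v w l : seq 'I_m) (s t j : nat) (a b c d : 'I_m) (S : pred nat) (r : qpath).

Hypothesis harr : forall a, (src a < tgt a)%N.
Hypothesis hrel : forall e, e \in qrels Q -> (2 <= size e)%N.

Local Notation PBs s := (PB Q (fun i => i == s)).
Local Notation IBs s := (IB Q (fun i => i == s)).
Local Notation Pm s := (pmod K (PBs s) (@pend Q) (@act_right Q)).
Local Notation Im S := (pmod K (IB Q S) (@pstart Q) (@act_dual Q)).

Lemma PBs_uniq S : uniq (PB Q S).
Proof. by have [] := PB_closed harr S. Qed.

Lemma PBsP s r : r \in PBs s -> [/\ r = (s, r.2), (s < n)%N & good s r.2].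
Proof. by case: r => t l; rewrite mem_PB // => /and3P[/eqP -> ? ?]. Qed.

Lemma PB_act S r r' a : r \in PB Q S -> act_right r a = Some r' -> r' \in PB Q S.
Proof.
case: r => s l; rewrite mem_PB // => /and3P[Ss sn g] /(act_right_some g)[-> _ g'].
by rewrite mem_PB // Ss sn.
Qed.

Lemma IB_act S r r' a : r \in IB Q S -> act_dual r a = Some r' -> r' \in IB Q S.
Proof.
case: r => s [|b l] // rI; rewrite /act_dual /=; case: eqP => // <- [<-].
by have [] := IB_tail harr rI.
Qed.

(** The three elementary maps on bases: [strip] is P(s) -> I(t(u)) with e_s sent to u^*, [prep] is
    left multiplication by u, and [cut] sends (wu)^* to w^*. *)
Definition strip u r : option qpath :=
  if prefix r.2 u then Some (pend r, drop (size r.2) u) else None.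
Definition prep s u r : option qpath :=
  if nonzero_path (u ++ r.2) then Some (s, u ++ r.2) else None.
Definition cut u r : option qpath :=
  if suffix u r.2 then Some (r.1, take (size r.2 - size u) r.2) else None.

Lemma stripP u r r' : strip u r = Some r' -> u = r.2 ++ r'.2 /\ r'.1 = pend r.
Proof. by rewrite /strip; case: ifP => // /prefixP[w ->] [<-]; rewrite /= drop_size_cat. Qed.

Lemma strip_cat s l w : strip (l ++ w) (s, l) = Some (ptgt s l, w).
Proof. by rewrite /strip /= prefix_prefix drop_size_cat. Qed.

Lemma cutP u r r' : cut u r = Some r' -> r.2 = r'.2 ++ u /\ r'.1 = r.1.
Proof. by rewrite /cut; case: ifP => // /suffixP[w ->] [<-]; rewrite /= size_cat addnK take_size_cat. Qed.

Lemma cut_cat t w u : cut u (t, w ++ u) = Some (t, w).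
Proof. by rewrite /cut /= suffix_suffix size_cat addnK take_size_cat. Qed.

Lemma strip_in s u S r r' : good s u -> S (ptgt s u) -> r \in PBs s -> strip u r = Some r' ->
  r' \in IB Q S /\ pstart r' = pend r.
Proof.
move=> gu Su /PBsP[er sn gr] /stripP[eu er1]; rewrite /pstart er1; split=> //.
case: r' eu er1 => t w /= eu ->; rewrite er /pend /= mem_IB // -ptgt_cat -eu Su ptgt_bound //=.
by rewrite eu in gu; apply: goodr gu.
Qed.

Lemma strip_hom s u S : good s u -> S (ptgt s u) -> @is_hom Q K (Pm s) (Im S) (pmx K (PBs s) (IB Q S) (strip u)).
Proof.
move=> gu Su; apply: pmx_hom; [exact: PBs_uniq | exact: IB_uniq | | exact: PB_act | ].
  by move=> r r'; apply: strip_in.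
move=> r a /PBsP[-> sn]; move: (r.2) => l {r} gl; rewrite /strip /act_right /=.
case: (boolP (prefix l u)) => /= [/prefixP[w eu]|npr]; last first.
  case: ifP => // _ /=; case: ifP => // /prefixP[w eu]; case/negP: npr.
  by rewrite eu cat_rcons prefix_prefix.
rewrite eu drop_size_cat // /act_dual /=; case: w eu => [|b w] eu.
  rewrite cats0; case: ifP => // _ /=; case: ifP => // /prefixP[w].
  by move/(congr1 size); rewrite size_cat size_rcons addSn -addnS -{1}[size l]addn0 => /eqP; rewrite eqn_add2l.
case: eqP => [e|ne].
  subst b; have : good s (rcons l a) by rewrite eu -cat_rcons in gu; apply: goodl gu.
  rewrite /good composable_rcons => /andP[/andP[_ /eqP <-] ->]; rewrite eqxx /=.
  by rewrite -cat_rcons prefix_prefix drop_size_cat // /pend /= ptgt_rcons.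
case: ifP => // _ /=; case: ifP => // /prefixP[w']; rewrite cat_rcons => /cat_injl[e].
by case: ne.
Qed.

Lemma prep_hom s u t : (s < n)%N -> good s u -> ptgt s u = t ->
  @is_hom Q K (Pm t) (Pm s) (pmx K (PBs t) (PBs s) (prep s u)).
Proof.
move=> sn gu ut; apply: pmx_hom; [exact: PBs_uniq | exact: PBs_uniq | | exact: PB_act | ].
  move=> r r' /PBsP[er tn gr]; rewrite /prep; case: ifP => // nz [<-]; rewrite mem_PB // eqxx sn.
  have -> : good s (u ++ r.2) by rewrite good_cat // ut.
  by split=> //; rewrite er /pend /= ptgt_cat ut.
move=> r a /PBsP[-> tn]; move: (r.2) => l {r} gl; rewrite /prep /act_right /=.
case: ifP => nz /=; rewrite ?ptgt_cat ?ut.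
  case: eqP => //= _; rewrite rcons_cat; case: (boolP (nonzero_path (rcons l a))) => nz' //=.
  by rewrite (negbTE (contra (@nz_catr _ u _) nz')).
case: ifP => //= _; rewrite -cats1 catA; case: ifP => // /nz_catl.
by rewrite nz.
Qed.

Lemma cut_in s u S S' r r' : good s u -> S' s -> r \in IB Q S -> ptgt s u = pend r -> cut u r = Some r' ->
  r' \in IB Q S' /\ pstart r' = pstart r.
Proof.
case: r r' => t l [t' w] gu S's rI ue /cutP[/= el ->]; split=> //.
move: rI ue; rewrite el !mem_IB // => /and3P[_ tn g] /= ue; rewrite tn (goodl g) !andbT.
by rewrite (start_suffix gu g).
Qed.

Lemma cut_hom s u S S' : good s u -> u != [::] -> S' s ->
  @is_hom Q K (Im S) (Im S') (pmx K (IB Q S) (IB Q S') (cut u)).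
Proof.
move=> gu u0 S's; apply: pmx_hom; [exact: IB_uniq | exact: IB_uniq | | exact: IB_act | ].
  move=> r r' rI e; apply: (cut_in gu S's rI _ e); have [er _] := cutP e; rewrite /pend er ptgt_cat.
  by case: (u) u0.
move=> [t l] a _; rewrite /cut /=; case: (boolP (suffix u l)) => /= [/suffixP[w el]|ns]; last first.
  case: l ns => // b l ns; rewrite /act_dual /=; case: eqP => //= _; case: ifP => // /suffixP[w e].
  by case/negP: ns; rewrite e -cat_cons suffix_suffix.
rewrite el size_cat addnK take_size_cat //; case: w el => [|b w] el.
  case: u u0 gu el {S's} => // b u _ _ el; rewrite /act_dual /=; case: eqP => //= _; case: ifP => // /suffixP[w].
  by move/(congr1 size); rewrite size_cat /= addnS -addSn => /addn_neq.
rewrite /act_dual /=; case: eqP => //= _.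
by rewrite suffix_suffix size_cat addnK take_size_cat.
Qed.

Lemma rad_PB s w : (s, w) \in PBs s -> w != [::] -> (dl K (PBs s) (s, w) <= rad (Pm s))%MS.
Proof.
case/lastP: w => // w a /PBsP[_ /= sn g] _.
have -> : dl K (PBs s) (s, rcons w a) = dl K (PBs s) (s, w) *m mX (Pm s) a.
  have wB : (s, w) \in PBs s by rewrite mem_PB // eqxx sn; rewrite -cats1 in g; rewrite (goodl g).
  have -> := @dl_mX Q K (PBs s) (@pend Q) (@act_right Q) (PBs_uniq _) _ a wB.
  rewrite /act_right /=; move: g; rewrite /good composable_rcons => /andP[/andP[_ /eqP ->] ->].
  by rewrite eqxx.
by apply: (submx_trans (submxMl _ _)); rewrite (sumsmx_sup a).
Qed.

Lemma Pm_mod s : is_module (Pm s). Proof. exact: rmod_mod (PB_closed harr _). Qed.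

Lemma Im_mod S : is_module (Im S). Proof. exact: lmod_mod. Qed.

Lemma hom_dim0 M N (f : 'M[K]_(mdim M, mdim N)) : mdim M = 0%N -> @is_hom Q K M N f.
Proof.
by move=> e; split=> i; apply/matrixP => k; exfalso; case: k => k; rewrite e.
Qed.

Lemma PBs0 s : (n <= s)%N -> size (PBs s) = 0%N.
Proof.
move=> le; case e: (PBs s) => [|r B] //; have /PBsP[_ sn _] : r \in PBs s by rewrite e mem_head.
by move: sn; rewrite ltnNge le.
Qed.

Lemma IBs0 s : (n <= s)%N -> size (IBs s) = 0%N.
Proof.
move=> le; case e: (IBs s) => [|[t l] B] //; have : (t, l) \in IBs s by rewrite e mem_head.
by rewrite mem_IB // => /and3P[/eqP e' tn _]; move: (ptgt_bound l tn); rewrite e' ltnNge le.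
Qed.

Section ChainPres.
(** An infinite sequence describes a finite resolution: the term is zero as soon as [vs k] is not
    below [n]. By [hu] and [hr] each kernel is generated by the next path, or is zero when there is
    none. *)
Variables (i : 'I_n) (vs : nat -> nat) (q : nat -> seq 'I_m) (u : seq 'I_m).
Hypothesis h0 : (vs 0 < n)%N.
Hypothesis gu : good (vs 0%N) u.
Hypothesis ui : ptgt (vs 0%N) u = i.
Hypothesis hi : forall t w, (t < n)%N -> good t w -> ptgt t w = i -> suffix w u.
Hypothesis hu : forall y, good (vs 0%N) y -> ~~ prefix y u = (vs 1 < n)%N && prefix (q 0) y.
Hypothesis hq : forall k, (vs k.+1 < n)%N ->
  [/\ (vs k < n)%N, good (vs k) (q k), q k != [::] & ptgt (vs k) (q k) = vs k.+1].
Hypothesis hr : forall k y, (vs k.+1 < n)%N -> good (vs k.+1) y ->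
  ~~ nonzero_path (q k ++ y) = (vs k.+2 < n)%N && prefix (q k.+1) y.

Definition chain_presol : presol (injmod K i) := @PResol Q K (injmod K i)
  (fun k => Pm (vs k)) (fun k => pmx K (PBs (vs k.+1)) (PBs (vs k)) (prep (vs k) (q k)))
  (pmx K (PBs (vs 0)) (IBs i) (strip u)).

Lemma prep_in k r r' : r \in PBs (vs k.+1) -> prep (vs k) (q k) r = Some r' ->
  [/\ r' = (vs k, q k ++ r.2), r' \in PBs (vs k) & (vs k.+1 < n)%N].
Proof.
move=> /PBsP[_ sn gr]; rewrite /prep; case: ifP => // nz [<-]; have [kn gq _ e] := hq sn.
by split=> //; rewrite mem_PB // eqxx kn good_cat ?e.
Qed.

Lemma prep_inj k r1 r2 r' : r1 \in PBs (vs k.+1) -> r2 \in PBs (vs k.+1) ->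
  prep (vs k) (q k) r1 = Some r' -> prep (vs k) (q k) r2 = Some r' -> r1 = r2.
Proof.
move=> B1 B2 e1 e2; have [E1 _ _] := prep_in B1 e1; have [E2 _ _] := prep_in B2 e2.
have [e] : (vs k, q k ++ r1.2) = (vs k, q k ++ r2.2) by rewrite -E1 -E2.
have [-> _ _] := PBsP B1; have [-> _ _] := PBsP B2.
by rewrite (cat_injl e).
Qed.

Lemma prep_out k s y : (vs k.+1 < n)%N -> (s, q k ++ y) \in PBs (vs k) ->
  (vs k.+1, y) \in PBs (vs k.+1) /\ prep (vs k) (q k) (vs k.+1, y) = Some (s, q k ++ y).
Proof.
move=> sn; rewrite mem_PB // => /and3P[/eqP -> kn g]; have [_ _ _ e] := hq sn; split.
  by rewrite mem_PB // eqxx sn -e (goodr g).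
by rewrite /prep /=; case/andP: g => _ ->.
Qed.

Lemma chain_presolP : is_presol chain_presol.
Proof.
have uP := PBs_uniq; have uI := IB_uniq Q.
split=> [k|||/=|k /=].
- by split; [exact: Pm_mod | exact: PB_proj].
- split; first by apply: strip_hom; rewrite ?ui.
  move=> k /=; case: (ltnP (vs k.+1) n) => kn; last by apply: hom_dim0; rewrite /= PBs0.
  by have [? ? _ ?] := hq kn; apply: prep_hom.
- apply: (@pmx_full Q K (PBs (vs 0%N)) (IBs i) (strip u)) => // -[t w]; rewrite mem_IB // => /and3P[/eqP wi tn gw].
  have /suffixP[y eu] := hi tn gw wi; have gu' := gu; rewrite eu in gu'.
  exists (vs 0%N, y); first by rewrite mem_PB // eqxx h0 (goodl gu').
  rewrite eu strip_cat; congr (Some (_, _)).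
  by apply: start_suffix gw gu' _; rewrite -eu ui wi.
- apply: (@pmx_exact Q K (PBs (vs 1%N)) (PBs (vs 0%N)) (IBs i) (prep (vs 0%N) (q 0%N)) (strip u)) => //.
  + move=> r r' rB e; have [-> rP v1] := prep_in rB e; split=> //.
    have [_ _ g] := PBsP rP; rewrite /strip /=.
    by case: ifP => // /negPn; rewrite hu ?v1 ?prefix_prefix // -[_ ++ _]/((vs 0%N, q 0%N ++ r.2).2).
  + move=> [s y] yB; have [[->] _ gy] := PBsP yB; rewrite /strip; case: ifP => //= npr _.
    have : ~~ prefix y u by rewrite npr.
    rewrite hu // => /andP[v1 /prefixP[y' ey]]; move: yB; rewrite ey => yB.
    by have [h1 h2] := prep_out v1 yB; exists (vs 1%N, y') => //; rewrite h2; case/PBsP: yB => [[->]].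
  + by move=> r r' rB e; have [] := strip_in (S := fun j => j == i) gu _ rB e; rewrite ?ui.
  move=> r1 r2 r' /PBsP[e1 _ _] /PBsP[e2 _ _] /stripP[E1 _] /stripP[E2 _].
  by rewrite e1 e2 (@cat_injr _ r'.2 r1.2 r2.2) // -E1 -E2.
apply: pmx_exact => //.
- move=> r r' rB e; have [-> rP v1] := prep_in rB e; split=> //.
  have [_ v2 g] := PBsP rP; rewrite /prep /=.
  by case: ifP => // nz; have := hr v2 g; rewrite nz v1 prefix_prefix.
- move=> [s y] yB; have [[es] v1 gy] := PBsP yB; rewrite /prep; case: ifP => //= npr _.
  have : ~~ nonzero_path (q k ++ y) by rewrite npr.
  rewrite hr // => /andP[v2 /prefixP[y' ey]]; move: yB; rewrite ey => yB.
  by have [h1 h2] := prep_out v2 yB; exists (vs k.+2, y').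
- by move=> r r' rB e; have [] := prep_in rB e.
exact: prep_inj.
Qed.

Lemma rd_rad k : (rd chain_presol k <= rad (rP chain_presol k))%MS.
Proof.
apply: dl_sub => [|r rB]; first exact: PBs_uniq.
rewrite dl_pmx ?PBs_uniq //; case e: (prep _ _ r) => [r'|] /=; last exact: sub0mx.
have [er rP v1] := prep_in rB e; have [_ _ q0 _] := hq v1; rewrite er in rP *.
by apply: rad_PB rP _; case: (q k) q0.
Qed.

Lemma chain_presol_min : minimal_presol chain_presol.
Proof.
have HR := chain_presolP; have [_ _ _ /eqmxP e0 ek] := HR.
split=> //; split=> [|k]; apply: sup_of_rad => //; try exact: Pm_mod.
  by rewrite -e0; apply: rd_rad.
by rewrite -(eqmxP (ek k)); apply: rd_rad.
Qed.

End ChainPres.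

Section ChainIcores.
Variables (j : 'I_n) (xs : nat -> nat) (p : nat -> seq 'I_m) (v : seq 'I_m).
Hypothesis h0 : (xs 0 < n)%N.
Hypothesis gv : good j v.
Hypothesis vx : ptgt j v = xs 0%N.
Hypothesis hj : forall y, good j y -> prefix y v.
Hypothesis hu : forall t w, (t < n)%N -> good t w -> ptgt t w = xs 0%N ->
  ~~ suffix w v = (xs 1 < n)%N && suffix (p 0) w.
Hypothesis hq : forall k, (xs k.+1 < n)%N ->
  [/\ (xs k < n)%N, good (xs k.+1) (p k), p k != [::] & ptgt (xs k.+1) (p k) = xs k].
Hypothesis hr : forall k t w, (xs k.+1 < n)%N -> (t < n)%N -> good t w -> ptgt t w = xs k.+1 ->
  ~~ nonzero_path (w ++ p k) = (xs k.+2 < n)%N && suffix (p k.+1) w.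

(** The guard makes the differential zero once its target is zero; there [p k] carries no
    information. *)
Definition cutn k := if (xs k.+1 < n)%N then cut (p k) else fun _ => None.

Definition chain_icoresol : icoresol (projmod K j) := @ICoresol Q K (projmod K j)
  (fun k => Im (fun i => i == xs k)) (fun k => pmx K (IBs (xs k)) (IBs (xs k.+1)) (cutn k))
  (pmx K (PBs j) (IBs (xs 0)) (strip v)).

Lemma pmx_None (B B' : seq qpath) : pmx K B B' (fun _ => None) = 0.
Proof. by apply/matrixP => a b; rewrite !mxE. Qed.

Lemma cutn_in k r r' : r \in IBs (xs k) -> cutn k r = Some r' ->
  [/\ r = (r'.1, r'.2 ++ p k), r' \in IBs (xs k.+1) & (xs k.+1 < n)%N].
Proof.
move=> rI; rewrite /cutn; case: ifP => // xn e; have [_ gp _ pe] := hq xn.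
have [e2 e1] := cutP e; split=> //; first by case: r rI e e2 e1 => ? ? /= _ _ -> ->.
apply: (proj1 (@cut_in _ _ _ (fun i => i == xs k.+1) _ _ gp (eqxx _) rI _ e)).
by case: r rI {e e2 e1} => t l; rewrite mem_IB // => /and3P[/eqP el _ _]; rewrite pe /pend /= el.
Qed.

Lemma cutn_out k t w : (xs k.+1 < n)%N -> (t, w) \in IBs (xs k.+1) -> nonzero_path (w ++ p k) ->
  (t, w ++ p k) \in IBs (xs k) /\ cutn k (t, w ++ p k) = Some (t, w).
Proof.
move=> xn; rewrite !mem_IB // => /and3P[/eqP we tn gw] nz; have [_ gp _ pe] := hq xn.
by rewrite ptgt_cat we pe eqxx tn good_cat ?we // /cutn xn cut_cat.
Qed.

Lemma chain_icoresol_min : minimal_icoresol chain_icoresol.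
Proof.
have uP := PBs_uniq; have uI := IB_uniq Q.
have jI r r' : r \in PBs j -> strip v r = Some r' -> r' \in IBs (xs 0%N).
  by move=> rB e; have [] := strip_in (S := fun i => i == xs 0%N) gv _ rB e; rewrite ?vx.
have sinj r1 r2 r' : r1 \in PBs j -> r2 \in PBs j -> strip v r1 = Some r' -> strip v r2 = Some r' -> r1 = r2.
  move=> /PBsP[e1 _ _] /PBsP[e2 _ _] /stripP[E1 _] /stripP[E2 _].
  by rewrite e1 e2 (@cat_injr _ r'.2 r1.2 r2.2) // -E1 -E2.
have soc k (U : 'M[K]_(_, size (IBs (xs k)))) : ((xs k < n)%N -> (dl K (IBs (xs k)) (xs k, [::]) <= U)%MS) ->
    essential (M := Im (fun i => i == xs k)) U.
  move=> H; apply: ess_of_soc => //; first exact: Im_mod.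
  move=> i x xs_; case: (ltnP (xs k) n) => xn; last first.
    rewrite (_ : x = 0) ?sub0mx //; apply/matrixP => i1 i2; exfalso; case: i2 => i2 /=.
    by rewrite IBs0.
  have [c ->] := @soc_injmod Q K harr (Ordinal xn) i x xs_.
  by apply: scalemx_sub; apply: H.
split=> [k||||].
- by split; [exact: Im_mod | exact: IB_inj].
- split; first by apply: strip_hom; rewrite ?vx.
  move=> k /=; rewrite /cutn; case: ifP => xn; last by rewrite pmx_None; apply: hom_zero.
  by have [_ gp p0 _] := hq xn; apply: cut_hom gp p0 _.
- apply: (@pmx_free Q K (PBs j) (IBs (xs 0%N)) (strip v)) => // r rB; have [er jn gr] := PBsP rB; have /prefixP[w ev] := hj gr.
  have e : strip v r = Some (pend r, w) by rewrite er ev strip_cat.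
  by exists (pend r, w) => //; apply: jI e.
- split=> [|k]; [apply: (@pmx_exact Q K (PBs j) (IBs (xs 0%N)) (IBs (xs 1%N)) (strip v) (cutn 0)) => // | apply: pmx_exact => //].
  + move=> r r' rB e; have rI := jI _ _ rB e; split=> //; rewrite /cutn; case: ifP => // xn.
    rewrite /cut; case: ifP => // sf; exfalso; have [ev _] := stripP e.
    case: r' rI e sf ev => t w; rewrite mem_IB // => /and3P[/eqP wx tn gw] _ /= sf ev.
    by have := hu tn gw wx; rewrite xn sf ev suffix_suffix.
  + move=> [t w] tI; have := tI; rewrite mem_IB // => /and3P[/eqP wx tn gw] cn.
    have /negbFE/suffixP[y ev] : ~~ suffix w v = false.
      rewrite (hu tn gw wx); move: cn; rewrite /cutn /cut; case: ifP => //= _.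
      by case: ifP.
    have gv' := gv; rewrite ev in gv'.
    exists (j : nat, y); first by rewrite mem_PB // eqxx ltn_ord (goodl gv').
    by rewrite ev strip_cat; congr (Some (_, _)); apply: start_suffix gw gv' _; rewrite -ev vx wx.
  + by move=> r r' rI e; have [] := cutn_in rI e.
  + by move=> r1 r2 r' B1 B2 e1 e2; have [-> _ _] := cutn_in B1 e1; have [-> _ _] := cutn_in B2 e2.
  + move=> r r' rI e; have [er r'I xn] := cutn_in rI e; split=> //.
    rewrite /cutn; case: ifP => // xn2; rewrite /cut; case: ifP => // sf; exfalso.
    case: r' er r'I sf {e} => t w /= er; rewrite mem_IB // => /and3P[/eqP wx tn gw] sf.
    have := hr xn tn gw wx; rewrite xn2 sf /=; move: rI; rewrite er mem_IB // => /and3P[_ _ /andP[_ ->]].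
    by [].
  + move=> [t w] tI; have := tI; rewrite mem_IB // => /and3P[/eqP wx tn gw] cn.
    have xn : (xs k.+1 < n)%N by rewrite -wx ptgt_bound.
    have nz : nonzero_path (w ++ p k).
      apply: negbFE; rewrite (hr xn tn gw wx); move: cn; rewrite /cutn /cut; case: ifP => //= _.
      by case: ifP.
    by have [h1 h2] := cutn_out xn tI nz; exists (t, w ++ p k).
  + by move=> r r' rI e; have [] := cutn_in rI e.
  + by move=> r1 r2 r' B1 B2 e1 e2; have [-> _ _] := cutn_in B1 e1; have [-> _ _] := cutn_in B2 e2.
split=> [|k]; apply: soc => xn.
  have vB : (j : nat, v) \in PBs j by rewrite mem_PB // eqxx ltn_ord.
  have -> : dl K (IBs (xs 0%N)) (xs 0%N, [::]) = dl K (PBs j) (j : nat, v) *m ceta chain_icoresol.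
    by rewrite dl_pmx // -{1}[v]cats0 strip_cat vx.
  exact: submxMl.
have [kn gp _ pe] := hq xn.
have tI : (xs k.+1, [::]) \in IBs (xs k.+1) by rewrite mem_IB // eqxx xn good_nil.
have nz : nonzero_path ([::] ++ p k) by case/andP: gp.
have [h1 h2] := cutn_out xn tI nz.
have -> : dl K (IBs (xs k.+1)) (xs k.+1, [::]) = dl K (IBs (xs k)) (xs k.+1, [::] ++ p k) *m cd chain_icoresol k.
  by rewrite dl_pmx // h2.
exact: submxMl.
Qed.

End ChainIcores.

End Explicit.

(** * Resolutions and coresolutions attached to chains of exits *)

Section Threads.
Variables (Q : monquiver) (K : fieldType).
Local Notation n := (qn Q).
Local Notation m := (qm Q).
Local Notation src := (@qsrc Q).
Local Notation tgt := (@qtgt Q).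
Local Notation qpath := (qpath Q).
Implicit Types (y z u v w l q r : seq 'I_m) (s t : nat) (i j : 'I_n) (a b c d : 'I_m) (S : pred nat)
  (qs : seq (seq 'I_m)) (ps : seq qpath).

Hypothesis harr : forall a, (src a < tgt a)%N.
Hypothesis hrel : forall e, e \in qrels Q -> (2 <= size e)%N.
Hypothesis thr : threaded Q.

Local Notation PBs s := (PB Q (fun o => o == s)).
Local Notation IBs s := (IB Q (fun o => o == s)).
Local Notation Pm s := (pmod K (PBs s) (@pend Q) (@act_right Q)).
Local Notation Im S := (pmod K (IB Q S) (@pstart Q) (@act_dual Q)).

Lemma size_cvert s q qs : size (cvert s q qs) = (size qs).+1.
Proof. by elim: qs s q => //= r qs IH s q; rewrite IH. Qed.

Lemma nth_bound (V : seq nat) k : all (fun x => x < n)%N V -> (nth n V k < n)%N = (k < size V)%N.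
Proof.
move=> /allP H; case: (ltnP k (size V)) => kV; first by rewrite H ?mem_nth.
by rewrite nth_default ?ltnn.
Qed.

Lemma cvert_bound s q qs : (s < n)%N -> all (fun x => x < n)%N (cvert s q qs).
Proof. by elim: qs s q => [|r qs IH] s q sn /=; rewrite ptgt_bound //= IH // ptgt_bound. Qed.

Lemma isch_nth s q qs k : (s < n)%N -> good s q -> q != [::] -> isch s q qs -> (k < (size qs).+1)%N ->
  [/\ good (nth n (s :: cvert s q qs) k) (nth [::] (q :: qs) k), nth [::] (q :: qs) k != [::],
      ptgt (nth n (s :: cvert s q qs) k) (nth [::] (q :: qs) k) = nth n (cvert s q qs) k &
      forall y, good (nth n (cvert s q qs) k) y ->
        ~~ nonzero_path (nth [::] (q :: qs) k ++ y) = (k < size qs)%N && prefix (nth [::] qs k) y].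
Proof.
elim: qs s q k => [|r qs IH] s q [|k] //= sn gq q0.
  by move=> H _; split=> // y /H ->.
- by move=> [[gr r0 H] _] _; split.
move=> [[gr r0 _] h] kq; exact: (IH _ r k (ptgt_bound _ sn) gr r0 h kq).
Qed.

Lemma lch_nth s p ps k : (s < n)%N -> good s p -> p != [::] -> lch s p ps -> (k < (size ps).+1)%N ->
  [/\ good (nth n (s :: map fst ps) k) (nth [::] (p :: map snd ps) k), nth [::] (p :: map snd ps) k != [::],
      (nth n (s :: map fst ps) k < n)%N,
      forall k', k = k'.+1 -> ptgt (nth n (s :: map fst ps) k) (nth [::] (p :: map snd ps) k) = nth n (s :: map fst ps) k' &
      forall t w, (t < n)%N -> good t w -> ptgt t w = nth n (s :: map fst ps) k ->
        ~~ nonzero_path (w ++ nth [::] (p :: map snd ps) k) = (k < size ps)%N && suffix (nth [::] (map snd ps) k) w].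
Proof.
elim: ps s p k => [|[s' l] ps IH] s p [|k] //= sn gp p0.
  by move=> H _; split=> // t w tn gw e; rewrite (H t w).
- by move=> [[_ _ _ _ H] _] _; split.
move=> [[s'n gl ls l0 _] h] kp; have [h1 h2 h3 h4 h5] := IH s' l k s'n gl l0 h kp; split=> //.
by move=> k' [<-]; case: k kp h4 {h1 h2 h3 h5} => [|k] kp h4 //=; rewrite (h4 k).
Qed.

Lemma idata_start i s u qs : ncr Q i -> idata i s u qs -> ncr Q s.
Proof.
move=> nc [sn gu us lm _]; case: u gu us lm => [|a u] gu us lm; last exact: (lmax_ncr hrel thr sn gu isT lm).
by rewrite -[s]/(@ptgt Q s [::]) us.
Qed.

Lemma ivert_bound i s u qs : idata i s u qs -> all (fun x => x < n)%N (ivert s qs).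
Proof. by case=> sn _ _ _ _; rewrite /ivert /= sn; case: qs => //= q qs; apply: cvert_bound. Qed.

Lemma size_ivert s qs : size (ivert s qs) = (size qs).+1.
Proof. by case: qs => //= q qs; rewrite size_cvert. Qed.

Lemma nth_iend s qs : nth n (ivert s qs) (size qs) = iend s qs.
Proof. by case: qs => //= q qs; elim: qs s q => //= r qs IH s q; apply: IH. Qed.

(** At a non-crossing i all paths into i are suffixes of u, so P(s) maps onto I(i); the kernel is
    generated by ua, and exits give the rest. The default [n] of [nth] makes all later terms
    zero. *)
Lemma inj_chain i s u qs : ncr Q i -> idata i s u qs ->
  exists R : presol (injmod K i), minimal_presol R /\ forall k, rP R k = Pm (nth n (ivert s qs) k).
Proof.
move=> nc D; have ncs := idata_start nc D; have Vb := ivert_bound D.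
have [sn gu us lm H] := D.
have nb k : (nth n (ivert s qs) k < n)%N = (k < (size qs).+1)%N by rewrite nth_bound // size_ivert.
exists (@chain_presol Q K i (nth n (ivert s qs)) (nth [::] qs) u); split=> //.
apply: chain_presol_min => //.
- move=> t w tn gw wi; case/orP: (cmp_into thr tn sn nc gw gu wi us) => // /suffixP[w' e].
  have e0 : w' = [::] by apply: (lmax_suffix lm gu (s' := t)); rewrite -?e //; apply: start_suffix gu _ _; rewrite -e ?us ?wi.
  by rewrite e e0 suffix_refl.
- move=> y gy0; have {gy0} gy : good s y := gy0; rewrite nb ltnS /=; case/orP: (cmp_from thr sn ncs gy gu) => [pr|/prefixP[w e]].
    rewrite pr /=; apply/esym; case: qs H {D Vb nb} => //= q qs [a [_ -> _ _]]; apply/negP => pr'.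
    have /prefixP[w] := prefix_trans pr' pr.
    by move/(congr1 size); rewrite size_cat size_rcons addSn -addnS -{1}[size u]addn0 => /eqP; rewrite eqn_add2l.
  case: w e => [|b w] e; first by rewrite e cats0 prefix_refl; case: qs H {D Vb nb} => //= q qs [a [_ -> _ _]]; apply/esym/negP => /prefixP[w];
    move/(congr1 size); rewrite size_cat size_rcons addSn -addnS -{1}[size u]addn0 => /eqP; rewrite eqn_add2l.
  have -> : prefix y u = false.
    apply/negP => /prefixP[w'] /(congr1 size); rewrite e !size_cat /= -addnA -{1}[size u]addn0 => /eqP.
    by rewrite eqn_add2l addSn.
  have gb : good s (rcons u b) by rewrite e -cat_rcons in gy; apply: goodl gy.
  have bi : src b = i :> nat by move: gb; rewrite /good composable_rcons us => /andP[/andP[_ /eqP]].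
  case: qs H {D Vb nb} => [|q qs] /=; first by move/(_ b bi); case/andP: gb => _ ->.
  move=> [a [ai -> _ _]]; have -> : a = b by apply: (proj1 nc); rewrite ?ai ?bi.
  by rewrite e -cat_rcons prefix_prefix.
- move=> k; rewrite !nb ltnS => kq; rewrite ltnW ?ltnS //.
  case: qs H kq {D Vb nb} => // q qs [a [ai -> nz h]] kq.
  have g : good s (rcons u a) by apply: good_rcons; rewrite ?us ?ai.
  have [|h1 h2 h3 _] := isch_nth sn g _ h kq; first by case: (u).
  by split.
move=> k y; rewrite !nb !ltnS => kq.
case: qs H kq {D Vb nb} => // q qs [a [ai -> nz h]] kq.
have g : good s (rcons u a) by apply: good_rcons; rewrite ?us ?ai.
have [|_ _ _ h4] := isch_nth sn g _ h kq; first by case: (u).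
exact: h4.
Qed.

(** Dually, all paths from j are prefixes of v, so P(j) embeds in I(t(v)), and left exits describe
    the successive cokernels. *)
Lemma proj_chain j v ps : ncr Q j -> pdata j v ps ->
  exists C : icoresol (projmod K j), minimal_icoresol C /\
    forall k, cI C k = Im (fun o => o == nth n (ptgt j v :: map fst ps) k).
Proof.
move=> nc D; have ncv := pdata_ncr hrel thr (ltn_ord j) nc D; have [gv hv H] := D.
have vn : (ptgt j v < n)%N by apply: ptgt_bound.
have Vb : all (fun x => x < n)%N (ptgt j v :: map fst ps).
  rewrite /= vn; case: ps H {D} => //= p ps [a [_ -> _ /= h]]; rewrite ltn_ord /=.
  elim: ps (src a : nat) (a :: v) h => //= r ps IH s q [[rn _ _ _ _] h]; rewrite rn; exact: IH h.
have nb k : (nth n (ptgt j v :: map fst ps) k < n)%N = (k < (size ps).+1)%N by rewrite nth_bound //= size_map.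
exists (@chain_icoresol Q K j (nth n (ptgt j v :: map fst ps)) (nth [::] (map snd ps)) v); split=> //.
have Hps : forall k, (k < size ps)%N -> exists a ps', [/\ tgt a = j :> nat, ps = (src a : nat, a :: v) :: ps',
    good (src a) (a :: v) & lch (src a) (a :: v) ps'].
  case: ps H {D Vb nb} => // p ps [a [aj -> nz h]] _ _; exists a, ps; split=> //.
  by rewrite /good /= eqxx aj nz andbT; case/andP: gv.
apply: chain_icoresol_min => //.
- move=> t w tn gw wx0; have {wx0} wx : ptgt t w = ptgt j v := wx0; rewrite nb ltnS; case/orP: (cmp_into thr tn (ltn_ord j) ncv gw gv wx erefl) => [sf|/suffixP[w' e]].
    rewrite sf /=; apply/esym; case: ps H {D Vb nb Hps} => //= p ps [a [_ -> _ _]]; apply/negP => sf'.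
    have /suffixP[w'] := suffix_trans sf' sf.
    by move/(congr1 size); rewrite size_cat /= addnS -addSn => /addn_neq.
  case/lastP: w' e => [|w' b] e.
    rewrite e suffix_refl; case: ps H {D Vb nb Hps} => //= p ps [a [_ -> _ _]]; apply/esym/negP => /suffixP[w'].
    by move/(congr1 size); rewrite size_cat /= addnS -addSn => /addn_neq.
  have -> : suffix w v = false.
    by apply/negP => /suffixP[w2] /(congr1 size); rewrite e !size_cat size_rcons addnA addnS addSn -addSn => /addn_neq.
  have bj : tgt b = j :> nat.
    by rewrite -(ptgt_rcons t w' b); apply: start_suffix gv _ _; rewrite -e ?wx.
  have nzb : nonzero_path (b :: v) by move: gw; rewrite e cat_rcons => /andP[_ /nz_catr].
  case: ps H {D Vb nb Hps} => [|p ps] /=; first by move/(_ b bj); rewrite nzb.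
  move=> [a [aj -> _ _]]; have -> : a = b by apply: (proj2 nc); rewrite ?aj ?bj.
  by rewrite e cat_rcons suffix_suffix.
- move=> k; rewrite !nb ltnS => kp; rewrite ltnW ?ltnS //.
  have [a [ps' [aj eps ga h]]] := Hps k kp; rewrite eps /= in kp *.
  have [h1 h2 h3 h4 _] := lch_nth (ltn_ord _) ga isT h kp; split=> //.
  by case: k kp h4 {h1 h2 h3} => [|k] kp h4 /=; [rewrite ptgt_cons aj | exact: h4].
move=> k t w; rewrite !nb !ltnS => kp tn gw wx.
have [a [ps' [aj eps ga h]]] := Hps k kp; rewrite eps /= in kp wx *.
have [_ _ _ _ h5] := lch_nth (ltn_ord _) ga isT h kp; exact: (h5 t w tn gw wx).
Qed.

Lemma inj_chain_pdim i s u qs : ncr Q i -> idata i s u qs -> pdim_le (injmod K i) (size qs).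
Proof.
move=> nc D; have [R [[RP _] e]] := inj_chain nc D; exists R; split=> // k kq.
by rewrite e /= PBs0 // nth_default ?size_ivert.
Qed.

Lemma inj_chain_min i s u qs (d : nat) (I : finType) (N : I -> amod Q K) : ncr Q i -> idata i s u qs ->
  (forall k, is_module (N k)) -> retract_of (injmod K i) N -> (forall k, pdim_le (N k) d) -> (size qs <= d)%N.
Proof.
move=> nc D Nm r pd; have [R [mR e]] := inj_chain nc D; rewrite leqNgt; apply/negP => dq.
have := pdim_minimal (injmod_mod K harr i) Nm mR r pd dq; rewrite e /= => s0.
have vn : (nth n (ivert s qs) (size qs) < n)%N by rewrite nth_bound ?size_ivert //; apply: ivert_bound D.
have : (nth n (ivert s qs) (size qs), [::]) \in PBs (nth n (ivert s qs) (size qs)) by rewrite mem_PB // eqxx vn good_nil.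
by rewrite (size0nil s0).
Qed.

Lemma ncr_ar_perm i s u qs j : ncr Q i -> idata i s u qs -> iend s qs = j -> ar_perm_rel K i j.
Proof.
move=> nc D ej d [pd pm] R' mR'.
have -> : d = size qs.
  apply/eqP; rewrite eqn_leq; apply/andP; split; first by apply: pm; apply: inj_chain_pdim nc D.
  exact: (inj_chain_min nc D (fun=> injmod_mod K harr i) (retract_id _) (fun=> pd)).
have [R [mR e]] := inj_chain nc D.
by have := min_iso (size qs) (injmod_mod K harr i) mR' mR; rewrite e nth_iend ej.
Qed.

End Threads.

(** * The exact sequence at a crossing *)

(** [h] and [l] are merely linear; exactness is thereby reduced to three matrix identities. *)
Lemma split_exact (K : fieldType) a b c (g : 'M[K]_(a, b)) h (f : 'M[K]_(b, c)) l :
  g *m h = 1%:M -> l *m f = 1%:M -> f *m l + h *m g = 1%:M ->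
  [/\ row_free g, row_full f & (g == kermx f)%MS].
Proof.
move=> gh lf e; have gf : g *m f = 0.
  have gfl : g *m f *m l = 0.
    have : g *m (f *m l + h *m g) = g by rewrite e mulmx1.
    rewrite mulmxDr !mulmxA gh mul1mx => /eqP; rewrite -subr_eq0 addrK => /eqP //.
  by rewrite -[g *m f]mulmx1 -lf mulmxA gfl mul0mx.
split; [by apply/row_freeP; exists h | by apply/row_fullP; exists l | apply/andP; split].
  by apply/sub_kermxP.
rewrite -[kermx f]mulmx1 -e mulmxDr !mulmxA mulmx_ker mul0mx add0r.
exact: submxMl.
Qed.

Section Sequence.
Variables (Q : monquiver) (K : fieldType) (P J I : amod Q K).
Variables (g : 'M[K]_(mdim P, mdim J)) (f : 'M[K]_(mdim J, mdim I)).
Hypothesis harr : forall a, (@qsrc Q a < @qtgt Q a)%N.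
Hypotheses (gh : is_hom g) (fh : is_hom f) (gf : row_free g) (ff : row_full f) (gk : (g == kermx f)%MS).

Definition ses_presol : presol I := @PResol Q K I
  (fun k => if k is k'.+1 then (if k' is _.+1 then zero_mod Q K else P) else J)
  (fun k => if k is k'.+1 return
     'M[K]_(mdim (if k is _.+1 then zero_mod Q K else P),
            mdim (if k is k'.+1 then (if k' is _.+1 then zero_mod Q K else P) else J)) then 0 else g) f.

Lemma kermx_free a b (A : 'M[K]_(a, b)) : row_free A -> kermx A = 0.
Proof. by rewrite -kermx_eq0 => /eqP. Qed.

Lemma ses_presol_min : is_module P -> projective P -> is_module J -> projective J -> (g <= rad J)%MS -> minimal_presol ses_presol.
Proof.
have z0 : mdim (zero_mod Q K) = 0%N by [].
move=> Pm Pp Jm Jp gr; split; last split.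
- split=> //.
  + move=> [|[|k]] //=; split; [exact: zero_is_module | exact: zero_projective].
  + split=> // -[|k] //=; exact: hom_zero.
  move=> [|k] /=; first by rewrite kermx_free //; apply/andP; rewrite !sub0mx.
  by apply/andP; split; [apply: sub0mx | rewrite [kermx _]flatmx0 sub0mx].
- by apply: sup_of_rad => //; rewrite -(eqmxP gk).
move=> [|k] /=; first by rewrite kermx_free // => k' V _; rewrite adds0mx.
by rewrite [kermx _]flatmx0 => k' V _; rewrite adds0mx.
Qed.

Definition ses_icoresol : icoresol P := @ICoresol Q K P
  (fun k => if k is k'.+1 then (if k' is _.+1 then zero_mod Q K else I) else J)
  (fun k => if k is k'.+1 return
     'M[K]_(mdim (if k is k'.+1 then (if k' is _.+1 then zero_mod Q K else I) else J),
            mdim (if k is _.+1 then zero_mod Q K else I)) then 0 else f) g.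

Lemma ses_icoresolP : is_module I -> Defs.injective I -> is_module J -> Defs.injective J -> is_icoresol ses_icoresol.
Proof.
have z0 : mdim (zero_mod Q K) = 0%N by [].
move=> Im Ii Jm Ji; split=> //.
- move=> [|[|k]] //=; split; [exact: zero_is_module | exact: zero_injective].
- split=> // -[|k] //=; exact: hom_zero.
split=> // -[|k] /=.
  by apply/andP; split; [apply/sub_kermxP; rewrite mulmx0 | apply: submx_full].
by apply/andP; split; rewrite ?sub0mx // [kermx _]flatmx0 sub0mx.
Qed.

End Sequence.

Section Crossing.
Variables (Q : monquiver) (K : fieldType).
Local Notation n := (qn Q).
Local Notation m := (qm Q).
Local Notation src := (@qsrc Q).
Local Notation tgt := (@qtgt Q).
Local Notation qpath := (qpath Q).
Implicit Types (y z u v w l : seq 'I_m) (s t : nat) (k : 'I_n) (a b c d : 'I_m) (S : pred nat).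

Hypothesis harr : forall a, (src a < tgt a)%N.
Hypothesis hrel : forall e, e \in qrels Q -> (2 <= size e)%N.

Local Notation PBs s := (PB Q (fun o => o == s)).
Local Notation IBs s := (IB Q (fun o => o == s)).
Local Notation Pm s := (pmod K (PBs s) (@pend Q) (@act_right Q)).
Local Notation Im S := (pmod K (IB Q S) (@pstart Q) (@act_dual Q)).

(** A partition of the basis respected by the arrows is a direct sum decomposition. *)
Lemma pmod_split (B : seq qpath) vert act (I : finType) (e : I -> pred qpath) : uniq B ->
  (forall r r' a, r \in B -> act r a = Some r' -> r' \in B) ->
  (forall r, r \in B -> exists2 i, e i r & forall i', e i' r -> i' = i) ->
  (forall i r r' a, r \in B -> act r a = Some r' -> e i r' = e i r) ->
  retract_of (pmod K B vert act) (fun i => pmod K [seq r <- B | e i r] vert act) /\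
  forall i, retract_of (pmod K [seq r <- B | e i r] vert act) (fun _ : 'I_1 => pmod K B vert act).
Proof.
move=> uB aB ex ea; have uF i : uniq [seq r <- B | e i r] by apply: filter_uniq.
pose f i := pmx K B [seq r <- B | e i r] (fun r => if e i r then Some r else None).
pose g i := pmx K [seq r <- B | e i r] B Some.
have fh i : @is_hom Q K (pmod K B vert act) (pmod K [seq r <- B | e i r] vert act) (f i).
  apply: pmx_hom => //; first by move=> r r' rB; case: ifP => // er [<-]; rewrite mem_filter er.
  move=> r a rB; case E: (act r a) => [r'|] /=; first by rewrite (ea i r r' a) //; case: ifP => //= _; rewrite E.
  by case: ifP => //= _; rewrite E.
have gh i : @is_hom Q K (pmod K [seq r <- B | e i r] vert act) (pmod K B vert act) (g i).
  apply: pmx_hom => //; first by move=> r r'; rewrite mem_filter => /andP[_ rB] [<-].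
    by move=> r r' a; rewrite !mem_filter => /andP[er rB] E; rewrite (ea i r r' a) // er (aB r r' a).
  by move=> r a _ /=; case: (act r a).
split=> [|i]; last first.
  apply: (@retract1 Q K (pmod K [seq r <- B | e i r] vert act) (pmod K B vert act) (g i) (f i)) => //.
  apply: dl_eq => // r rF.
  by have := rF; rewrite mem_filter mulmxA mulmx1 dl_pmx //= => /andP[er rB]; rewrite dl_pmx // er.
exists f, g; split=> //; apply: dl_eq => // r rB; rewrite mulmx1 mulmx_sumr; have [i0 e0 u0] := ex r rB.
rewrite (bigD1 i0) //= big1 ?addr0 => [|i ne].
  by rewrite mulmxA dl_pmx // e0 /= dl_pmx // mem_filter e0.
rewrite mulmxA dl_pmx //; case: ifP => [/u0 E|_]; first by rewrite E eqxx in ne.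
by rewrite mul0mx.
Qed.

Lemma reg_split : retract_of (regmod Q K) (fun j : 'I_n => projmod K j) /\
  forall j, retract_of (projmod K j) (fun _ : 'I_1 => regmod Q K).
Proof.
apply: (@pmod_split (nzpaths Q) (@pend Q) (@act_right Q) 'I_n (fun (j : 'I_n) r => pstart r == j)).
- exact: nzpaths_uniq.
- move=> [s l] r' a; rewrite mem_nz // => /andP[sn g] /(act_right_some g)[-> _ g'].
  by rewrite mem_nz //= sn.
- move=> [s l]; rewrite mem_nz // => /andP[sn _]; exists (Ordinal sn) => //= i /eqP e.
  by apply: val_inj; rewrite /= -e.
by move=> i [s l] r' a; rewrite mem_nz // => /andP[sn g] /(act_right_some g)[-> _ _].
Qed.

Lemma IB_proj S : (forall i : 'I_n, S i -> projective (injmod K i)) -> projective (Im S).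
Proof.
move=> Sp; have r : retract_of (Im S) (fun i : {i : 'I_n | S i} =>
    pmod K [seq r <- IB Q S | pend r == val i :> nat] (@pstart Q) (@act_dual Q)).
  apply: proj1; apply: (@pmod_split (IB Q S) _ _ _ (fun (i : {i : 'I_n | S i}) r => pend r == val i :> nat)); [exact: IB_uniq | exact: (IB_act harr) | |].
    move=> [s l]; rewrite mem_IB // => /and3P[Ss sn _].
    exists (exist _ (Ordinal (ptgt_bound l sn)) Ss) => //= i /eqP e.
    by apply/val_inj/val_inj; rewrite /= -e.
  move=> i [s [|b l]] r' a _ //; rewrite /act_dual /=; case: eqP => // <- [<-].
  by rewrite /pend /= ptgt_cons.
apply: (retract_proj r) => -[i Si] /=.
have -> : [seq r <- IB Q S | pend r == i :> nat] = [seq r <- nzpaths Q | pend r == i].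
  rewrite /IB -filter_predI; apply: eq_filter => r' /=.
  by case: eqP => //= ->; rewrite Si.
exact: Sp.
Qed.

Lemma rad_IB S s b z : (s, b :: z) \in IB Q S -> (dl K (IB Q S) (tgt b : nat, z) <= rad (Im S))%MS.
Proof.
move=> bI; have -> : dl K (IB Q S) (tgt b : nat, z) = dl K (IB Q S) (s, b :: z) *m mX (Im S) b.
  have -> := @dl_mX Q K (IB Q S) (@pstart Q) (@act_dual Q) (IB_uniq Q S) _ b bI.
  by rewrite /act_dual /= eqxx.
by apply: (submx_trans (submxMl _ _)); rewrite (sumsmx_sup b).
Qed.

Hypothesis thr : threaded Q.

Lemma rmax_ncr s l : (s < n)%N -> good s l -> l != [::] ->
  (forall a, src a = ptgt s l :> nat -> ~~ nonzero_path (rcons l a)) -> ncr Q (ptgt s l).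
Proof.
case/lastP: l => // l c sn gl _ rm; have vn := ptgt_bound (rcons l c) sn.
case: (ncrP thr vn) => // cs; have ck : tgt c = Ordinal vn by apply: val_inj; rewrite /= ptgt_rcons.
have [d [d' [dk _ _ _ gll]]] := cross_out cs ck.
have gd : good (Ordinal vn) [:: d] by rewrite -dk good_arrow.
by have := rm d (congr1 val dk); rewrite -cats1 (gll s l [::] gl gd).
Qed.

Section Maps.
(** v1 and v2 will be the longest paths from the crossing k along its two threads; by [link] every
    nontrivial path into k continues along exactly one of them. *)
Variables (k : 'I_n) (v1 v2 : seq 'I_m).
Hypotheses (gv1 : good k v1) (gv2 : good k v2) (v10 : v1 != [::]) (v20 : v2 != [::]).
Hypothesis pre : forall y, good k y -> prefix y v1 || prefix y v2.
Hypothesis pre2 : forall y, y != [::] -> prefix y v1 -> prefix y v2 = false.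
Hypothesis link : forall t w, (t < n)%N -> good t w -> ptgt t w = k -> w != [::] ->
  nonzero_path (w ++ v1) = ~~ nonzero_path (w ++ v2).
Hypotheses (nc1 : ncr Q (ptgt k v1)) (nc2 : ncr Q (ptgt k v2)).

Local Notation t1 := (ptgt k v1).
Local Notation t2 := (ptgt k v2).

Lemma cross_ns w w' : w ++ v1 <> w' ++ v2.
Proof.
have half u v x : good k u -> good k v -> u != [::] -> v = x ++ u -> v = u.
  move=> gu gv u0 e; rewrite e in gv; have : ptgt k x = k.
    by apply: start_suffix gu gv _; rewrite ptgt_cat; case: (u) u0.
  case: x e gv => // a x e gv ex; have := composable_lt harr (proj1 (andP (goodl gv))) isT.
  by rewrite ex ltnn.
move/cat_catP/orP => [|] /suffixP[x e].
  have e12 := half _ _ _ gv1 gv2 v10 e; have := pre2 v10 (prefix_refl v1).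
  by rewrite e12 prefix_refl.
have e12 := half _ _ _ gv2 gv1 v20 e; have := pre2 v10 (prefix_refl v1).
by rewrite e12 prefix_refl.
Qed.

Lemma cross_ne : t1 != t2.
Proof.
apply/eqP => e; have := cmp_into thr (ltn_ord k) (ltn_ord k) nc1 gv1 gv2 erefl (esym e).
by case/orP=> /suffixP[x ex]; [apply: (@cross_ns x [::]) | apply: (@cross_ns [::] x)].
Qed.

Definition S0 : pred nat := fun o => (o == t1) || (o == t2).
Local Notation B0 := (IB Q S0).

Definition unstrip (v : seq 'I_m) (r : qpath) : option qpath :=
  if suffix r.2 v then Some (k : nat, take (size v - size r.2) v) else None.
(** A linear retraction of P(k) -> J. Since e_k goes to v1^* + v2^*, it is read off at v1^* alone
    and v2^* is sent to zero. *)
Definition hmap (r : qpath) : option qpath :=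
  if pend r == t1 then unstrip v1 r else if r.2 == v2 then None else unstrip v2 r.
Definition extn (v : seq 'I_m) (r : qpath) : option qpath :=
  if nonzero_path (r.2 ++ v) then Some (r.1, r.2 ++ v) else None.

Definition gmx : 'M[K]_(size (PBs k), size B0) := pmx K (PBs k) B0 (strip v1) + pmx K (PBs k) B0 (strip v2).
Definition fmx : 'M[K]_(size B0, size (IBs k)) := pmx K B0 (IBs k) (cut v1) - pmx K B0 (IBs k) (cut v2).
Definition hmx : 'M[K]_(size B0, size (PBs k)) := pmx K B0 (PBs k) hmap.
(** A linear section of J -> I(k). The element e_k^* is lifted to -v2^*, since v1^* already serves
    [hmx] and [fmx] cuts v2 with a minus sign. *)
Definition lmx : 'M[K]_(size (IBs k), size B0) :=
  pmx K (IBs k) B0 (fun r => if r.2 == [::] then None else extn v1 r) - pmx K (IBs k) B0 (extn v2).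

Lemma unstrip_cat t y z : unstrip (y ++ z) (t, z) = Some (k : nat, y).
Proof. by rewrite /unstrip /= suffix_suffix size_cat addnK take_size_cat. Qed.

Lemma suffix_nil (v w : seq 'I_m) : w != [::] -> suffix (w ++ v) v = false.
Proof.
case: w => // a w _; apply/negP => /suffixP[x] /(congr1 size).
by rewrite size_cat /= size_cat addnS addnA -addSn => /addn_neq.
Qed.

Lemma cut_self v t : cut v (t, v) = Some (t, [::]).
Proof. exact: (@cut_cat _ t [::]). Qed.

Lemma unstrip_self v t : unstrip v (t, v) = Some (k : nat, [::]).
Proof. exact: (@unstrip_cat t [::]). Qed.

Lemma cut_none v z : suffix v z = false -> forall t, cut v (t, z) = None.
Proof. by rewrite /cut => e t /=; rewrite e. Qed.

Lemma ns1 y z : v1 = y ++ z -> suffix v2 z = false.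
Proof. by move=> e; apply/negP => /suffixP[x ex]; apply: (@cross_ns [::] (y ++ x)); rewrite /= e ex catA. Qed.
Lemma ns2 y z : v2 = y ++ z -> suffix v1 z = false.
Proof. by move=> e; apply/negP => /suffixP[x ex]; apply: (@cross_ns (y ++ x) [::]); rewrite /= e ex catA. Qed.
Lemma ns3 w : suffix v2 (w ++ v1) = false.
Proof. by apply/negP => /suffixP[x ex]; apply: (@cross_ns w x). Qed.
Lemma ns4 w : suffix v1 (w ++ v2) = false.
Proof. by apply/negP => /suffixP[x ex]; apply: (@cross_ns x w). Qed.

Lemma dl_g y : good k y -> dl K (PBs k) (k : nat, y) *m gmx = dlo K B0 (strip v1 (k : nat, y)) + dlo K B0 (strip v2 (k : nat, y)).
Proof. by move=> gy; rewrite mulmxDr !dl_pmx ?PBs_uniq // mem_PB // eqxx ltn_ord. Qed.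

Lemma dl_f t z : (t, z) \in B0 -> dl K B0 (t, z) *m fmx = dlo K (IBs k) (cut v1 (t, z)) - dlo K (IBs k) (cut v2 (t, z)).
Proof. by move=> zB; rewrite mulmxBr !dl_pmx ?IB_uniq. Qed.

Lemma dl_h t z : (t, z) \in B0 -> dl K B0 (t, z) *m hmx = dlo K (PBs k) (hmap (t, z)).
Proof. by move=> zB; rewrite !dl_pmx ?IB_uniq. Qed.

Lemma dl_l0 : dl K (IBs k) (k : nat, [::]) *m lmx = - dl K B0 (k : nat, v2).
Proof.
have kI : (k : nat, [::]) \in IBs k by apply: triv_IB.
by rewrite mulmxBr !dl_pmx ?IB_uniq // /extn /=; case/andP: gv2 => _ -> /=; rewrite sub0r.
Qed.

Lemma dl_l1 t w : (t, w) \in IBs k -> w != [::] -> nonzero_path (w ++ v1) ->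
  dl K (IBs k) (t, w) *m lmx = dl K B0 (t, w ++ v1).
Proof.
move=> wI w0 nz; move: (wI); rewrite mem_IB // => /and3P[/eqP wk tn gw].
rewrite mulmxBr !dl_pmx ?IB_uniq // /extn /= (negbTE w0) nz.
by rewrite (link tn gw wk w0) in nz; rewrite (negbTE nz) /= subr0.
Qed.

Lemma dl_l2 t w : (t, w) \in IBs k -> w != [::] -> nonzero_path (w ++ v2) ->
  dl K (IBs k) (t, w) *m lmx = - dl K B0 (t, w ++ v2).
Proof.
move=> wI w0 nz; move: (wI); rewrite mem_IB // => /and3P[/eqP wk tn gw].
rewrite mulmxBr !dl_pmx ?IB_uniq // /extn /= (negbTE w0) nz.
by rewrite (link tn gw wk w0) nz /= sub0r.
Qed.

Lemma mem_B0l y z : v1 = y ++ z -> (ptgt k y, z) \in B0.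
Proof.
move=> e; have := gv1; rewrite e => g; have et : t1 = ptgt (ptgt k y) z by rewrite -ptgt_cat -e.
rewrite mem_IB // /S0 et eqxx /= ptgt_bound //.
exact: goodr g.
Qed.

Lemma mem_B0r y z : v2 = y ++ z -> (ptgt k y, z) \in B0.
Proof.
move=> e; have := gv2; rewrite e => g; have et : t2 = ptgt (ptgt k y) z by rewrite -ptgt_cat -e.
rewrite mem_IB // /S0 et eqxx orbT /= ptgt_bound //.
exact: goodr g.
Qed.

Lemma mem_B0x t w v : (t, w) \in IBs k -> v = v1 \/ v = v2 -> nonzero_path (w ++ v) -> (t, w ++ v) \in B0.
Proof.
rewrite !mem_IB // => /and3P[/eqP wk tn gw] ev nz; rewrite tn /S0 ptgt_cat wk.
have gv : good k v by case: ev => ->.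
have -> : good t (w ++ v) by rewrite good_cat ?wk.
by case: ev => ->; rewrite eqxx ?orbT.
Qed.

Lemma mem_v1 : (k : nat, v1) \in B0. Proof. exact: (@mem_B0l [::]). Qed.
Lemma mem_v2 : (k : nat, v2) \in B0. Proof. exact: (@mem_B0r [::]). Qed.

Lemma strip0 v : strip v (k : nat, [::]) = Some (k : nat, v).
Proof. by rewrite -{1}[v]cat0s strip_cat. Qed.

(* h and l split the sequence linearly: gh = 1, lf = 1 and fl + hg = 1. *)
Lemma cross_gh : gmx *m hmx = 1%:M.
Proof.
apply: dl_eq => [|r rB]; first exact: PBs_uniq.
have [-> _ gy] := PBsP harr rB; move: (r.2) gy => y gy {r rB}; rewrite mulmxA dl_g // mulmx1.
case: (eqVneq y [::]) => [->|y0].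
  rewrite !strip0 /= mulmxDl !dl_h ?mem_v1 ?mem_v2 //.
  rewrite /hmap /pend /= !eqxx eq_sym (negbTE cross_ne) unstrip_self /=.
  by rewrite addr0.
case/orP: (pre gy) => pr.
  have p2 := pre2 y0 pr; have /prefixP[z e] := pr.
  rewrite {1}e strip_cat {1}/strip /= p2 addr0 dl_h ?mem_B0l // /hmap /pend /= -ptgt_cat -e eqxx.
  by rewrite {1}e unstrip_cat.
have p1 : prefix y v1 = false by apply/negP => p1; rewrite (pre2 y0 p1) in pr.
have /prefixP[z e] := pr.
rewrite {1}e strip_cat {1}/strip /= p1 add0r dl_h ?mem_B0r // /hmap /pend /= -ptgt_cat -e eq_sym (negbTE cross_ne).
have -> : (z == v2) = false.
  by apply/eqP => ez; move: (congr1 size e); rewrite ez size_cat; case: (y) y0 => // a y' _ /addn_neq.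
by rewrite {1}e unstrip_cat.
Qed.

Lemma cross_lf : lmx *m fmx = 1%:M.
Proof.
apply: dl_eq => [|[t w] wI]; first exact: IB_uniq.
move: (wI); rewrite mem_IB // => /and3P[/eqP wk tn gw]; rewrite mulmxA mulmx1.
case: (eqVneq w [::]) => [w0|w0].
  have -> : t = k by rewrite -wk w0.
  rewrite w0 dl_l0 mulNmx dl_f ?mem_v2 // cut_none ?(@ns2 [::]) //.
  by rewrite cut_self /= sub0r opprK.
case: (boolP (nonzero_path (w ++ v1))) => nz.
  by rewrite dl_l1 // dl_f ?mem_B0x //; [rewrite cut_cat cut_none ?ns3 //= subr0 | left].
have nz2 : nonzero_path (w ++ v2) by rewrite (link tn gw wk w0) negbK in nz.
by rewrite dl_l2 // mulNmx dl_f ?mem_B0x //; [rewrite cut_cat cut_none ?ns4 //= sub0r opprK | right].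
Qed.

Lemma mem_cut t w v : (t, w ++ v) \in B0 -> v = v1 \/ v = v2 -> (t, w) \in IBs k.
Proof.
rewrite !mem_IB // => /and3P[_ tn g] ev; rewrite tn (goodl g) !andbT.
have [gv v0] : good k v /\ v != [::] by case: ev => ->.
by apply/eqP; apply: start_suffix gv g _; rewrite ptgt_cat; case: (v) v0.
Qed.

Lemma cross_fl : fmx *m lmx + hmx *m gmx = 1%:M.
Proof.
apply: dl_eq => [|[t z] zB]; first exact: IB_uniq.
have := zB; rewrite mem_IB // => /and3P[zS tn gz].
rewrite mulmxDr !mulmxA dl_f // dl_h // mulmx1 /hmap /pend /=.
have kI := triv_IB harr hrel k; have y0I := good_nil hrel k.
case: (eqVneq (ptgt t z) t1) => zt.
  case/orP: (cmp_into thr tn (ltn_ord k) nc1 gz gv1 zt erefl) => [/suffixP[y e]|/suffixP[w e]].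
    have gy : good k y by have := gv1; rewrite e => /goodl.
    have et : ptgt k y = t by apply: (start_suffix gz); rewrite -e ?zt.
    rewrite (cut_none (ns1 e)) {2}e unstrip_cat /= dl_g //.
    case: (eqVneq y [::]) => [ey|y0].
      rewrite ey /= in e et; rewrite ey -et -e !strip0 cut_self /= subr0 dl_l0 /=.
      by rewrite addrCA addNr addr0.
    have p1 : prefix y v1 by rewrite e prefix_prefix.
    have n1 : suffix v1 z = false by rewrite {1}e suffix_nil.
    by rewrite cut_none // subrr mul0mx add0r {1}e strip_cat /strip /= (pre2 y0 p1) addr0 et.
  subst z; case: (eqVneq w [::]) => [ew|w0].
    move: zt gz zB; rewrite ew /= => zt gz zB.
    have et : t = k by apply: start_eq gz gv1 zt.
    subst t; rewrite (cut_none (@ns1 [::] _ erefl)) cut_self unstrip_self /= subr0 dl_l0 dl_g // !strip0 /=.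
    by rewrite addrCA addNr addr0.
  have wI := mem_cut zB (or_introl erefl).
  rewrite cut_cat cut_none ?ns3 //= subr0 dl_l1 //; last by case/andP: gz.
  by rewrite /unstrip /= suffix_nil //= mul0mx addr0.
have zt2 : ptgt t z = t2 by move: zS; rewrite /S0 (negbTE zt) => /eqP.
case/orP: (cmp_into thr tn (ltn_ord k) nc2 gz gv2 zt2 erefl) => [/suffixP[y e]|/suffixP[w e]].
  have gy : good k y by have := gv2; rewrite e => /goodl.
  have et : ptgt k y = t by apply: (start_suffix gz); rewrite -e ?zt2.
  rewrite (cut_none (ns2 e)); case: (eqVneq y [::]) => [ey|y0].
    rewrite ey /= in e et; rewrite -et -e eqxx cut_self /= mul0mx addr0 sub0r mulNmx dl_l0.
    by rewrite opprK.
  have n2 : suffix v2 z = false by rewrite {1}e suffix_nil.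
  have -> : (z == v2) = false by apply/eqP => ez; rewrite ez suffix_refl in n2.
  have p1 : prefix y v1 = false by apply/negP => p1; have := pre2 y0 p1; rewrite e prefix_prefix.
  rewrite (cut_none n2) subrr mul0mx add0r {1}e unstrip_cat /= dl_g // {1}e strip_cat /strip /= p1 add0r.
  by rewrite et.
subst z; case: (eqVneq w [::]) => [ew|w0].
  move: zt2 gz zB; rewrite ew /= => zt2 gz zB.
  have et : t = k by apply: start_eq gz gv2 zt2.
  subst t; rewrite (cut_none (@ns2 [::] _ erefl)) cut_self eqxx /= mul0mx addr0 sub0r mulNmx dl_l0.
  by rewrite opprK.
have wI := mem_cut zB (or_intror erefl).
rewrite cut_cat cut_none ?ns4 //= sub0r mulNmx dl_l2 //; last by case/andP: gz.
rewrite opprK /unstrip /= suffix_nil //; case: ifP => _; rewrite /= mul0mx addr0 //.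
Qed.

Lemma cross_gh_hom : @is_hom Q K (projmod K k) (Im S0) gmx.
Proof.
by apply: hom_add; apply: (@strip_hom Q K harr k); rewrite ?/S0 ?eqxx ?orbT.
Qed.

Lemma cross_f_hom : @is_hom Q K (Im S0) (injmod K k) fmx.
Proof.
by apply: hom_add; [|apply: hom_opp]; apply: (@cut_hom Q K harr k).
Qed.

End Maps.

Definition pair_pred t1 t2 : pred nat := fun o => (o == t1) || (o == t2).

(** The middle term is projective because both thread paths are right maximal. The image of P(k)
    lies in its radical because v_i^* = (c_i v_i)^* c_i for the incoming arrow c_i of the same
    thread. *)
Lemma cross_ses k : two_gorenstein Q K -> cross_spec k -> exists t1 t2
    (g : 'M[K]_(mdim (projmod K k), mdim (Im (pair_pred t1 t2)))) (f : 'M[K]_(_, mdim (injmod K k))),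
  [/\ [/\ (k < t1 < n)%N, (k < t2 < n)%N, t1 != t2 & projective (Im (pair_pred t1 t2))],
      is_hom g, is_hom f & [/\ row_free g, row_full f, (g == kermx f)%MS & (g <= rad (Im (pair_pred t1 t2)))%MS]].
Proof.
move=> gor cs; have [c1 [c2 [d1 [d2 [[c12 d12 ck1 ck2] [dk1 dk2 n12 n21] hin hout [gl1 gl2]]]]]] := cs.
have rext d : src d = k -> exists w, [/\ good k (d :: w),
    forall a, src a = ptgt k (d :: w) :> nat -> ~~ nonzero_path (rcons (d :: w) a) &
    forall y, good k (d :: y) -> prefix y w].
  move=> dk; have gd : good k [:: d] by rewrite -dk good_arrow.
  have [w [gw rm]] := rext_ex harr (ltn_ord k) gd; exists w; split=> // y gy.
  case/orP: (@cmp_after Q thr k [:: d] y w (ltn_ord k) isT gy gw) => // /prefixP[[|a w'] e]; first by rewrite e cats0 prefix_refl.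
  exfalso; move: gy; rewrite e -cat_rcons -cat_cons => /goodl; rewrite -rcons_cons /good composable_rcons => /andP[/andP[_ /eqP as_]].
  by rewrite (negbTE (rm a as_)).
have [w1 [gv1 rm1 pre1]] := rext d1 dk1; have [w2 [gv2 rm2 pre2]] := rext d2 dk2.
pose v1 := d1 :: w1; pose v2 := d2 :: w2.
have nc1 : ncr Q (ptgt k v1) by apply: rmax_ncr.
have nc2 : ncr Q (ptgt k v2) by apply: rmax_ncr.
have preH y : good k y -> prefix y v1 || prefix y v2.
  case: y => [|b y] gy; first by rewrite prefix0s.
  have bk : src b = k by apply: val_inj; case/andP: gy => /andP[/eqP].
  case: (hout b bk) => eb; subst b; rewrite /v1 /v2 /= eqxx; first by rewrite pre1.
  by rewrite pre2 // orbT.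
have preX y : y != [::] -> prefix y v1 -> prefix y v2 = false.
  case: y => // b y _; rewrite /v1 /v2 /= => /andP[/eqP -> _]; by rewrite (negbTE d12).
have link t w : (t < n)%N -> good t w -> ptgt t w = k -> w != [::] ->
    nonzero_path (w ++ v1) = ~~ nonzero_path (w ++ v2).
  case/lastP: w => // w b tn gw wk _; have bk : tgt b = k by apply: val_inj; rewrite /= -wk ptgt_rcons.
  case: (hin b bk) => eb; subst b.
    by rewrite (gl1 t) //; apply/esym; apply: contra n12 => /nz_link.
  rewrite (gl2 t w w2) //=; apply/negbTE; apply: contra n21 => /nz_link //.
have ne := cross_ne gv1 gv2 isT isT preX nc1.
have lt v : good k v -> v != [::] -> (k < ptgt k v < n)%N.
  by move=> /andP[cv _] v0; rewrite composable_lt //= ptgt_bound.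
have pj v (t : 'I_n) : good k v -> (forall a, src a = ptgt k v :> nat -> ~~ nonzero_path (rcons v a)) ->
    ptgt k v = t -> projective (injmod K t).
  move=> gv rm vt; apply: (gor_rmax_proj harr hrel gor (s := k) (l := v)) => //; first by rewrite mem_nz //= ltn_ord.
  by move=> a at_; apply: rm; rewrite at_ vt.
exists (ptgt k v1), (ptgt k v2), (gmx k v1 v2), (fmx k v1 v2).
have [h1 h2 h3] := split_exact (cross_gh gv1 gv2 isT isT preH preX nc1)
  (cross_lf gv1 gv2 isT isT preX link) (cross_fl gv1 gv2 isT isT preX link nc1 nc2).
split; [split; [exact: (lt v1) | exact: (lt v2) | exact: ne |] | exact: cross_gh_hom | exact: cross_f_hom | split=> //].
  by apply: IB_proj => t /orP[] /eqP e; [apply: (pj v1) | apply: (pj v2)].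
apply: (@dl_sub Q K (PBs k)) => [|r rB]; first exact: (PBs_uniq harr).
have [-> _ gy] := PBsP harr rB; move: (r.2) gy => y gy {r rB}; rewrite dl_g //.
have sub c v : (c = c1 /\ v = v1) \/ (c = c2 /\ v = v2) -> (dlo K (IB Q (S0 k v1 v2)) (strip v (k : nat, y)) <= rad (Im (S0 k v1 v2)))%MS.
  move=> cv; case e: (strip v _) => [[t z]|] /=; last exact: sub0mx.
  have gv : good k v by case: cv => -[_ ->].
  have Sv : S0 k v1 v2 (ptgt k v) by case: cv => -[_ ->]; rewrite /S0 eqxx ?orbT.
  have [/= ev et] := stripP e; rewrite /= in et; rewrite et /pend /=.
  case/lastP: y gy ev {e et} => [|y b] gy ev.
    have ck : tgt c = k by case: cv => -[-> _].
    have gc : good (src c) (c :: v).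
      rewrite /good /= eqxx ck; case/andP: (gv) => -> _ /=.
      have nzc a f : nonzero_path (rcons [::] a ++ f) -> nonzero_path (a :: f) by [].
      by case: cv => -[-> ->]; apply: nzc; [apply: (gl1 (src c1)) | apply: (gl2 (src c2))]; rewrite // good_arrow.
    rewrite /= in ev; subst z; rewrite /ptgt /= -ck; apply: (@rad_IB _ (src c)).
    by rewrite mem_IB // ptgt_cons ck Sv ltn_ord gc.
  have gv' := gv; rewrite ev cat_rcons in gv'.
  rewrite ptgt_rcons; apply: (@rad_IB _ (ptgt k y)).
  rewrite mem_IB // ptgt_bound // (goodr gv') !andbT -ptgt_cat -cat_rcons -ev.
  exact: Sv.
apply: addmx_sub; apply: sub; [by left | by right].
Qed.

Lemma cross_res k : two_gorenstein Q K -> cross_spec k ->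
  (exists R : presol (injmod K k), [/\ minimal_presol R, rP R 1 = projmod K k & forall i, (1 < i)%N -> mdim (rP R i) = 0%N]) /\
  exists t1 t2 (C : icoresol (projmod K k)), [/\ is_icoresol C, cI C 0 = Im (pair_pred t1 t2), cI C 1 = injmod K k,
   (forall i, (1 < i)%N -> mdim (cI C i) = 0%N) & [/\ (k < t1 < n)%N, (k < t2 < n)%N & t1 != t2]].
Proof.
move=> gor cs; have [t1 [t2 [g [f [[lt1 lt2 ne pj] gh fh [gf ff gk gr]]]]]] := cross_ses gor cs.
have Jm := Im_mod K harr (pair_pred t1 t2).
split.
  exists (ses_presol g f); split=> //; last by case=> [|[]].
  by apply: ses_presol_min => //; [exact: projmod_mod | exact: projmod_proj].
exists t1, t2, (ses_icoresol g f); split=> //; last by case=> [|[]].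
by apply: ses_icoresolP => //; [exact: injmod_mod | exact: injmod_inj | exact: IB_inj].
Qed.

End Crossing.

(** * Bruhat decompositions *)

Lemma upper_det k (U : 'M[rat]_k) : upper_trig U -> \det U = \prod_i U i i.
Proof.
move=> hU; rewrite -det_tr det_trig; first by apply: eq_bigr => i _; rewrite mxE.
by apply/is_trig_mxP => i j ij; rewrite mxE hU.
Qed.

Lemma trig_diag k (M V U : 'M[rat]_k) : upper_trig U -> M = V *m U -> \det M != 0 -> forall i, U i i != 0.
Proof.
move=> hU -> ; rewrite det_mulmx mulf_eq0 negb_or (upper_det hU) => /andP[_ /prodf_neq0 H] i.
exact: H.
Qed.

(** Forward substitution: column c of vU involves only the entries of v up to c. *)
Lemma trig_solve k (U : 'M[rat]_k) (v : 'rV[rat]_k) (i : 'I_k) : upper_trig U -> (forall c, U c c != 0) ->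
  (forall c : 'I_k, (c < i)%N -> (v *m U) 0 c = 0) ->
  (forall c : 'I_k, (c < i)%N -> v 0 c = 0) /\ (v *m U) 0 i = v 0 i * U i i.
Proof.
move=> hU dU hv.
have key (c : 'I_k) : (forall b : 'I_k, (b < c)%N -> v 0 b = 0) -> (v *m U) 0 c = v 0 c * U c c.
  move=> h; rewrite mxE (bigD1 c) //= big1 ?addr0 // => b bc.
  case: (ltngtP b c) => [lt|gt|e]; first by rewrite h // mul0r.
    by rewrite hU // mulr0.
  by rewrite (val_inj e) eqxx in bc.
have h (c : 'I_k) : (c < i)%N -> v 0 c = 0.
  have [N] := ubnP (nat_of_ord c); elim: N c => // N IH c cN ci.
  have := key c; rewrite hv // => H; apply/eqP.
  have /esym/eqP : 0 = v 0 c * U c c by apply: H => b bc; apply: IH; [apply: leq_trans bc _ | apply: ltn_trans bc ci].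
  by rewrite mulf_eq0 (negbTE (dU c)) orbF.
by split=> //; apply: key.
Qed.

Definition first_nonzero k (C : 'M[rat]_k) (f : 'I_k -> 'I_k) :=
  forall j, C j (f j) != 0 /\ forall x : 'I_k, (x < f j)%N -> C j x = 0.

(** Sorting the rows by the positions of their first nonzero entries leaves an upper triangular
    matrix. *)
Lemma bruhat_exists k (C : 'M[rat]_k) (f : 'I_k -> 'I_k) : ssrfun.injective f -> first_nonzero C f ->
  exists P U2, bruhat_dec C 1%:M P U2.
Proof.
move=> fi H; exists (perm_mx (perm fi)), (row_perm (perm fi)^-1%g C); split.
- by move=> i j ji; rewrite mxE; case: eqP => // e; rewrite e ltnn in ji.
- move=> i j ji; rewrite mxE; have [_ h] := H ((perm fi)^-1%g i); apply: h.
  by rewrite -(permE fi) permKV.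
- exact: perm_mx_is_perm.
by rewrite mul1mx row_permE mulmxA -perm_mxM mulgV perm_mx1 mul1mx.
Qed.

Lemma leq_inj_id k (f : 'I_k -> 'I_k) : ssrfun.injective f -> (forall r : 'I_k, (r <= f r)%N) -> forall r, f r = r.
Proof.
move=> fi H r; have [N] := ubnP (k - r)%N; elim: N r => // N IH r rN; apply/eqP; apply: contraT => ne.
have lt : (r < f r)%N by rewrite ltn_neqAle H andbT eq_sym.
have e : f (f r) = f r by apply: IH; apply: subn_ltS lt (ltn_ord _) rN.
by rewrite (fi _ _ e) eqxx in ne.
Qed.

(** Right multiplication by U2 preserves first nonzero positions, so row r of U1 P is nonzero at
    f(r). As U1 is upper triangular, s^-1(f(r)) is at least r, and an injection with this property
    is the identity. *)
Lemma bruhat_unique k (C U1 P U2 : 'M[rat]_k) (f : 'I_k -> 'I_k) : ssrfun.injective f -> first_nonzero C f ->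
  \det C != 0 -> bruhat_dec C U1 P U2 -> forall i j, P j i != 0 -> i = f j.
Proof.
move=> fi H dC [h1 h2 /is_perm_mxP[s ->] eC].
have dU := trig_diag h2 eC dC.
have V r c : (U1 *m perm_mx s) r c = U1 r (s^-1%g c).
  rewrite mxE (bigD1 (s^-1%g c)) //= !mxE permKV eqxx mulr1 big1 ?addr0 // => b ne.
  by rewrite !mxE; case: eqP => [e|_]; rewrite ?mulr0 //; rewrite -e permK eqxx in ne.
have le (r : 'I_k) : (r <= s^-1%g (f r))%N.
  have [C0 Cz] := H r; rewrite leqNgt; apply/negP => lt.
  have := @trig_solve _ U2 (row r (U1 *m perm_mx s)) (f r) h2 dU.
  have E c : (row r (U1 *m perm_mx s) *m U2) 0 c = C r c by rewrite -row_mul -eC mxE.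
  case=> [c cf|_]; first by rewrite E Cz.
  rewrite E mxE V h1 // mul0r => e; by rewrite e eqxx in C0.
have fs r : f r = s r.
  have : s^-1%g (f r) = r by apply: (leq_inj_id (f := s^-1%g \o f)) => //= x y /perm_inj/fi.
  by move=> {2}<-; rewrite permKV.
move=> i j; rewrite !mxE fs; case: (s j =P i) => [-> //|_]; by rewrite eqxx.
Qed.

(** * Cartan matrix and resolutions *)

Section Cartan.
Variables (Q : monquiver) (K : fieldType).
Local Notation n := (qn Q).
Local Notation m := (qm Q).
Local Notation src := (@qsrc Q).
Local Notation tgt := (@qtgt Q).
Implicit Types (i j w : 'I_n) (s t : nat).

Hypothesis harr : forall a, (src a < tgt a)%N.
Hypothesis hrel : forall e, e \in qrels Q -> (2 <= size e)%N.

Lemma rank_exact (X Y Z : amod Q K) (d : 'M[K]_(mdim X, mdim Y)) (d' : 'M[K]_(mdim Y, mdim Z)) w :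
  is_module Y -> is_hom d -> (d == kermx d')%MS ->
  \rank (mE Y w) = (\rank (mE Y w *m d') + \rank (mE X w *m d))%N.
Proof.
move=> Ym [dh _] /eqmxP dk; rewrite -(mxrank_mul_ker (mE Y w) d'); congr addn.
apply: eqmx_rank; apply/andP; split; last first.
  by rewrite sub_capmx {1}dh submxMl -dk submxMl.
set x := (_ :&: _)%MS; have xE : x *m mE Y w = x.
  have /submxP[y ->] : (x <= mE Y w)%MS by apply: capmxSl.
  by rewrite -mulmxA mEid.
have /submxP[z ez] : (x <= d)%MS by rewrite dk capmxSr.
have -> : x = z *m (mE X w *m d) by rewrite dh mulmxA -ez xE.
exact: submxMl.
Qed.

(** A telescoping Euler characteristic: [e] stands for the dimensions of the terms, [a] for the
    ranks of the differentials. *)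
Lemma alt_sum (a e : nat -> nat) (r : nat) L : e 0%N = (a 0%N + r)%N -> (forall k, e k.+1 = (a k.+1 + a k)%N) ->
  a L = 0%N -> r%:R = \sum_(k < L.+1) (-1) ^+ k * (e k)%:R :> rat.
Proof.
move=> e0 ek aL; suff H N : \sum_(k < N.+1) (-1) ^+ k * (e k)%:R = r%:R + (-1) ^+ N * (a N)%:R :> rat.
  by rewrite H aL mulr0 addr0.
elim: N => [|N IH]; first by rewrite big_ord_recl big_ord0 /= expr0 !mul1r addr0 e0 natrD addrC.
by rewrite big_ord_recr /= IH ek natrD exprS mulN1r mulrDr !mulNr [- _ + - _]addrC addrA addrK.
Qed.

Lemma rank_icores (N : amod Q K) (C : icoresol N) L w : is_module N -> is_icoresol C -> mdim (cI C L.+1) = 0%N ->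
  (\rank (mE N w))%:R = \sum_(k < L.+1) (-1) ^+ k * (\rank (mE (cI C k) w))%:R :> rat.
Proof.
move=> Nm [Cm [eh dh] ef [ek dk]] z.
apply: (@alt_sum (fun k => \rank (mE (cI C k) w *m cd C k)) (fun k => \rank (mE (cI C k) w))).
- rewrite (rank_exact w (proj1 (Cm 0%N)) eh ek); congr addn.
  by rewrite mxrankMfree.
- by move=> k; rewrite (rank_exact w (proj1 (Cm k.+1)) (dh k) (dk k)).
by apply/eqP; rewrite -leqn0 -z rank_leq_col.
Qed.

Lemma rank_presol (M : amod Q K) (R : presol M) L w : is_module M -> is_presol R -> mdim (rP R L.+1) = 0%N ->
  (\rank (mE M w))%:R = \sum_(k < L.+1) (-1) ^+ k * (\rank (mE (rP R k) w))%:R :> rat.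
Proof.
move=> Mm [Rm [eh dh] ef ek dk] z.
apply: (@alt_sum (fun k => \rank (mE (rP R k.+1) w *m rd R k)) (fun k => \rank (mE (rP R k) w))).
- rewrite (rank_exact w (proj1 (Rm 0%N)) (dh 0%N) ek) addnC; congr addn.
  case: eh => -> _; apply/eqP; rewrite eqn_leq mxrankM_maxr /=.
  by have /row_fullP[B eB] := ef; rewrite -{1}[mE M w]mul1mx -eB -mulmxA mxrankM_maxr.
- by move=> k; rewrite (rank_exact w (proj1 (Rm k.+1)) (dh k.+1) (dk k)) addnC.
by apply/eqP; rewrite -leqn0; apply: leq_trans (mxrankM_maxl _ _) _; rewrite -z rank_leq_row.
Qed.

Lemma rank_pmod (B : seq (qpath Q)) vert act w : uniq B ->
  \rank (mE (pmod K B vert act) w) = count (fun r => vert r == w) B.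
Proof.
move=> uB; pose F := [seq r <- B | vert r == w]; have uF : uniq F by apply: filter_uniq.
have -> : mE (pmod K B vert act) w = pmx K B F (fun r => if vert r == w then Some r else None) *m pmx K F B Some.
  apply: dl_eq => // r rB; have -> := @dl_mE Q K B vert act uB r w rB.
  rewrite mulmxA dl_pmx //; case: ifP => vr /=; last by rewrite mul0mx.
  by rewrite dl_pmx // mem_filter vr.
rewrite mxrankMfree; last by apply: pmx_free => // [r|r r' r2 _ _ [->] [->]] //; rewrite mem_filter => /andP[_ rB]; exists r.
rewrite -size_filter; apply/eqP; apply: pmx_full => // r; rewrite mem_filter => /andP[vr rB].
by exists r; rewrite // vr.
Qed.

Definition npaths s t := count (fun r : qpath Q => (pstart r == s) && (pend r == t)) (nzpaths Q).

Lemma rank_IB S w : \rank (mE (pmod K (IB Q S) (@pstart Q) (@act_dual Q)) w) =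
  count (fun r : qpath Q => (pstart r == w) && S (pend r)) (nzpaths Q).
Proof. by rewrite rank_pmod ?IB_uniq // count_filter. Qed.

Lemma rank_PB s w : \rank (mE (pmod K (PB Q (fun o => o == s)) (@pend Q) (@act_right Q)) w) = npaths s w.
Proof.
rewrite rank_pmod ?(PBs_uniq harr) // count_filter.
by apply: eq_count => r /=; rewrite andbC.
Qed.

Lemma rank_pair t1 t2 w : t1 != t2 ->
  \rank (mE (pmod K (IB Q (pair_pred t1 t2)) (@pstart Q) (@act_dual Q)) w) = (npaths w t1 + npaths w t2)%N.
Proof.
move=> ne; rewrite rank_IB /npaths -count_predUI.
rewrite (@eq_count _ (predI _ _) pred0) ?count_pred0 ?addn0 => [|r] /=.
  by apply: eq_count => r /=; rewrite /pair_pred andb_orr.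
by case: eqP => //= _; case: eqP => //= ->; rewrite (negbTE ne).
Qed.

Lemma cartanE i j : cartan Q i j = (npaths j i)%:R.
Proof. by rewrite mxE. Qed.

Lemma cartan_det : \det (cartan Q) = 1.
Proof.
rewrite det_trig; last first.
  apply/is_trig_mxP => i j ij; rewrite cartanE /npaths (@eq_in_count _ _ pred0) ?count_pred0 // => -[s l].
  rewrite mem_nz // => /andP[_ /andP[cl _]] /=; apply/negP => /andP[/eqP e1 /eqP e2].
  have := composable_le harr cl; rewrite /pstart /pend /= in e1 e2; rewrite e2 e1 => le.
  by have := leq_trans (leq_addr _ _) le; rewrite leqNgt ij.
rewrite big1 // => i _; rewrite cartanE; suff -> : npaths i i = 1%N by [].
rewrite /npaths -size_filter; apply: perm_size (_ : perm_eq _ [:: (i : nat, [::])]).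
apply: uniq_perm => //; first by rewrite filter_uniq // nzpaths_uniq.
move=> [s l]; rewrite mem_filter inE mem_nz //=; apply/idP/eqP => [/andP[/andP[/eqP e1 /eqP e2] /andP[_ /andP[cl _]]]|[-> ->]].
  rewrite /pstart /pend /= in e1 e2; subst s; case: l cl e2 => // a l cl e2.
  by have := composable_lt harr cl isT; rewrite e2 ltnn.
by rewrite /pstart /pend /ptgt /= !eqxx ltn_ord good_nil.
Qed.

(** The class of a resolution with indecomposable terms at the vertices [V], in the Grothendieck
    group. *)
Definition alt_row (V : seq nat) : 'rV[rat]_n := \row_x \sum_(k < size V) (-1) ^+ k * (nth n V k == x)%:R.

Lemma alt_rowM (V : seq nat) (A : 'M[rat]_n) (F : nat -> rat) w : all (fun x => x < n)%N V ->
  (forall x : 'I_n, A x w = F x) -> (alt_row V *m A) 0 w = \sum_(k < size V) (-1) ^+ k * F (nth n V k).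
Proof.
move=> Vb AF; rewrite mxE; under eq_bigr => x _ do rewrite mxE mulr_suml.
rewrite exchange_big /=; apply: eq_bigr => k _; have kn : (nth n V k < n)%N by rewrite nth_bound.
rewrite (bigD1 (Ordinal kn)) //= eqxx mulr1 AF big1 ?addr0 // => x ne.
by rewrite (_ : (_ == _) = false) ?mulr0 ?mul0r //; apply: contraNF ne => /eqP e; apply/eqP/val_inj.
Qed.

Lemma alt_row_uniq (V : seq nat) k (x : 'I_n) : uniq V -> (k < size V)%N -> nth n V k = x -> alt_row V 0 x = (-1) ^+ k.
Proof.
move=> uV kV e; rewrite mxE (bigD1 (Ordinal kV)) //= e eqxx mulr1 big1 ?addr0 // => k' ne.
by rewrite -e nth_uniq // (_ : (_ == _) = false) ?mulr0 //; apply: contraNF ne => /eqP e'; apply/eqP/val_inj.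
Qed.

Lemma alt_row_out (V : seq nat) (x : 'I_n) : (x : nat) \notin V -> alt_row V 0 x = 0.
Proof.
move=> xV; rewrite mxE big1 // => k _; rewrite (_ : (_ == _) = false) ?mulr0 //.
by apply: contraNF xV => /eqP <-; rewrite mem_nth.
Qed.

Lemma cartan_unit : cartan Q \in unitmx.
Proof. by rewrite unitmxE cartan_det unitr1. Qed.

Lemma coxeter_det : \det (coxeter Q) != 0.
Proof.
rewrite /coxeter -scaleN1r detZ det_mulmx det_tr det_inv cartan_det mul1r invr1 mulr1.
by rewrite expf_neq0 // oppr_eq0 oner_eq0.
Qed.

(** Rows of the Cartan matrix are the dimension vectors of the I(x), columns those of the P(j); so v
    expresses P(j) through the I(x). *)
Lemma coxeter_row j (v : 'rV[rat]_n) : (forall w, (v *m cartan Q) 0 w = cartan Q w j) ->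
  forall x, coxeter Q j x = - v 0 x.
Proof.
move=> H x; have e : v *m cartan Q = row j (cartan Q)^T by apply/rowP => w; rewrite H !mxE.
rewrite /coxeter mxE; congr (- _); have -> : v = row j ((cartan Q)^T *m invmx (cartan Q)).
  by rewrite row_mul -e mulmxK // cartan_unit.
by rewrite [RHS]mxE.
Qed.

(** Here v expresses I(i) through the P(x), so -v is row i of the inverse of C. *)
Lemma coxeter_inv_row i (v : 'rV[rat]_n) : (forall w, (v *m (cartan Q)^T) 0 w = cartan Q i w) ->
  v *m coxeter Q = - delta_mx 0 i.
Proof.
move=> H; have e : v *m (cartan Q)^T = row i (cartan Q) by apply/rowP => w; rewrite H !mxE.
by rewrite /coxeter mulmxN mulmxA e -row_mul mulmxV ?cartan_unit // rowE mulmx1.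
Qed.

End Cartan.

(** * Auslander regularity *)

Section Regular.
Variables (Q : monquiver) (K : fieldType).
Local Notation n := (qn Q).
Local Notation m := (qm Q).
Local Notation src := (@qsrc Q).
Local Notation tgt := (@qtgt Q).
Implicit Types (i j w x : 'I_n) (s t k : nat) (u v : seq 'I_m) (qs : seq (seq 'I_m)) (ps : seq (qpath Q)).

Hypothesis harr : forall a, (src a < tgt a)%N.
Hypothesis hrel : forall e, e \in qrels Q -> (2 <= size e)%N.
Hypothesis gor : two_gorenstein Q K.
Let thr : threaded Q := gorenstein_threaded harr hrel gor.

Local Notation xs j v ps := (ptgt j v :: map fst ps).
Local Notation Im S := (pmod K (IB Q S) (@pstart Q) (@act_dual Q)).

Lemma xs_bound j v ps : pdata j v ps -> all (fun o => o < n)%N (xs j v ps).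
Proof.
case=> _ _ H; rewrite /= ptgt_bound //=; case: ps H => //= p ps [a [_ -> _ /= h]]; rewrite ltn_ord /=.
elim: ps (src a : nat) (a :: v) h => //= r ps IH s q [[rn _ _ _ _] h]; rewrite rn; exact: IH h.
Qed.

Lemma xs_dec j v ps : pdata j v ps -> sorted (fun o o' => o' < o)%N (xs j v ps).
Proof.
case=> gv _; case: ps => //= p ps [a [aj -> _ /= h]].
have le : (j <= ptgt j v)%N by case/andP: gv => cv _; apply: leq_trans (leq_addr _ _) (composable_le harr cv).
have -> : (src a < ptgt j v)%N by apply: leq_trans le; rewrite -aj.
elim: ps (src a : nat) (a :: v) h => //= -[s' l] ps IH s q [[rn /= gl <- l0 _] h].
by rewrite composable_lt //=; [apply: IH h | case/andP: gl].
Qed.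

Lemma pdim_le_mono (M : amod Q K) k k' : (k <= k')%N -> pdim_le M k -> pdim_le M k'.
Proof. by move=> le [R [RP H]]; exists R; split=> // e lt; apply: H; apply: leq_ltn_trans lt. Qed.

Lemma pdim_dim0 (M : amod Q K) k : mdim M = 0%N -> pdim_le M k.
Proof.
move=> M0; apply: (@pdim_retract _ _ harr hrel M 'I_0 (fun _ => M)) => //; try by case.
  exact: zero_is_module.
exists (fun _ => 0), (fun _ => 0); split=> [[]|[]|] //; rewrite big_ord0.
by apply/matrixP => e; exfalso; case: e => e; rewrite M0.
Qed.

(** P(j) is a summand of A, so the k-th term I(x_k) of its minimal coresolution is a summand of
    I^k. *)
Lemma ar_bound j v ps k s u qs : auslander_regular Q K -> ncr Q j -> pdata j v ps ->
  ncr Q (nth n (xs j v ps) k) -> idata (nth n (xs j v ps) k) s u qs -> (size qs <= k)%N.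
Proof.
move=> [_ AR] nc D ncx Di; have [C mC] := icores_ex harr hrel (reg_mod K harr).
have xn : (nth n (xs j v ps) k < n)%N by case: Di => sn _ <- _ _; apply: ptgt_bound.
have [D1 [mD eD]] := proj_chain K harr hrel thr nc D.
have r := compare_icores k (projmod_mod K harr j) (fun=> reg_mod K harr) mD (fun=> min_icoresol mC) (proj2 (reg_split K harr) j).
rewrite eD in r; have Cm : is_module (cI C k) by case: mC => H _ _ _ _; case: (H k).
exact: (@inj_chain_min Q K harr hrel thr (Ordinal xn) s u qs k _ _ ncx Di (fun=> Cm) r (fun=> AR C mC k)).
Qed.

Lemma cross_pdim x : cross_spec x -> pdim_le (injmod K x) 1.
Proof. by move=> cs; have [[R [[RP _] _ H]] _] := cross_res harr hrel thr gor cs; exists R. Qed.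

(** Degrees 0 and 1 are the 2-Gorenstein condition. From degree 2 on crossings are harmless: I(x)
    has projective dimension at most 1 there, and the coresolution of P(j) has already stopped. *)
Lemma ar_of_bound : (forall j v ps k s u qs, ncr Q j -> pdata j v ps -> (0 < k <= size ps)%N ->
    ncr Q (nth n (xs j v ps) k) -> idata (nth n (xs j v ps) k) s u qs -> (size qs <= k)%N) ->
  auslander_regular Q K.
Proof.
move=> H; split; first exact: gldim_fin.
move=> C mC k; case: (ltnP 1 k) => k1; last by case: k k1 => [|[|]] //; case: (gor mC).
have ex j : exists D : icoresol (projmod K j), is_icoresol D /\ pdim_le (cI D k) k.
  case: (ncrP thr (ltn_ord j)) => [nc|cs].
    have [v [ps D]] := pdata_ex harr hrel thr (ltn_ord j) nc.
    have [D1 [mD eD]] := proj_chain K harr hrel thr nc D; exists D1; split; first exact: min_icoresol.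
    rewrite eD; case: (ltnP k (size (xs j v ps))) => kx; last first.
      by apply: pdim_dim0; rewrite /= (IBs0 harr) // nth_default.
    have xn : (nth n (xs j v ps) k < n)%N by rewrite nth_bound // xs_bound.
    case: (ncrP thr xn) => [ncx|csx]; last exact: pdim_le_mono (ltnW k1) (cross_pdim csx).
    have [s [u [qs Di]]] := idata_ex harr hrel thr xn.
    apply: pdim_le_mono (@inj_chain_pdim Q K harr hrel thr (Ordinal xn) s u qs ncx Di).
    apply: H D _ ncx Di => //; rewrite (ltnW k1) /=.
    by move: kx; rewrite /= size_map ltnS.
  have csj : cross_spec j by have -> : j = Ordinal (ltn_ord j) by apply: val_inj.
  have [_ [t1 [t2 [D [DP _ _ D0 _]]]]] := cross_res harr hrel thr gor csj.
  by exists D; split=> //; apply: pdim_dim0; apply: D0.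
pose D j := sval (constructive_indefinite_description _ (ex j)).
have DP j : is_icoresol (D j) by case: (svalP (constructive_indefinite_description _ (ex j))).
have Dk j : pdim_le (cI (D j) k) k by case: (svalP (constructive_indefinite_description _ (ex j))).
have r := compare_icores k (reg_mod K harr) (projmod_mod K harr) mC DP (proj1 (reg_split K harr)).
apply: (pdim_retract harr hrel _ _ r) => //; first by case: mC => Cm _ _ _ _; case: (Cm k).
by move=> j; case: (DP j) => Cm _ _ _; case: (Cm k).
Qed.

Lemma row_ncr j v ps : ncr Q j -> pdata j v ps -> forall x, coxeter Q j x = - alt_row Q (xs j v ps) 0 x.
Proof.
move=> nc D; apply: (coxeter_row harr hrel) => w; have Vb := xs_bound D.
have [C [mC eC]] := proj_chain K harr hrel thr nc D.
rewrite (@alt_rowM _ _ _ (fun t => (npaths Q w t)%:R)) // => [|x]; last by rewrite cartanE.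
have z : mdim (cI C (size ps).+1) = 0%N by rewrite eC /= (IBs0 harr) // nth_default //= size_map.
rewrite cartanE -(rank_PB K harr) (rank_icores w (projmod_mod K harr j) (min_icoresol mC) z).
by rewrite /= size_map; apply: eq_bigr => k _; rewrite eC rank_IB.
Qed.

Lemma row_inv i s u qs : ncr Q i -> idata i s u qs -> alt_row Q (ivert s qs) *m coxeter Q = - delta_mx 0 i.
Proof.
move=> nc D; apply: (coxeter_inv_row harr hrel) => w; have Vb := ivert_bound D.
have [R [[RP _] eR]] := inj_chain K harr hrel thr nc D.
rewrite (@alt_rowM _ _ _ (fun t => (npaths Q t w)%:R)) // => [|x]; last by rewrite mxE cartanE.
have -> : cartan Q i w = (\rank (mE (injmod K i) w))%:R by rewrite cartanE (rank_IB K (fun o => o == i) w).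
have z : mdim (rP R (size qs).+1) = 0%N by rewrite eR; apply: (PBs0 harr); rewrite nth_default // size_ivert.
rewrite (rank_presol w (injmod_mod K harr i) RP z) size_ivert.
by apply: eq_bigr => k _; rewrite eR (rank_PB K harr).
Qed.

(** The exact sequence at the crossing shows that the row is e_j - e_t1 - e_t2, with t1 and t2
    beyond j. *)
Lemma row_cross j : cross_spec j -> coxeter Q j j != 0 /\ forall x, (x < j)%N -> coxeter Q j x = 0.
Proof.
move=> cs; have [_ [t1 [t2 [C [CP e0 e1 z [/andP[lt1 b1] /andP[lt2 b2] ne]]]]]] := cross_res harr hrel thr gor cs.
have E x : coxeter Q j x = - (delta_mx 0 (Ordinal b1) + delta_mx 0 (Ordinal b2) - delta_mx 0 j : 'rV_n) 0 x.
  apply: (coxeter_row harr hrel) => w.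
  have rE (e : 'I_n) : ((delta_mx 0 e : 'rV[rat]_n) *m cartan Q) 0 w = (npaths Q w e)%:R by rewrite -rowE mxE cartanE.
  rewrite mulmxBl mulmxDl [LHS]mxE [X in _ + X]mxE [X in X + _]mxE !rE cartanE.
  have -> : npaths Q j w = \rank (mE (projmod K j) w) := esym (rank_PB K harr j w).
  rewrite (rank_icores w (projmod_mod K harr j) CP (z 2 isT)).
  rewrite !big_ord_recl big_ord0 /= e0 e1 rank_pair // expr0 expr1 mul1r mulN1r addr0 natrD.
  by rewrite (rank_IB K (fun o => o == j) w).
have dE (e y : 'I_n) : (delta_mx 0 e : 'rV[rat]_n) 0 y = (y == e)%:R by rewrite mxE eqxx.
have hd x : (x <= j)%N -> (x == Ordinal b1) = false /\ (x == Ordinal b2) = false.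
  by move=> xj; split; apply/eqP => e; move: xj; rewrite e /= leqNgt ?lt1 ?lt2.
split; [|move=> x xj]; rewrite E [X in - X]mxE [X in _ + X]mxE [X in X + _]mxE !dE.
  by have [-> ->] := hd j (leqnn _); rewrite eqxx !mulr0n mulr1n addr0 sub0r opprK oner_eq0.
have [-> ->] := hd x (ltnW xj); have -> : (x == j) = false by apply/eqP => e; rewrite e ltnn in xj.
by rewrite !mulr0n addr0 subr0 oppr0.
Qed.

(** The x_k strictly decrease, so nothing cancels in the alternating sum and its leftmost entry
    belongs to x_d. *)
Lemma first_ncr j v ps x : ncr Q j -> pdata j v ps -> last (ptgt j v) (map fst ps) = x ->
  coxeter Q j x != 0 /\ forall y : 'I_n, (y < x)%N -> coxeter Q j y = 0.
Proof.
move=> nc D ex; have dec := xs_dec D; have tr : transitive (fun o o' => o' < o)%N by move=> a b c h1 h2; apply: ltn_trans h2 h1.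
have uV : uniq (xs j v ps) by apply: (sorted_uniq tr) dec => o; rewrite ltnn.
have lV : nth n (xs j v ps) (size ps) = x by rewrite -ex (last_nth n) size_map.
have kV : (size ps < size (xs j v ps))%N by rewrite /= size_map.
split; first by rewrite (row_ncr nc D) (alt_row_uniq uV kV lV) oppr_eq0 signr_eq0.
move=> y yx; rewrite (row_ncr nc D) alt_row_out ?oppr0 //; apply/negP => yV.
rewrite -(nth_index n yV) in yx; have iV : (index (y : nat) (xs j v ps) < size (xs j v ps))%N by rewrite index_mem.
case: (ltngtP (index (y : nat) (xs j v ps)) (size ps)) => h.
- have := sorted_ltn_nth tr n dec _ _ iV kV h; rewrite lV => h'.
  by have := ltn_trans h' yx; rewrite ltnn.
- by move: iV; rewrite /= size_map ltnS leqNgt h.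
by rewrite h lV ltnn in yx.
Qed.

Lemma ivert_uniq i s u qs : idata i s u qs -> uniq (ivert s qs).
Proof.
move=> [sn gu us lm H]; have tr : transitive ltn by apply: ltn_trans.
apply: (sorted_uniq tr ltnn); rewrite /ivert; case: qs H => //= q qs [a [ai -> nz h]].
have g : good s (rcons u a) by apply: good_rcons; rewrite ?us.
have q0 : rcons u a != [::] by case: (u).
elim: qs s {sn gu us lm nz} (rcons u a) g q0 h => [|r qs IH] s' q' /= g q0.
  by move=> _; rewrite composable_lt //; case/andP: g.
by move=> [[gr r0 _] h]; rewrite composable_lt //=; [apply: IH h | case/andP: g].
Qed.

(** The permutation p sends j to x_d. If j occurred in the resolution of I(x_k) with k < d, [supp]
    would give that x_k is at most p(j) = x_d, against strict decrease. So the first alternative of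
    [pdata_main] always holds. *)
Lemma bruhat_regular P U2 : bruhat_dec (coxeter Q) 1%:M P U2 -> auslander_regular Q K.
Proof.
move=> [_ hU /is_perm_mxP[p ->]]; rewrite mul1mx => eC; have dU := trig_diag hU eC (coxeter_det harr hrel).
have CE a b : coxeter Q a b = U2 (p a) b by rewrite eC -row_permE mxE.
have last_p j v ps : ncr Q j -> pdata j v ps -> last (ptgt j v) (map fst ps) = p j.
  move=> nc D; have xn : (last (ptgt j v) (map fst ps) < n)%N.
    by have /allP := xs_bound D; apply; apply: mem_last.
  have [c0 cz] := first_ncr (x := Ordinal xn) nc D erefl; rewrite CE in c0.
  apply/eqP; rewrite eqn_leq; apply/andP; split.
    by rewrite leqNgt; apply/negP => lt; have := dU (p j); rewrite -CE cz ?eqxx.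
  by rewrite leqNgt; apply/negP => lt; rewrite hU ?eqxx in c0.
(* Let v be the alternating row of the resolution of I(i). Since v P U2 = -e_i has no entry before
   i, neither has vP, whose entry at p(j) is the sign of v at j. *)
have supp i j s u qs : ncr Q i -> idata i s u qs -> (j : nat) \in ivert s qs -> (i <= p j)%N.
  move=> nc D jV; rewrite leqNgt; apply/negP => lt.
  have := row_inv nc D; rewrite eC mulmxA => E.
  have [|h _] := @trig_solve _ U2 (alt_row Q (ivert s qs) *m perm_mx p) i hU dU.
    move=> c ci; have ne : (c == i) = false by apply/eqP => e; rewrite e ltnn in ci.
    by rewrite E !mxE ne andbF oppr0.
  have iV : (index (j : nat) (ivert s qs) < size (ivert s qs))%N by rewrite index_mem.
  have := h (p j) lt; suff -> : (alt_row Q (ivert s qs) *m perm_mx p) 0 (p j) = alt_row Q (ivert s qs) 0 j.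
    by rewrite (alt_row_uniq (ivert_uniq D) iV (nth_index n jV)) => /eqP; rewrite signr_eq0.
  have pE a b : perm_mx p a b = (p a == b)%:R :> rat by rewrite !mxE.
  rewrite mxE (bigD1 j) //= pE eqxx mulr1 big1 ?addr0 // => b bj.
  by rewrite pE (inj_eq perm_inj) (negbTE bj) mulr0.
apply: ar_of_bound => j v ps k s u qs nc D kp ncx Di.
have [|B _] := pdata_main harr hrel thr (ltn_ord j) nc D; last first.
  have nE : nth n (xs j v ps) k = nth 0%N (xs j v ps) k.
    by apply: set_nth_default; rewrite /= size_map ltnS; case/andP: kp.
  by rewrite nE in ncx Di; apply: B kp ncx _ _ _ Di.
move=> k' /andP[k0 kp'] ncx' s' u' qs' Di'; left; apply/negP => jV.
have xn : (nth 0%N (xs j v ps) k' < n)%N by case: Di' => sn _ <- _ _; apply: ptgt_bound.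
have := supp (Ordinal xn) j s' u' qs' ncx' Di' jV; rewrite /= -(last_p j v ps nc D) (last_nth 0%N) size_map leqNgt => /negP[].
have tr : transitive (fun o o' => o' < o)%N by move=> a b c h1 h2; apply: ltn_trans h2 h1.
have kV : (size ps < size (xs j v ps))%N by rewrite /= size_map.
exact: (sorted_ltn_nth tr 0%N (xs_dec D) _ _ (ltn_trans kp' kV) kV kp').
Qed.

(** The sequence at the crossing is the minimal projective resolution of I(x), and its last term
    P(x) is nonzero, so the dimension is exactly 1. *)
Lemma cross_ar_perm x : cross_spec x -> ar_perm_rel K x x.
Proof.
move=> cs d [pd pm] R' mR'; have [[R [mR e1 H]] _] := cross_res harr hrel thr gor cs.
have -> : d = 1%N.
  apply/eqP; rewrite eqn_leq; apply/andP; split; first by apply: pm; apply: cross_pdim.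
  rewrite lt0n; apply/eqP => d0; subst d.
  have := pdim_minimal (injmod_mod K harr x) (fun=> injmod_mod K harr x) mR (retract_id _) (fun=> pd) (ltnSn 0).
  rewrite e1 /= => s0; have : (x : nat, [::]) \in [seq r <- nzpaths Q | pstart r == x] by rewrite mem_filter mem_triv // /pstart eqxx.
  by rewrite (size0nil s0).
by have := min_iso 1 (injmod_mod K harr x) mR' mR; rewrite e1.
Qed.

(* The module I(x) has last syzygy P(j). *)
Definition thread_end j x := (ncr Q x /\ exists s u qs, idata x s u qs /\ iend s qs = j) \/ (cross_spec x /\ x = j).

Lemma thread_end_inj j j' x : thread_end j x -> thread_end j' x -> j = j'.
Proof.
move=> [[nc [s [u [qs [D e]]]]]|[cs e]] [[nc' [s' [u' [qs' [D' e']]]]]|[cs' e']].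
- by have [es _ eq] := idata_uniq thr nc D D'; subst s' qs'; apply: val_inj; rewrite /= -e -e'.
- by case: (ncr_cross nc cs').
- by case: (ncr_cross nc' cs).
by rewrite -e.
Qed.

Lemma thread_end_ar j x : thread_end j x -> ar_perm_rel K x j.
Proof.
move=> [[nc [s [u [qs [D e]]]]]|[cs e]]; first exact: (@ncr_ar_perm Q K harr hrel thr x s u qs j nc D e).
by rewrite -e; apply: cross_ar_perm.
Qed.

(** [ar_bound] supplies the second alternative of [pdata_main], so I(x_d) has last syzygy P(j).
    Injectivity follows because x determines this last syzygy. *)
Lemma regular_first : auslander_regular Q K -> exists f : 'I_n -> 'I_n,
  [/\ ssrfun.injective f, first_nonzero (coxeter Q) f & forall j, ar_perm_rel K (f j) j].
Proof.
move=> AR; have ex j : exists x, [/\ coxeter Q j x != 0, forall y : 'I_n, (y < x)%N -> coxeter Q j y = 0 & thread_end j x].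
  case: (ncrP thr (ltn_ord j)) => [nc|cs]; last first.
    have csj : cross_spec j by have -> : j = Ordinal (ltn_ord j) by apply: val_inj.
    by exists j; have [h1 h2] := row_cross csj; split=> //; right.
  have [v [ps D]] := pdata_ex harr hrel thr (ltn_ord j) nc.
  have xn : (last (ptgt j v) (map fst ps) < n)%N by have /allP := xs_bound D; apply; apply: mem_last.
  exists (Ordinal xn); have [h1 h2] := first_ncr (x := Ordinal xn) nc D erefl; split=> //; left.
  have [|_ [ncx [s [u [qs [Di _ e]]]]]] := pdata_main harr hrel thr (ltn_ord j) nc D; last by split=> //; exists s, u, qs.
  move=> k /andP[_ kp] ncx s u qs Di; right.
  have nE : nth 0%N (xs j v ps) k = nth n (xs j v ps) k.
    by apply: set_nth_default; rewrite /= size_map ltnS ltnW.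
  by rewrite nE in ncx Di; apply: ar_bound AR nc D ncx Di.
have [f Hf] := fin_all_exists ex; exists f; split.
- move=> j j' e; have [_ _ h1] := Hf j; have [_ _ h2] := Hf j'; rewrite e in h1.
  exact: thread_end_inj h1 h2.
- by move=> j; have [] := Hf j.
by move=> j; apply: thread_end_ar; have [] := Hf j.
Qed.

End Regular.

Theorem theorem4p11 (K : fieldType) (Q : monquiver) :
  quiver_connected Q -> acyclic Q -> monomial_admissible Q ->
  natural_labelling Q ->
  two_gorenstein Q K ->
  (auslander_regular Q K <->
     exists P U2 : 'M[rat]_(qn Q), bruhat_dec (coxeter Q) 1%:M P U2) /\
  (auslander_regular Q K ->
     forall U1 P U2 : 'M[rat]_(qn Q), bruhat_dec (coxeter Q) U1 P U2 ->
     forall i j : 'I_(qn Q), P j i != 0 -> ar_perm_rel K i j).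
Proof.
move=> _ _ adm lab gor.
have harr a : (@qsrc Q a < @qtgt Q a)%N by apply: (lab (qsrc a) [:: a]); rewrite //= eqxx.
have hrel r : r \in qrels Q -> (2 <= size r)%N by move=> /adm[].
split; first split.
- by move=> /(regular_first harr hrel gor)[f [fi ff _]]; apply: bruhat_exists fi ff.
- by move=> [P [U2 D]]; apply: (bruhat_regular harr hrel gor D).
(* A nonzero entry of P in row j and column i forces i = f j, whose last syzygy is P(j). *)
move=> /(regular_first harr hrel gor)[f [fi ff fa]] U1 P U2 D i j Pji.
by rewrite (bruhat_unique fi ff (coxeter_det harr hrel) D Pji); apply: fa.
Qed.
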